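(* Let $E_i$, $i\in T_e$, be an exceptional divisor of the minimal log resolution $\pi$ of the plane curve germ defined by $f$, and let $\omega\in\Omega^2_{\mathbb{C}^2,x}$ be a (nonzero) top differential form. Then there always exists $\omega'\in\Omega^2_{\mathbb{C}^2,x}$ with $\sigma_i(\omega')=\sigma_i(\omega)$ and such that $$-1\le \epsilon_{i_j}(\omega')\le 1\qquad\text{for all } j \text{ with } E_{i_j}\cap E_i\neq\emptyset .$$ Moreover, $\epsilon_{i_j}(\omega')=-1$ only occurs if $r_i=1$, or $r_i=2$, or $r_i=3$ with $E_i$ satellite and $$N_i=\lambda N_i(C_i),\quad N_{i_1}=\lambda N_{i_1}(C_i),\quad N_{i_2}=\lambda N_{i_2}(C_i)\qquad\text{for some }\lambda\in\mathbb{Z}_{>0}.$$ Similarly, $\epsilon_{i_j}(\omega')=1$ only occurs for $E_{i_1}$, resp. $E_{i_2}$ (that is, $j=1$, resp. $j=2$), and only if there are no arrowheads in the connected component of $\Delta_\pi\setminus\{E_i\}$ containing $E_{i_1}$, resp. $E_{i_2}$.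
   Context: Let $f:(\mathbb{C}^2,x)\to(\mathbb{C},0)$ be a germ of a holomorphic function defining a plane curve germ $C$, not necessarily reduced or irreducible, and let $\pi:(Y,E)\to(\mathbb{C}^2,x)$ be its minimal log resolution, with exceptional locus $E$. Write $F_\pi=\mathrm{Div}(\pi^*f)=\sum_{i\in T}N_iE_i$ and $K_\pi=\mathrm{Div}(\det\mathrm{Jac}\,\pi)=\sum_{i\in T}(k_i-1)E_i$, where $T=T_e\sqcup T_s$, $T_e$ indexes the exceptional components and $T_s$ the components of the strict transform of $C$ (so $k_i=1$ for $i\in T_s$). $E_0$ is the first exceptional divisor (from blowing up $x$). Dual graph $\Delta_\pi$: one vertex for each $E_i$, $i\in T_e$; an edge for each intersection of two exceptional components; an arrowhead for each $E_k$, $k\in T_s$, attached to the vertex of the exceptional divisor it meets. $r_i$ is the number of components of $F_\pi$ different from $E_i$ that intersect $E_i$. An exceptional divisor is satellite if the center of the blow-up producing it is the intersection of two exceptional divisors. For $i\in T$ and $g\in\mathscr{O}_{\mathbb{C}^2,x}$ nonzero, $v_i(g)$ is the order of vanishing of $\pi^*g$ along $E_i$. For $\omega=g\,\mathrm{d}x$ ($\mathrm{d}x$ the standard volume form, $g\ne0$), $\sigma_i(\omega)=-\frac{k_i+v_i(g)}{N_i}$. Adjacent divisors: the components of $F_\pi$ adjacent to $E_i$, $i \in T_e$, are denoted $E_{i_1},\dots,E_{i_{m_i}}$ ($i_j\in T$, $m_i\ge3$, some possibly zero, i.e. absent), where $E_{i_1},E_{i_2}$ are those lying on the paths of $\Delta_\pi$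 connecting $E_i$ with divisors created before $E_i$; $E_{i_2}$ is on the path from $E_i$ to $E_0$. If there is no such $E_{i_1}$ one sets $E_{i_1}=0$; $E_{i_2}=0$ only if $E_i=E_0$. The residue numbers of $\omega=g\,\mathrm{d}x$ at $E_i$ are $\epsilon_{i_j}(\omega)=N_{i_j}\sigma_i(\omega)+k_{i_j}+v_{i_j}(g)$, $j=1,\dots,m_i$, and $\epsilon_{i_j}(\omega)=1$ by convention if $E_{i_j}=0$. $C_i$ is a germ of a branch whose strict transform intersects $E_i$ transversally at a general point; $N_k(C_i)$ is the multiplicity along $E_k$ of the pull-back under $\pi$ of an equation of $C_i$. *)

(* Defs.v *)
From HB Require Import structures.
From mathcomp Require Import all_boot all_order all_algebra.
From mathcomp Require Import boolp classical_sets functions cardinality reals.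
From mathcomp Require Import complex.

Set Implicit Arguments.
Unset Strict Implicit.
Unset Printing Implicit Defensive.

Import Order.TTheory GRing.Theory Num.Theory.
Local Open Scope ring_scope.
Local Open Scope complex_scope.

(** The local ring O_(C^2,x) = C{u,v}: arrays [a] of Taylor coefficients, [a m n]
    being the coefficient of u^m v^n, that satisfy a Cauchy estimate (equivalently
    the power series converges in a neighbourhood of the origin). *)

Section Convergence.
Variable R : realType.
Local Notation C := R[i].
Implicit Types a b : nat -> nat -> C.

Definition convergent a : Prop :=
  exists M r : R, forall m n, `|a m n| <= (M * r ^+ (m + n))%:C.

Definition conv_pred : {pred (nat -> nat -> C)} := fun a => `[< convergent a >].

Lemma convI a (M r : C) : 0 <= M -> 0 <= r ->
  (forall m n, `|a m n| <= M * r ^+ (m + n)) -> convergent a.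
Proof.
move=> M0 r0 H; exists (complex.Re M), (complex.Re r) => m n.
have e (z : C) : 0 <= z -> (complex.Re z)%:C = z by move=> z0; rewrite RRe_real ?ger0_real.
by rewrite rmorphM rmorphXn /= !e.
Qed.

Lemma convE a : convergent a ->
  exists2 K : C, 1 <= K & forall m n, `|a m n| <= K ^+ (m + n).+1.
Proof.
case=> M [r H]; exists (1 + `|M| + `|r|)%:C.
  by rewrite -[1]/(1%:C) lecR -addrA lerDl addr_ge0.
move=> m n; apply: le_trans (H m n) _.
rewrite -rmorphXn /= lecR exprS.
apply: le_trans (ler_norm _) _; rewrite normrM normrX.
apply: ler_pM; rewrite ?exprn_ge0 //.
  by rewrite addrAC lerDr addr_ge0.
by apply: lerXn2r; rewrite ?nnegrE ?addr_ge0 // lerDr addr_ge0.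
Qed.

Lemma conv_zmod : zmod_closed conv_pred.
Proof.
split; first by apply/asboolP; exists 0, 0 => m n; rewrite normr0 mul0r.
move=> a b /asboolP/convE[K K1 Ha] /asboolP/convE[L L1 Hb].
have K0 := le_trans ler01 K1; have L0 := le_trans ler01 L1.
have Q0 : 0 <= K + L by rewrite addr_ge0.
apply/asboolP/(@convI _ (2 * (K + L)) (K + L)) => // [|m n].
  by rewrite mulr_ge0.
rewrite -mulrA -exprS mulr_natl mulr2n.
apply: le_trans (ler_normB _ _) _; apply: lerD.
- apply: le_trans (Ha m n) _; apply: lerXn2r; rewrite ?nnegrE ?lerDl //.
- apply: le_trans (Hb m n) _; apply: lerXn2r; rewrite ?nnegrE ?lerDr //.
Qed.
HB.instance Definition _ := GRing.isZmodClosed.Build (nat -> nat -> C) conv_pred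
  conv_zmod.

Record germ := Germ { coef :> nat -> nat -> C; _ : conv_pred coef }.
HB.instance Definition _ := [isSub for coef].
HB.instance Definition _ := [Choice of germ by <:].
HB.instance Definition _ := [SubChoice_isSubZmodule of germ by <:].

Definition mk_germ a (H : convergent a) : germ := Germ (asboolT H).

Lemma coefC (f : germ) : convergent f.
Proof. by case: f => a /= /asboolP. Qed.

Lemma germ_eq (f g : germ) : (forall m n, f m n = g m n) -> f = g.
Proof. by move=> H; apply/val_inj/funext => m; apply/funext => n; apply: H. Qed.

Definition cauchy a b : nat -> nat -> C := fun m n =>
  \sum_(i < m.+1) \sum_(j < n.+1) a i j * b (m - i)%N (n - j)%N.

Lemma ltn2X n : (n.+1 <= 2 ^ n)%N.
Proof. exact: ltn_expl. Qed.

Lemma conv_cauchy a b : convergent a -> convergent b -> convergent (cauchy a b).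
Proof.
move=> /convE[K K1 Ha] /convE[L L1 Hb].
have K0 := le_trans ler01 K1; have L0 := le_trans ler01 L1.
have KL : 1 <= K * L by rewrite mulr_ege1.
have KL0 := le_trans ler01 KL.
apply: (@convI _ (K * L) (2 * (K * L))); rewrite ?mulr_ge0 // => m n.
apply: (@le_trans _ _ (\sum_(i < m.+1) \sum_(j < n.+1) (K * L) ^+ (m + n).+1)).
  apply: le_trans (ler_norm_sum _ _ _) _; apply: ler_sum => i _.
  apply: le_trans (ler_norm_sum _ _ _) _; apply: ler_sum => j _.
  rewrite normrM exprMn; apply: ler_pM => //.
    apply: le_trans (Ha _ _) _; apply: ler_weXn2l => //.
    by rewrite ltnS leq_add // -ltnS.
  apply: le_trans (Hb _ _) _; apply: ler_weXn2l => //.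
  by rewrite ltnS leq_add // leq_subr.
rewrite !sumr_const !card_ord -mulrnA [leRHS]mulrC [(2 * _) ^+ _]exprMn.
rewrite -mulrA -exprSr -[leLHS]mulr_natl.
apply: ler_wpM2r; first by rewrite exprn_ge0.
by rewrite -natrX ler_nat expnD mulnC leq_mul // ltn2X.
Qed.

Definition germ_mul (f g : germ) : germ := mk_germ (conv_cauchy (coefC f) (coefC g)).

Definition monom p q : nat -> nat -> C := fun m n => ((m == p) && (n == q))%:R.

Lemma conv_monom p q : convergent (monom p q).
Proof.
exists 1, 1 => m n; rewrite expr1n mulr1 /monom.
by case: (_ && _); rewrite ?normr0 ?normr1 -?[1%:C]/(1 : C) ?ler01.
Qed.

Definition germ_monom p q : germ := mk_germ (conv_monom p q).

Definition trunc N a : {poly {poly C}} := \poly_(i < N) \poly_(j < N) a i j.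

Lemma truncE N a m n : (m < N)%N -> (n < N)%N -> (trunc N a)`_m`_n = a m n.
Proof. by move=> mN nN; rewrite coef_poly mN coef_poly nN. Qed.

Lemma coefM2 (p q : {poly {poly C}}) m n :
  (p * q)`_m`_n = cauchy (fun i j => p`_i`_j) (fun i j => q`_i`_j) m n.
Proof.
rewrite coefM coef_sum; apply: eq_bigr => i _.
by rewrite coefM.
Qed.

Lemma eq_cauchy a b a' b' m n :
  (forall i j, (i <= m)%N -> (j <= n)%N -> a i j = a' i j) ->
  (forall i j, (i <= m)%N -> (j <= n)%N -> b i j = b' i j) ->
  cauchy a b m n = cauchy a' b' m n.
Proof.
move=> Ha Hb; apply: eq_bigr => i _; apply: eq_bigr => j _.
by rewrite Ha ?Hb ?leq_subr // -ltnS.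
Qed.

Lemma cauchy_trunc a b m n N : (m < N)%N -> (n < N)%N ->
  cauchy a b m n = (trunc N a * trunc N b)`_m`_n.
Proof.
move=> mN nN; rewrite coefM2; apply: eq_cauchy => i j im jn;
  by rewrite truncE //; [apply: leq_ltn_trans mN|apply: leq_ltn_trans nN].
Qed.

Lemma germ_mulA : associative germ_mul.
Proof.
move=> f g h; apply: germ_eq => m n /=.
pose N := (m + n).+1.
have lt i j : (i <= m)%N -> (j <= n)%N -> (i < N)%N * (j < N)%N.
  by move=> im jn; rewrite !ltnS (leq_trans im) ?leq_addr // (leq_trans jn) ?leq_addl.
transitivity (trunc N f * trunc N g * trunc N h)`_m`_n.
  rewrite -mulrA coefM2; apply: eq_cauchy => i j im jn.
    by rewrite truncE ?lt // (lt i j).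
  by rewrite -cauchy_trunc ?(lt i j).
rewrite coefM2; apply: eq_cauchy => i j im jn.
  by rewrite -cauchy_trunc ?(lt i j).
by rewrite truncE // (lt i j).
Qed.

Lemma germ_mulC : commutative germ_mul.
Proof.
move=> f g; apply: germ_eq => m n /=.
by rewrite !(@cauchy_trunc _ _ _ _ (m + n).+1) 1?mulrC // ltnS ?leq_addr ?leq_addl.
Qed.

Lemma germ_mul1 : left_id (germ_monom 0 0) germ_mul.
Proof.
move=> f; apply: germ_eq => m n /=.
rewrite /cauchy (bigD1 ord0) //= (bigD1 ord0) //= /monom eqxx mul1r !subn0.
rewrite big1 ?addr0 => [|j /negPf j0]; last by rewrite (_ : _ == _ = false) ?mul0r.
rewrite big1 ?addr0 // => i /negPf i0; rewrite big1 // => j _.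
by rewrite (_ : (_ == _) = false) ?mul0r.
Qed.

Lemma germ_mulD : left_distributive germ_mul +%R.
Proof.
move=> f g h; apply: germ_eq => m n /=.
rewrite -[LHS]/(cauchy _ _ m n) -[RHS]/(cauchy _ _ m n + cauchy _ _ m n).
rewrite -big_split; apply: eq_bigr => i _; rewrite -big_split.
by apply: eq_bigr => j _ /=; rewrite mulrDl.
Qed.

Lemma germ_1_neq0 : germ_monom 0 0 != 0.
Proof.
apply/eqP => /(congr1 (fun f : germ => f 0%N 0%N)) /eqP.
by rewrite -[X in _ == X]/(0 : C) /= /monom oner_eq0.
Qed.

HB.instance Definition _ := GRing.Zmodule_isComNzRing.Build germ
  germ_mulA germ_mulC germ_mul1 germ_mulD germ_1_neq0.

Definition germ_unit : {pred germ} := fun f => `[< exists g, g * f = 1 >].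
Definition germ_inv (f : germ) : germ :=
  if f \in germ_unit then xget 0 [set g | g * f = 1]%classic else f.

Lemma germ_mulVx : {in germ_unit, left_inverse 1 germ_inv *%R}.
Proof.
move=> f fu; rewrite /germ_inv fu; move/asboolP: fu => [g gf].
by case: xgetP => [h _ //|/(_ g)/(_ gf)].
Qed.
Lemma germ_unitPl (f g : germ) : g * f = 1 -> germ_unit f.
Proof. by move=> H; apply/asboolP; exists g. Qed.
Lemma germ_invr_out : {in [predC germ_unit], germ_inv =1 id}.
Proof. by move=> f; rewrite inE /= /germ_inv => /negPf ->. Qed.

HB.instance Definition _ := GRing.ComNzRing_hasMulInverse.Build germ
  germ_mulVx germ_unitPl germ_invr_out.

Lemma conv_du (f : germ) : convergent (fun m n => f m.+1 n *+ m.+1).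
Proof.
have [K K1 Ha] := convE (coefC f); have K0 := le_trans ler01 K1.
apply: (@convI _ (K ^+ 2) (2 * K)); rewrite ?exprn_ge0 ?mulr_ge0 // => m n.
rewrite normrMn exprMn mulrCA -exprD -[leLHS]mulr_natl add2n -addSn -natrX.
apply: ler_pM => //.
by rewrite ler_nat (leq_trans (ltn2X m)) // leq_exp2l // leq_addr.
Qed.

Lemma conv_dv (f : germ) : convergent (fun m n => f m n.+1 *+ n.+1).
Proof.
have [K K1 Ha] := convE (coefC f); have K0 := le_trans ler01 K1.
apply: (@convI _ (K ^+ 2) (2 * K)); rewrite ?exprn_ge0 ?mulr_ge0 // => m n.
rewrite normrMn exprMn mulrCA -exprD -[leLHS]mulr_natl add2n -addnS -natrX.
apply: ler_pM => //.
by rewrite ler_nat (leq_trans (ltn2X n)) // leq_exp2l // leq_addl.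
Qed.

Definition du (f : germ) : germ := mk_germ (conv_du f).
Definition dv (f : germ) : germ := mk_germ (conv_dv f).

(** Pull-back under the two charts of the blow-up of the origin:
    (u,v) |-> (u, u(v+c)), centred at the point of direction c, and
    (u,v) |-> (uv, v), centred at the point of direction infinity. *)

Definition coef_fin (c : C) a : nat -> nat -> C := fun m n =>
  \sum_(j < m.+1) a (m - j)%N j * c ^+ (j - n) *+ 'C(j, n).

Definition coef_inf a : nat -> nat -> C := fun m n =>
  if (m <= n)%N then a m (n - m)%N else 0.

Lemma bin_le_2X j n : ('C(j, n) <= 2 ^ j)%N.
Proof.
elim: j n => [|j IH] [|n] //; first by rewrite bin0 expn_gt0.
by rewrite binS expnS mul2n -addnn leq_add.
Qed.

Lemma conv_coef_fin c (f : germ) : convergent (coef_fin c f).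
Proof.
have [K K1 Ha] := convE (coefC f); have K0 := le_trans ler01 K1.
pose D : C := 1 + `|c|; have D1 : 1 <= D by rewrite lerDl.
have D0 := le_trans ler01 D1.
have KD1 : 1 <= 2 * (2 * (K * D)) by rewrite !mulr_ege1 ?ler1n.
apply: (@convI _ K (2 * (2 * (K * D)))); rewrite ?mulr_ge0 // => m n.
apply: (@le_trans _ _ (K * (2 * (2 * (K * D))) ^+ m)); last first.
  by apply: ler_wpM2l => //; apply: ler_weXn2l; rewrite ?leq_addr.
apply: (@le_trans _ _ (\sum_(j < m.+1) (K ^+ m.+1 * D ^+ m) *+ 2 ^ m)).
  apply: le_trans (ler_norm_sum _ _ _) _; apply: ler_sum => j _.
  have jm : (j <= m)%N by rewrite -ltnS.
  rewrite normrMn -[leLHS]mulr_natr -[leRHS]mulr_natr.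
  apply: ler_pM => //; last first.
    by rewrite ler_nat (leq_trans (bin_le_2X j n)) // leq_exp2l.
  rewrite normrM normrX; apply: ler_pM; rewrite ?exprn_ge0 //.
    by apply: le_trans (Ha _ _) _; rewrite subnK.
  apply: (@le_trans _ _ (D ^+ (j - n))).
    by apply: lerXn2r; rewrite ?nnegrE // lerDr.
  by apply: ler_weXn2l => //; rewrite (leq_trans (leq_subr _ _)).
rewrite sumr_const card_ord -mulrnA -[leLHS]mulr_natl natrM natrX.
rewrite [(2 * _) ^+ _]exprMn [(2 * (K * D)) ^+ _]exprMn [(K * D) ^+ _]exprMn exprS.
rewrite -!mulrA mulrCA [X in _ <= X]mulrCA; apply: ler_wpM2l; first exact: exprn_ge0.
rewrite [leLHS]mulrCA; apply: ler_wpM2l => //.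
rewrite [leLHS]mulrCA; apply: ler_wpM2l; first exact: exprn_ge0.
by apply: ler_wpM2r; rewrite ?exprn_ge0 // -natrX ler_nat ltn2X.
Qed.

Lemma conv_coef_inf (f : germ) : convergent (coef_inf f).
Proof.
have [K K1 Ha] := convE (coefC f); have K0 := le_trans ler01 K1.
apply: (@convI _ K K) => // m n; rewrite -exprS /coef_inf.
case: leqP => mn; last by rewrite normr0 exprn_ge0.
apply: le_trans (Ha _ _) _; rewrite subnKC //.
by apply: ler_weXn2l; rewrite ?ltnS ?leq_addl.
Qed.

(** A direction is a point of P^1(C); [None] is the direction of {u = 0}. *)
Definition direction := option C.

Definition blow (d : direction) (f : germ) : germ :=
  if d is Some c then mk_germ (conv_coef_fin c f) else mk_germ (conv_coef_inf f).

End Convergence.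

Arguments germ_monom {R} p q.

Section Resolution.
Variable R : realType.
Local Notation C := R[i].
Local Notation germ := (germ R).
Implicit Types (f g h x y : germ).

(** Conventions: [f] defines the curve germ C, [s] is the sequence of centers of the
    resolution pi : Y -> (C^2,x), F_pi = Div(pi^* f) = sum N_i E_i and
    Div(det Jac pi) = sum (k_i - 1) E_i. A top form g dx is represented by its
    coefficient [g]; v_i(g) is the order of vanishing of pi^* g along E_i. *)

Definition coord_u : germ := germ_monom 1 0.
Definition coord_v : germ := germ_monom 0 1.

Definition jacobian x y : germ := du x * dv y - dv x * du y.

Definition coordinate_system x y : Prop :=
  [/\ x 0%N 0%N = 0, y 0%N 0%N = 0 & jacobian x y 0%N 0%N != 0].

Definition irreducible_germ h : Prop :=
  [/\ h != 0, h \isn't a GRing.unit &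
      forall a b, h = a * b -> a \is a GRing.unit \/ b \is a GRing.unit].

Definition divides h g : Prop := exists k, g = h * k.

Definition principal h : set germ := [set g | divides h g]%classic.

(** The largest [n] with [g] in the [n]-th power of the principal ideal [J]
    (for [g != 0] and [J] proper). *)
Definition ideal_order (J : set germ) g : nat :=
  xget 0%N [set n | exists h,
    [/\ J = principal h, divides (h ^+ n) g & ~ divides (h ^+ n.+1) g]]%classic.

(** Points infinitely near to x, as the sequence of directions of the successive
    blow-ups, the latest one first; [[::]] is x itself. The point [d :: q] lies on
    the exceptional divisor of the blow-up of [q]. *)
Definition infpoint := seq (direction R).

(** The germ at [q] of the pull-back, in the coordinates of the standard chart. *)
Fixpoint pull (q : infpoint) g : germ :=
  if q is d :: q' then blow d (pull q' g) else g.

Definition jac (q : infpoint) : germ := jacobian (pull q coord_u) (pull q coord_v).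

(** The exceptional divisors whose germs at [q] are {u = 0} and {v = 0}, if any; the
    exceptional divisor of the blow-up of [p] and all its strict transforms are
    designated by their center [p]. *)
Fixpoint axes (q : infpoint) : option infpoint * option infpoint :=
  match q with
  | [::] => (None, None)
  | Some c :: q' => (Some q', if c == 0 then (axes q').2 else None)
  | None :: q' => ((axes q').1, Some q')
  end.

Definition exc_eq (p q : infpoint) : option germ :=
  if (axes q).1 == Some p then Some coord_u
  else if (axes q).2 == Some p then Some coord_v else None.

(** The center [p] is the intersection of two exceptional divisors. *)
Definition satellite (p : infpoint) : Prop :=
  exists p1 p2, axes p = (Some p1, Some p2).

(** A composition of point blow-ups over x, given by the sequence [s] of its centers
    in the order in which they are blown up. *)
Definition blowups (s : seq infpoint) : Prop :=
  uniq s /\ forall n, (n < size s)%N ->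
    match nth [::] s n with [::] => True | _ :: q => q \in take n s end.

(** The points over x of the surface Y obtained from [s]. *)
Definition on_Y (s : seq infpoint) (q : infpoint) : Prop :=
  q \notin s /\ match q with [::] => True | _ :: q' => q' \in s end.

Definition normal_crossing g : Prop :=
  exists w x y a b, [/\ w \is a GRing.unit, coordinate_system x y &
    g = w * x ^+ a * y ^+ b].

Definition log_resolution f (s : seq infpoint) : Prop :=
  blowups s /\ forall q, on_Y s q -> normal_crossing (pull q f).

(** Every log resolution factors through the minimal one. *)
Definition minimal_log_resolution f (s : seq infpoint) : Prop :=
  log_resolution f s /\ forall s', log_resolution f s' -> {subset s <= s'}.

(** [Exc p] is the exceptional divisor with center [p]; [Str q J] is the germ at [q]
    of a curve with (principal, prime) ideal [J]. *)
Inductive divisor := Exc of infpoint | Str of infpoint & set germ.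

(** The components of F_pi, i.e. the index set T. *)
Definition component f (s : seq infpoint) (D : divisor) : Prop :=
  match D with
  | Exc p => p \in s
  | Str q J => on_Y s q /\ exists h,
      [/\ irreducible_germ h, J = principal h, divides h (pull q f) &
          forall p e, exc_eq p q = Some e -> J <> principal e]
  end.

Definition through (D : divisor) (q : infpoint) : Prop :=
  match D with Exc p => exc_eq p q <> None | Str q' _ => q = q' end.

(** A point of the divisor and its local ideal there. At the point [Some 0 :: p] (which
    may be blown up later on) the divisor [Exc p] is {u = 0}. *)
Definition base (D : divisor) : infpoint :=
  match D with Exc p => Some 0 :: p | Str q _ => q end.
Definition local_ideal (D : divisor) : set germ :=
  match D with Exc _ => principal coord_u | Str _ J => J end.

(** [vord D g] is v_i(g), so that N_i is [vord D f]; [knum D] is k_i. *)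
Definition vord (D : divisor) g : nat := ideal_order (local_ideal D) (pull (base D) g).

Definition knum (D : divisor) : nat := (ideal_order (local_ideal D) (jac (base D))).+1.

Definition ovord (E : option divisor) g : nat := if E is Some D then vord D g else 0%N.

Definition sigma f (p : infpoint) g : rat :=
  - ((knum (Exc p) + vord (Exc p) g)%:R / (vord (Exc p) f)%:R).

Definition residue f (p : infpoint) g (E : option divisor) : rat :=
  if E is Some D then (vord D f)%:R * sigma f p g + (knum D)%:R + (vord D g)%:R else 1.

Definition meet (s : seq infpoint) (D D' : divisor) : Prop :=
  exists q, [/\ on_Y s q, through D q & through D' q].

Definition adjacent f (s : seq infpoint) (p : infpoint) (D : divisor) : Prop :=
  [/\ component f s D, D <> Exc p & meet s (Exc p) D].

(** The number r_i of components of F_pi other than E_i that meet E_i is [n]. *)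
Definition valency f (s : seq infpoint) (p : infpoint) (n : nat) : Prop :=
  ([set D | adjacent f s p D]%classic #= `I_n)%card.

(** The edges of the dual graph; its vertices are the elements of [s]. *)
Definition edge (s : seq infpoint) : rel infpoint := fun p q =>
  [&& p \in s, q \in s, p != q & `[< meet s (Exc p) (Exc q) >]].

(** [p'] is the vertex following [p] on the path from [p] to [t]. *)
Definition towards (s : seq infpoint) (p t p' : infpoint) : Prop :=
  exists ps, [/\ path (edge s) p (p' :: ps), uniq (p :: p' :: ps) & last p' ps = t].

Definition created_before (s : seq infpoint) (t p : infpoint) : Prop :=
  (index t s < index p s)%N.

(** [adj] lists the adjacent components E_(i_1), E_(i_2), ..., E_(i_m) of E_i = [Exc p],
    [None] standing for 0. Positions are shifted by one: E_(i_1) and E_(i_2) are at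
    positions 0 and 1. The first divisor E_0 is [Exc [::]]. *)
Definition adjacent_labelling f (s : seq infpoint) (p : infpoint)
    (adj : seq (option divisor)) : Prop :=
  [/\ (3 <= size adj)%N,
      forall D, adjacent f s p D <-> exists j, nth None adj j = Some D,
      forall j j' D, nth None adj j = Some D -> nth None adj j' = Some D -> j = j',
      forall D, nth None adj 1 = Some D <->
        exists2 p', D = Exc p' & towards s p [::] p' &
      forall D, nth None adj 0 = Some D <->
        exists2 p', D = Exc p' & ~ towards s p [::] p' /\
          exists t, [/\ t \in s, created_before s t p & towards s p t p']].

(** There are no arrowheads in the connected component containing [p'] of the dual
    graph deprived of its vertex [p]. *)
Definition no_arrowheads f (s : seq infpoint) (p p' : infpoint) : Prop :=
  forall ps, path (edge s) p' ps -> p \notin p' :: ps ->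
    forall q J, component f s (Str q J) -> ~ meet s (Exc (last p' ps)) (Str q J).

(** [h] is an irreducible germ whose strict transform meets [Exc p] transversally at a
    point lying on no other component of F_pi. *)
Definition curvette f (s : seq infpoint) (p : infpoint) h : Prop :=
  irreducible_germ h /\
  exists q e n y,
    [/\ on_Y s q, exc_eq p q = Some e,
        forall D, component f s D -> through D q -> D = Exc p,
        pull q h = e ^+ n * y & coordinate_system e y].

End Resolution.

Arguments Exc {R} p.
Arguments Str {R} q J.

(* Main.v *)
(** Let N, v, k be the orders of f and g along E_i = Exc p and the number k_i. The surface has
    one point over each direction d at p; if g is monomial there in the equations of E_i and
    of the adjacent component, then the residue number of that component is kappa + a - s c
    with s = (k + v) / N, where c and a are the orders of the leading forms of f and g in the
    direction d, and kappa is the number k of the older divisor of direction d (1 if there is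
    none). The orders of a leading form add up to the multiplicity, so one looks for numbers
    a of sum v, realized by a form, that put all the residue numbers in the right windows.

    The forms used are products of curvettes, obtained by descending smooth germs through the
    blow-ups with Weierstrass preparation, and of a germ that is a monomial in the older axes
    at p. By a Newton polygon argument the exponents of such monomials are governed by toric
    weights and by the semigroup of values of the divisor E_b of the last free point; all w
    with w + k_b > n_b, where n_b is the order of a curvette of E_b, are in this semigroup, and
    this is what makes the required monomial exist.

    For the absence of arrowheads, let n_k be the orders of a general curvette H of E_i. If
    N_k / n_k is minimal at k <> i, then adding up the orders of the leading forms shows that
    no strict transform meets E_k and that the ratio is minimal at all its neighbours too.
    So the minimum is attained at E_i, and if it is attained at an adjacent divisor, then it
    is attained on its whole connected component. *)
Require Import Defs.
From HB Require Import structures.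
From mathcomp Require Import all_boot all_order all_algebra.
From mathcomp Require Import boolp classical_sets functions cardinality reals.
From mathcomp Require Import complex.
From mathcomp Require Import zify ring lra.

Set Implicit Arguments.
Unset Strict Implicit.
Unset Printing Implicit Defensive.

Import Order.TTheory GRing.Theory Num.Theory.
Local Open Scope ring_scope.
Local Open Scope complex_scope.

(** The form omega' keeps sigma exactly when its pull-back at the center of E_i has the same
    multiplicity as that of omega, so the residue numbers may only be shifted by integers of
    prescribed total. The obstacle is that the exponents on the two older axes are not free: once
    curvettes of E_i are taken out, they come from a pair (W, T) with T >= 0 and W in the semigroup
    of E_b. Let q_1, q_2 be the residue numbers in the older directions, c_1, c_2 the orders of f
    there, x_1, x_2 those of a curvette of E_i, n = x_1 + x_2 + 1 its value, s = - sigma, and al, P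
    the values at E_i of an equation and of a curvette of E_b. Unimodularity of the weights gives al
    (W + k_b - n_b) = n q_1 + s (c_1 n - x_1 N) and P (T + 1) = n q_2 + s (c_2 n - x_2 N). The
    Newton polygon of f makes c n >= x N. If this is strict, the window [0, 1) suffices; only
    equality calls for (0, 1]. Equality is also the criterion for the absence of arrowheads, which
    is why the value 1 and the missing arrowheads occur together. *)

Section GermAlgebra.
Variable R : realType.
Local Notation germ := (germ R).
Implicit Types (f g h x y G H : germ) (d : direction R).

Local Notation u := (coord_u R).
Local Notation v := (coord_v R).

(** * The ring of germs and lexicographically lowest monomials *)

Lemma germD f g m n : (f + g) m n = f m n + g m n. Proof. by []. Qed.
Lemma germN f m n : (- f) m n = - f m n. Proof. by []. Qed.
Lemma germB f g m n : (f - g) m n = f m n - g m n. Proof. by []. Qed.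
Lemma germ0 m n : (0 : germ) m n = 0. Proof. by []. Qed.
Lemma germ1 m n : (1 : germ) m n = ((m == 0%N) && (n == 0%N))%:R. Proof. by []. Qed.
Lemma germM f g m n :
  (f * g) m n = \sum_(i < m.+1) \sum_(j < n.+1) f i j * g (m - i)%N (n - j)%N.
Proof. by []. Qed.
Lemma germM00 f g : (f * g) 0%N 0%N = f 0%N 0%N * g 0%N 0%N.
Proof. by rewrite germM !big_ord1. Qed.

Lemma germ_sum (I : Type) (r : seq I) (P : pred I) (F : I -> germ) m n :
  (\sum_(i <- r | P i) F i) m n = \sum_(i <- r | P i) F i m n.
Proof.
by elim/big_rec2: _ => // i y1 y2 _ <-; rewrite germD.
Qed.

Lemma germ_monomM a b f m n : (germ_monom a b * f) m n =
  if (a <= m)%N && (b <= n)%N then f (m - a)%N (n - b)%N else 0.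
Proof.
rewrite germM; case: ifP => [/andP[am bn]|H].
  rewrite (bigD1 (Ordinal (am : (a < m.+1)%N))) //=.
  rewrite (bigD1 (Ordinal (bn : (b < n.+1)%N))) //=.
  rewrite /monom !eqxx mul1r big1 ?addr0 => [|j /negPf nj]; last first.
    by rewrite -val_eqE /= in nj; rewrite nj mul0r.
  rewrite big1 ?addr0 // => i /negPf ni; rewrite -val_eqE /= in ni.
  by rewrite big1 // => j _; rewrite ni mul0r.
rewrite big1 // => i _; rewrite big1 // => j _ /=; rewrite /monom.
case: eqP => [ia|]; rewrite ?mul0r //; case: eqP => [jb|]; rewrite ?mul0r //.
by move: H; rewrite -ia -jb; have := ltn_ord i; have := ltn_ord j; lia.
Qed.

Lemma monom_uv a b : germ_monom a b = u ^+ a * v ^+ b.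
Proof.
have mm p q p' q' : germ_monom p q * germ_monom p' q' = germ_monom (p + p')%N (q + q')%N :> germ.
  apply: germ_eq => m n; rewrite germ_monomM /= /monom.
  case: ifP => [/andP[pm qn]|H].
    by congr (_ && _)%:R; apply/eqP/eqP; lia.
  by case: andP => // -[/eqP h1 /eqP h2]; lia.
have ue k : u ^+ k = germ_monom k 0.
  by elim: k => [|k IH] //; rewrite exprS IH mm.
have ve k : v ^+ k = germ_monom 0 k.
  by elim: k => [|k IH] //; rewrite exprS IH mm.
by rewrite ue ve mm addn0.
Qed.

Lemma uXE a f m n : (u ^+ a * f) m n = if (a <= m)%N then f (m - a)%N n else 0.
Proof.
have -> : u ^+ a = germ_monom a 0 :> germ by rewrite monom_uv expr0 mulr1.
by rewrite germ_monomM andbT subn0.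
Qed.

Lemma vXE b f m n : (v ^+ b * f) m n = if (b <= n)%N then f m (n - b)%N else 0.
Proof.
have -> : v ^+ b = germ_monom 0 b :> germ by rewrite monom_uv expr0 mul1r.
by rewrite germ_monomM /= subn0.
Qed.

Lemma uM f m n : (u * f) m n = if (0 < m)%N then f m.-1 n else 0.
Proof. by rewrite -[u]expr1 uXE subn1. Qed.
Lemma vM f m n : (v * f) m n = if (0 < n)%N then f m n.-1 else 0.
Proof. by rewrite -[v]expr1 vXE subn1. Qed.

(** The lexicographically lowest monomial: [i] is the order along {u = 0}, and [j] the
    intersection number of {u = 0} with the residual curve. *)
Definition lexlow G i j : Prop :=
  [/\ G i j != 0, forall i' j', (i' < i)%N -> G i' j' = 0 &
      forall j', (j' < j)%N -> G i j' = 0].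

Lemma lexlow_ex G : G != 0 -> exists i j, lexlow G i j.
Proof.
move=> G0; have [[i [j ij]]|H] := pselect (exists i j, G i j != 0); last first.
  case/eqP: G0; apply: germ_eq => m n; apply/eqP; apply/negPn/negP => mn.
  by apply: H; exists m, n.
have exi : exists i, `[< exists j, G i j != 0 >] by exists i; apply/asboolP; exists j.
case: (ex_minnP exi) => i0 /asboolP exj mini.
case: (ex_minnP exj) => j0 nz minj; exists i0, j0; split => // [i' j'|j'] lt.
  apply/eqP/negPn/negP => nz'; suff : (i0 <= i')%N by lia.
  by apply: mini; apply/asboolP; exists j'.
by apply/eqP/negPn/negP => nz'; have := minj j' nz'; lia.
Qed.

Lemma lexlow_neq0 G i j : lexlow G i j -> G != 0.
Proof. by case=> nz _ _; apply: contraNneq nz => ->; rewrite germ0. Qed.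

Lemma lexlow_uniq G i j i' j' : lexlow G i j -> lexlow G i' j' -> i = i' /\ j = j'.
Proof.
move=> [n1 r1 c1] [n2 r2 c2]; have ii : i = i'.
  case: (ltngtP i i') => // lt; first by move: n1; rewrite r2 ?eqxx.
  by move: n2; rewrite r1 ?eqxx.
subst i'; split=> //; case: (ltngtP j j') => // lt.
  by move: n1; rewrite c2 ?eqxx.
by move: n2; rewrite c1 ?eqxx.
Qed.

(** The lexicographic order on exponents is compatible with addition, so only the product of the two
    lowest coefficients reaches this position. This makes the germs an integral domain. *)
Lemma lexlowM G H i j i' j' :
  lexlow G i j -> lexlow H i' j' -> lexlow (G * H) (i + i')%N (j + j')%N.
Proof.
move=> [n1 r1 c1] [n2 r2 c2].
have row a b k l : (k < i)%N \/ k = i /\ (l < j)%N \/ (a < i')%N \/ a = i' /\ (b < j')%N ->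
    G k l * H a b = 0.
  by case=> [|[[-> ]|[|[-> ]]]] lt; rewrite ?(r1 _ _ lt) ?(c1 _ lt) ?(r2 _ _ lt) ?(c2 _ lt)
    ?mul0r ?mulr0.
split.
- rewrite germM (bigD1 (inord i)) //= (bigD1 (inord j)) //= !inordK; try lia.
  rewrite !addKn big1 ?addr0 => [|l nl]; last first.
    apply: row; right.
    have : (l : nat) <> j by move=> e; case/eqP: nl; apply: val_inj; rewrite /= inordK //; lia.
    by have := ltn_ord l; lia.
  rewrite big1 ?addr0 ?mulf_neq0 // => k nk; rewrite big1 // => l _; apply: row.
  have : (k : nat) <> i by move=> e; case/eqP: nk; apply: val_inj; rewrite /= inordK //; lia.
  have := ltn_ord k; lia.
- move=> a b lt; rewrite germM big1 // => k _; rewrite big1 // => l _; apply: row.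
  have := ltn_ord k; lia.
- move=> b lt; rewrite germM big1 // => k _; rewrite big1 // => l _; apply: row.
  by have := ltn_ord k; have := ltn_ord l; lia.
Qed.

Lemma germ_idomain : GRing.integral_domain_axiom germ.
Proof.
move=> f g fg; case: (eqVneq f 0) => //= /lexlow_ex[i [j fij]].
case: (eqVneq g 0) => //= /lexlow_ex[i' [j' gij]].
by have /lexlow_neq0 := lexlowM fij gij; rewrite fg eqxx.
Qed.
HB.instance Definition _ := GRing.ComUnitRing_isIntegral.Build germ germ_idomain.

Lemma lexlow1 : lexlow 1 0 0.
Proof. by split=> //; rewrite germ1 oner_eq0. Qed.

Lemma lexlowX G i j n : lexlow G i j -> lexlow (G ^+ n) (n * i)%N (n * j)%N.
Proof.
move=> H; elim: n => [|n IH]; first exact: lexlow1.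
by rewrite exprS !mulSn; apply: lexlowM.
Qed.

Lemma lexlow_u : lexlow u 1 0.
Proof.
split=> //=; rewrite /monom ?oner_eq0 // => i j.
by case: i.
Qed.
Lemma lexlow_v : lexlow v 0 1.
Proof.
by split=> //=; rewrite /monom ?oner_eq0 // => -[].
Qed.

Lemma lexlow_uv i j : lexlow (u ^+ i * v ^+ j) i j.
Proof.
have := lexlowM (lexlowX i lexlow_u) (lexlowX j lexlow_v).
by rewrite !muln1 !muln0 addn0 add0n.
Qed.

Lemma lexlow00 G : lexlow G 0 0 <-> G 0%N 0%N != 0.
Proof. by split=> [[]|nz] //; split. Qed.

End GermAlgebra.

(** * Weierstrass division with convergence *)

Section WeierstrassDivision.
Variable R : realType.
Local Notation C := R[i].
Local Notation germ := (germ R).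

Section Recursion.
Variables (h g : germ) (m : nat).

(** The quotient [q] of [g] by [h] is the fixed point of [wstep]: the equation
    [wstep q = q] says that the coefficients of [g - q * h] of degree at least [m] in
    the second variable vanish, and it is triangular for the order below. *)
Let wstep (a : nat -> nat -> C) i l : C :=
  (h 0%N m)^-1 * (g i (m + l)%N
   - \sum_(k < i) \sum_(j < (m + l).+1) a k j * h (i - k)%N (m + l - j)%N
   - \sum_(j < l) a i j * h 0%N (m + l - j)%N).

(** The order is by the weight [m.+1 * i + l]: a row k < i is used only in columns up to [m + l],
    where the weight is smaller. So this many iterations from 0 have stabilized the value at (i,
    l). *)
Let wquo i l : C := iter ((m.+1 * i + l).+1) wstep (fun _ _ => 0) i l.

Let wstep_stable n i l : (m.+1 * i + l < n)%N ->
  iter n wstep (fun _ _ => 0) i l = wquo i l.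
Proof.
have step n' i' l' : (m.+1 * i' + l' < n')%N ->
    iter n'.+1 wstep (fun _ _ => 0) i' l' = iter n' wstep (fun _ _ => 0) i' l'.
  elim: n' i' l' => // n' IH i' l' lt.
  have IH' k j : (m.+1 * k + j < n')%N ->
      wstep (iter n' wstep (fun _ _ => 0)) k j = iter n' wstep (fun _ _ => 0) k j.
    by move=> kj; rewrite -iterS IH.
  rewrite iterS [in RHS]iterS {1 3}/wstep; congr (_ * (_ - _ - _)).
    apply: eq_bigr => k _; apply: eq_bigr => j _; rewrite iterS IH' //.
    have := ltn_ord k; have := ltn_ord j; move: lt; nia.
  apply: eq_bigr => j _; rewrite iterS IH' //.
  have := ltn_ord j; move: lt; nia.
elim: n => // n IH; rewrite ltnS leq_eqVlt => /orP[/eqP <- //|lt].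
by rewrite step ?IH.
Qed.

Let wquo_fix i l : wquo i l = wstep wquo i l.
Proof.
rewrite {1}/wquo iterS; congr (_ * (_ - _ - _)).
  apply: eq_bigr => k _; apply: eq_bigr => j _; rewrite wstep_stable //.
  have := ltn_ord k; have := ltn_ord j; nia.
apply: eq_bigr => j _; rewrite wstep_stable //.
have := ltn_ord j; nia.
Qed.

Hypothesis hm : lexlow h 0 m.

(** Method of majorants: [wstep] maps families bounded by [bnd] to such families, so all iterates
    from 0 are bounded by it. *)
Let wquo_conv : convergent wquo.
Proof.
have [K K_1 [Hh Hg]] : exists2 K : C, 1 <= K &
    (forall i j, `|h i j| <= K ^+ (i + j).+1) /\ forall i j, `|g i j| <= K ^+ (i + j).+1.
  have [K1 K1_1 Hh] := convE (Defs.coefC h); have [K2 K2_1 Hg] := convE (Defs.coefC g).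
  have K1_0 := le_trans ler01 K1_1; have K2_0 := le_trans ler01 K2_1.
  exists (K1 * K2); first by rewrite mulr_ege1.
  split=> i j; [apply: le_trans (Hh i j) _|apply: le_trans (Hg i j) _];
    by apply: lerXn2r; rewrite ?nnegrE ?mulr_ge0 // (ler_peMr, ler_peMl).
have K_0 := le_trans ler01 K_1.
have e1 i k l j : (k < i)%N -> (j < (m + l).+1)%N ->
  (i + (m + l)).+1 = (k + (j + (i - k + (m + l - j)).+1))%N by lia.
have e2 i l j : (j < l)%N -> (i + (m + l)).+1 = (i + (j + (0 + (m + l - j)).+1))%N by lia.
have hm0 : h 0%N m != 0 by case: hm.
have [c c0 cE] : exists2 c : C, 0 < c & `|(h 0%N m)^-1| * K ^+ m.+1 = c.
  eexists; last reflexivity.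
  by rewrite mulr_gt0 ?normr_gt0 ?invr_eq0 // exprn_gt0 // (lt_le_trans ltr01 K_1).
(* S and P are chosen to telescope the geometric sums in [geoS] and [geoP]. The datum and the two
   sums then contribute at most a third of [bnd] each, whence the factor 3. *)
have [S SE] : exists S : C, S = 1 + 3 * c by eexists.
have [P PE] : exists P : C, P = 1 + S ^+ m.+1 by eexists.
have S1 : 1 <= S by rewrite SE lerDl mulr_ge0 // ltW.
have S0 := le_trans ler01 S1.
have P1 : 1 <= P by rewrite PE lerDl exprn_ge0.
have P0 := le_trans ler01 P1.
pose bnd i l : C := 3 * c * (P * K) ^+ i * (S * K) ^+ l.
have eqle (x y : C) : x = y -> x <= y by move=> ->.
have geoS l : 3 * c * \sum_(j < l) S ^+ j = S ^+ l - 1.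
  by rewrite subrX1 {2}SE addrAC subrr add0r.
have geoP i : S ^+ m.+1 * \sum_(j < i) P ^+ j = P ^+ i - 1.
  by rewrite subrX1 {2}PE addrAC subrr add0r.
have step a : (forall i l, `|a i l| <= bnd i l) -> forall i l, `|wstep a i l| <= bnd i l.
  move=> Ha i l; rewrite /wstep normrM.
  apply: (@le_trans _ _ (`|(h 0%N m)^-1| * (K ^+ (i + (m + l)).+1 * (1
     + \sum_(k < i) \sum_(j < (m + l).+1) 3 * c * P ^+ k * S ^+ j
     + \sum_(j < l) 3 * c * P ^+ i * S ^+ j)))).
    apply: ler_wpM2l => //; apply: le_trans (ler_normB _ _) _.
    rewrite !mulrDr mulr1; apply: lerD.
      apply: le_trans (ler_normB _ _) _; apply: lerD => //.
      apply: le_trans (ler_norm_sum _ _ _) _; rewrite mulr_sumr; apply: ler_sum => k _.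
      apply: le_trans (ler_norm_sum _ _ _) _; rewrite mulr_sumr; apply: ler_sum => j _.
      rewrite normrM; apply: le_trans (ler_pM _ _ (Ha _ _) (Hh _ _)) _ => //.
      rewrite (e1 _ _ _ _ (ltn_ord k) (ltn_ord j)).
      rewrite /bnd !exprMn [K ^+ (_ + _)%N]exprD [K ^+ (j + _)%N]exprD; apply/eqle; ring.
    apply: le_trans (ler_norm_sum _ _ _) _; rewrite mulr_sumr; apply: ler_sum => j _.
    rewrite normrM; apply: le_trans (ler_pM _ _ (Ha _ _) (Hh _ _)) _ => //.
    rewrite (e2 i _ _ (ltn_ord j)).
    rewrite /bnd !exprMn [K ^+ (_ + _)%N]exprD [K ^+ (j + _)%N]exprD; apply/eqle; ring.
  have -> : (i + (m + l)).+1 = (m.+1 + (i + l))%N by lia.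
  set T := (X in K ^+ _ * X).
  have -> : `|(h 0%N m)^-1| * (K ^+ (m.+1 + (i + l)) * T) = c * K ^+ (i + l) * T.
    by rewrite exprD -cE; ring.
  rewrite {}/T.
  have -> : bnd i l = c * K ^+ (i + l) * (3 * (P ^+ i * S ^+ l)).
    by rewrite /bnd !exprMn exprD; ring.
  apply: ler_wpM2l; first by rewrite mulr_ge0 ?exprn_ge0 // ltW.
  have -> : 3 * (P ^+ i * S ^+ l) = P ^+ i * S ^+ l + P ^+ i * S ^+ l + P ^+ i * S ^+ l.
    by ring.
  apply: lerD; first apply: lerD.
  - by rewrite mulr_ege1 ?exprn_ege1.
  - rewrite (eq_bigr (fun k : 'I_i => P ^+ k * (S ^+ (m + l).+1 - 1))); last first.
      by move=> k _; rewrite -geoS !mulr_sumr; apply: eq_bigr => j _; ring.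
    rewrite -mulr_suml; apply: (@le_trans _ _ ((\sum_(k < i) P ^+ k) * (S ^+ m.+1 * S ^+ l))).
      apply: ler_wpM2l; first by rewrite sumr_ge0 // => k _; rewrite exprn_ge0.
      by rewrite -exprD addSn gerBl.
    by rewrite mulrA [X in X * _]mulrC geoP ler_wpM2r ?exprn_ge0 // gerBl.
  - rewrite (eq_bigr (fun k : 'I_l => P ^+ i * (3 * c * S ^+ k))); last first.
      by move=> k _; ring.
    by rewrite -!mulr_sumr geoS ler_wpM2l ?exprn_ge0 // gerBl.
have bd n i l : `|iter n wstep (fun _ _ => 0) i l| <= bnd i l.
  elim: n i l => [|n IH] i l; last exact: step.
  by rewrite /= normr0 /bnd !mulr_ge0 ?exprn_ge0 ?mulr_ge0 // ltW.
apply: (@convI _ _ (3 * c) (P * S * K)); rewrite ?mulr_ge0 // ?(ltW c0) // => i l.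
apply: le_trans (bd _ i l) _; rewrite /bnd -mulrA; apply: ler_wpM2l.
  by rewrite mulr_ge0 // ltW.
rewrite exprD; apply: ler_pM; rewrite ?exprn_ge0 ?mulr_ge0 //.
  apply: lerXn2r; rewrite ?nnegrE ?mulr_ge0 //.
  by rewrite ler_wpM2r // ler_peMr.
apply: lerXn2r; rewrite ?nnegrE ?mulr_ge0 //.
by rewrite ler_wpM2r // ler_peMl.
Qed.

(** The remainder has degree less than m in v. For m = 0 there is none and h gets inverted; for m =
    1 it depends on u alone. *)
Lemma weierstrass_division : exists q : germ, forall i l, (g - q * h) i (m + l)%N = 0.
Proof.
exists (mk_germ wquo_conv) => i l; rewrite germB; apply/eqP; rewrite subr_eq0; apply/eqP.
rewrite germM big_ord_recr /= subnn.
rewrite -(big_mkord predT (fun j => wquo i j * h 0%N (m + l - j)%N)).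
rewrite (big_cat_nat (n := l)) //=; last by rewrite leqW // leq_addl.
rewrite big_mkord big_ltn; last by rewrite ltnS leq_addl.
rewrite addnK [X in _ + (_ + (_ + X))]big_nat [X in _ + (_ + (_ + X))]big1 ?addr0 => [|j jl]; last first.
  by case: hm => _ _ -> //; [rewrite mulr0 | move: jl; lia].
have hm0 : h 0%N m != 0 by case: hm.
rewrite [wquo i l]wquo_fix /wstep mulrC.
by field.
Qed.

End Recursion.
End WeierstrassDivision.

(** * The charts of a blow-up as ring morphisms *)

Section BlowMorphism.
Variable R : realType.
Local Notation C := R[i].
Local Notation germ := (germ R).
Implicit Types (f g h x y G H : germ) (d : direction R).

Local Notation u := (coord_u R).
Local Notation v := (coord_v R).

Lemma germ_unitE G : (G \is a GRing.unit) = (G 0%N 0%N != 0).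
Proof.
apply/idP/idP => [/unitrP[y [yG _]]|nz].
  have : (y * G) 0%N 0%N != 0 by rewrite yG germ1 oner_eq0.
  by rewrite germM00; apply: contraNneq => ->; rewrite mulr0.
have [q Hq] := weierstrass_division 1 (proj2 (lexlow00 G) nz).
have qG : 1 - q * G = 0 by apply: germ_eq => i j; rewrite -[j]add0n Hq.
have {}qG : q * G = 1 by apply/eqP; rewrite eq_sym -subr_eq0 qG.
by apply/unitrP; exists q; split; rewrite // mulrC.
Qed.

Lemma conv_tr G : convergent (fun m n => G n m).
Proof. by case: (Defs.coefC G) => M [r H]; exists M, r => m n; rewrite addnC. Qed.
(** The exchange of the coordinates carries the chart at infinity to that of direction 0 and {v = 0}
    to {u = 0}, which halves the proofs. *)
Definition tr G : germ := mk_germ (conv_tr G).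

Lemma trK : involutive tr. Proof. by move=> G; apply: germ_eq. Qed.
Lemma tr_additive : {morph tr : G H / G - H}.
Proof. by move=> G H; apply: germ_eq. Qed.
Lemma tr_mult : monoid_morphism tr.
Proof.
split=> [|G H]; apply: germ_eq => m n; first by rewrite /= /monom andbC.
rewrite -[LHS]/((G * H) n m) !germM exchange_big; apply: eq_bigr => i _ /=.
by apply: eq_bigr.
Qed.
HB.instance Definition _ := GRing.isZmodMorphism.Build germ germ tr tr_additive.
HB.instance Definition _ := GRing.isMonoidMorphism.Build germ germ tr
  tr_mult.

Lemma tr_u : tr u = v.
Proof. by apply: germ_eq => m n; rewrite /= /monom andbC. Qed.
Lemma tr_v : tr v = u. Proof. by rewrite -tr_u trK. Qed.

Lemma conv_const (c : C) : convergent (fun m n => if (m == 0%N) && (n == 0%N) then c else 0).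
Proof.
apply: (@convI _ _ `|c| 1) => // m n; rewrite expr1n mulr1.
by case: ifP; rewrite // normr0.
Qed.
Definition germC c : germ := mk_germ (conv_const c).

Lemma germCM c G m n : (germC c * G) m n = c * G m n.
Proof.
rewrite germM big_ord_recl /= big_ord_recl /= !subn0 big1 ?addr0 => [|j _]; last first.
  by rewrite mul0r.
by rewrite big1 ?addr0 // => i _; rewrite big1 // => j _; rewrite mul0r.
Qed.
Lemma tr_C c : tr (germC c) = germC c.
Proof. by apply: germ_eq => m n; rewrite /= andbC. Qed.

(** The homogeneous part of degree m, dehomogenized by u = 1. *)
Definition hpart G m : {poly C} := \poly_(j < m.+1) G (m - j)%N j.

Lemma sum_window (V : nmodType) (F : nat -> V) l k m : (l + k <= m)%N ->
  (forall i, (i < l)%N -> F i = 0) -> (forall i, (l + k < i <= m)%N -> F i = 0) ->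
  \sum_(i < m.+1) F i = \sum_(a < k.+1) F (l + a)%N.
Proof.
move=> lkm Fl Fr; rewrite -(big_mkord predT F) (big_cat_nat (n := l)) //=; last by lia.
rewrite big_nat big1 ?add0r => [|i /andP[_ /Fl //]].
rewrite (big_cat_nat (n := (l + k).+1)) //=; try lia.
rewrite [X in _ + X]big_nat [X in _ + X]big1 ?addr0 => [|i il]; last by rewrite Fr //; lia.
by rewrite -{1}[l]add0n big_addn subSn ?leq_addr // addKn big_mkord; apply: eq_bigr => a _;
  rewrite addnC.
Qed.

Lemma hpartM G H m : hpart (G * H) m = \sum_(i < m.+1) hpart G i * hpart H (m - i)%N.
Proof.
apply/polyP => j; rewrite coef_sum.
under eq_bigr => i _ do rewrite coefM.
have -> : \sum_(i < m.+1) \sum_(l < j.+1) (hpart G i)`_l * (hpart H (m - i))`_(j - l) =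
  \sum_(l < j.+1) \sum_(i < m.+1) (hpart G i)`_l * (hpart H (m - i))`_(j - l).
  exact: exchange_big.
rewrite coef_poly ltnS.
have F0 (i : nat) (l : 'I_j.+1) : (i <= m)%N -> ~ (l <= i /\ i <= l + (m - j) /\ j <= m)%N ->
    (hpart G i)`_l * (hpart H (m - i))`_(j - l) = 0.
  move=> im bad; rewrite !coef_poly !ltnS; case: ifP => [li|]; last by rewrite mul0r.
  case: ifP => [lj|]; last by rewrite mulr0.
  by exfalso; apply: bad; have := ltn_ord l; lia.
case: leqP => jm; last first.
  rewrite big1 // => l _; rewrite big1 // => i _; apply: F0; [exact: (ltn_ord i)|lia].
rewrite [LHS]germM [LHS]exchange_big; apply: eq_bigr => l _.
rewrite (@sum_window _ (fun i => (hpart G i)`_l * (hpart H (m - i))`_(j - l)) l (m - j));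
  last 1 [move=> i im; apply: F0; lia].
- apply: eq_bigr => a _; have la := ltn_ord a; have ll := ltn_ord l.
  rewrite !coef_poly ltnS leq_addr ifT; last by lia.
  by congr (G _ _ * H _ _); lia.
- by have := ltn_ord l; lia.
- move=> i il; apply: F0; have := ltn_ord l; lia.
Qed.

Lemma hpartB G H m : hpart (G - H) m = hpart G m - hpart H m.
Proof. by apply/polyP => j; rewrite coefB !coef_poly; case: ifP; rewrite ?subr0. Qed.

(** G(u, u(v + c)) is the sum of the u^m G_m(1, v + c) over the homogeneous parts G_m of G.
    Multiplicativity of the chart then follows from [hpartM]. *)
Lemma blow_finE c G m n : blow (Some c) G m n = (hpart G m \Po ('X + c%:P))`_n.
Proof.
rewrite /= /coef_fin /hpart poly_def raddf_sum /= coef_sum; apply: eq_bigr => j _ /=.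
rewrite linearZ /= rmorphXn /= comp_polyX coefZ addrC exprDn coef_sum; case: (leqP n j) => nj.
  rewrite (bigD1 (Ordinal (nj : (n < j.+1)%N))) //= big1 ?addr0 => [|i ni].
    rewrite coefMn -polyC_exp coefCM coefXn eqxx mulr1.
    by rewrite mulrnAr.
  rewrite coefMn -polyC_exp coefCM coefXn; case: eqP => [e|]; rewrite ?mulr0 ?mul0rn //.
  by case/eqP: ni; apply: val_inj.
rewrite bin_small // big1 => [|i ni]; first by rewrite mulr0.
rewrite coefMn -polyC_exp coefCM coefXn; case: eqP => [e|]; rewrite ?mulr0 ?mul0rn //.
by have := ltn_ord i; lia.
Qed.

Lemma blow_infE G : blow None G = tr (blow (Some 0) (tr G)).
Proof.
apply: germ_eq => m n /=; rewrite /coef_inf /coef_fin; case: leqP => mn.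
  rewrite (bigD1 (inord m)) //= inordK ?ltnS // subnn expr0 binn mulr1 big1 ?addr0 // => j nj.
  have jm : (j : nat) <> m by move=> e; case/eqP: nj; apply: val_inj; rewrite /= inordK // -e.
  case: (ltnP j m) => lt; first by rewrite bin_small.
  by rewrite expr0n (_ : (j - m == 0)%N = false) ?mulr0 ?mul0rn //; lia.
rewrite big1 // => j _; rewrite bin_small //; have := ltn_ord j; lia.
Qed.

Lemma blow_additive d : {morph blow d : G H / G - H}.
Proof.
have fin (c : C) : {morph blow (Some c) : G H / G - H}.
  by move=> G H; apply: germ_eq => m n; rewrite [RHS]germB !blow_finE hpartB raddfB coefB.
case: d => [c|] G H; first exact: fin.
by rewrite !blow_infE raddfB fin raddfB.
Qed.

Lemma hpart1 m : hpart 1 m = (m == 0%N)%:R.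
Proof.
apply/polyP => j; rewrite coef_poly germ1 ltnS.
case: m => [|m]; first by rewrite coef1; case: j.
by rewrite coef0; case: ifP => // jm; case: eqP => //=; case: eqP => // ->.
Qed.

Lemma blow_mult d : monoid_morphism (blow d).
Proof.
have fin (c : C) : monoid_morphism (blow (Some c)).
  split=> [|G H]; apply: germ_eq => m n.
    rewrite blow_finE hpart1 germ1; case: eqP => _; last by rewrite linear0 coef0.
    by rewrite rmorph1 coef1.
  rewrite blow_finE hpartM raddf_sum coef_sum germM; apply: eq_bigr => i _.
  by rewrite /= comp_polyM coefM; apply: eq_bigr => j _; rewrite -!blow_finE.
case: d => [c|]; first exact: fin.
by split=> [|G H]; rewrite !blow_infE ?rmorphM ?(fin 0).2 ?rmorphM ?rmorph1 ?(fin 0).1 ?rmorph1.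
Qed.

HB.instance Definition _ d := GRing.isZmodMorphism.Build germ germ (blow d) (blow_additive d).
HB.instance Definition _ d := GRing.isMonoidMorphism.Build germ germ (blow d)
  (blow_mult d).

Lemma blow_C d c : blow d (germC c) = germC c.
Proof.
have fin a : blow (Some a) (germC c) = germC c.
  apply: germ_eq => m n; rewrite blow_finE.
  have -> : hpart (germC c) m = if m == 0%N then c%:P else 0.
    apply/polyP => j; rewrite coef_poly /= ltnS; case: m => [|m].
      by rewrite coefC; case: j.
    by rewrite coef0; case: ifP => // jm; case: eqP => //=; case: eqP => // ->.
  case: m => [|m]; rewrite ?comp_polyC ?coefC ?comp_poly0 ?coef0 /=.
    by [].
  by rewrite if_same.
by case: d => [a|]; rewrite ?blow_infE ?tr_C ?fin ?tr_C.
Qed.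

Lemma blow_fin_u c : blow (Some c) u = u.
Proof.
apply: germ_eq => m n; rewrite blow_finE.
have -> : hpart u m = (m == 1%N)%:R.
  apply/polyP => j; rewrite coef_poly /= /monom ltnS.
  case: m => [|[|m]] /=; rewrite ?coef0 ?coef1; first by case: j.
    by case: j => [|[]].
  by case: ifP => // jm; case: (j =P 0%N) => [->//|]; rewrite andbF.
case: m => [|[|m]] /=; rewrite /monom /= ?rmorph1 ?rmorph0 ?coef0 ?coef1 //.
Qed.

Lemma blow_fin_v c : blow (Some c) v = u * (v + germC c).
Proof.
apply: germ_eq => m n; rewrite blow_finE uM germD.
have -> : hpart v m = if m == 1%N then 'X else 0.
  apply/polyP => j; rewrite coef_poly /= /monom ltnS.
  case: m => [|[|m]] /=; rewrite ?coef0 ?coefX; first by case: j.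
    by case: j => [|[|j]].
  by case: ifP => // jm; case: (j =P 1%N) => [->//|]; rewrite andbF.
case: m => [|[|m]] /=; rewrite /monom /= ?comp_poly0 ?coef0 ?addr0 //.
by rewrite comp_polyX coefD coefX coefC; case: n => [|[]].
Qed.

Lemma blow_inf_v : blow None v = v.
Proof. by rewrite blow_infE tr_v blow_fin_u tr_u. Qed.

Lemma blow_inf_u : blow None u = u * v.
Proof.
rewrite blow_infE tr_u blow_fin_v rmorphM rmorphD /= tr_C tr_u tr_v mulrC; congr (_ * _).
by rewrite (_ : germC 0 = 0) ?addr0 //; apply: germ_eq => m n; rewrite /= if_same.
Qed.

Lemma blow00 d G : blow d G 0%N 0%N = G 0%N 0%N.
Proof.
have fin (c : C) (H : germ) : blow (Some c) H 0%N 0%N = H 0%N 0%N.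
  by rewrite /= /coef_fin big_ord1 /= expr0 mulr1.
by case: d => [c|]; rewrite ?blow_infE ?fin // -[LHS]/(blow (Some 0) (tr G) 0%N 0%N) fin.
Qed.

Lemma blow_unit d G : G \is a GRing.unit -> blow d G \is a GRing.unit.
Proof. by rewrite !germ_unitE blow00. Qed.

Lemma tr_unit G : (tr G \is a GRing.unit) = (G \is a GRing.unit).
Proof. by rewrite !germ_unitE. Qed.

Lemma blowM d G H : blow d (G * H) = blow d G * blow d H.
Proof. exact: rmorphM. Qed.
Lemma blowX d G n : blow d (G ^+ n) = blow d G ^+ n.
Proof. exact: rmorphXn. Qed.

Lemma pull_additive (q : infpoint R) : {morph pull q : G H / G - H}.
Proof. by elim: q => [|d q IH] G H //=; rewrite IH raddfB. Qed.
Lemma pull_mult (q : infpoint R) : monoid_morphism (pull q).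
Proof.
elim: q => [|d q [IH1 IHm]] //; split=> [|G H] /=.
  by rewrite IH1 -[LHS]/(blow d _) rmorph1.
by rewrite IHm -[LHS]/(blow d _) rmorphM.
Qed.
HB.instance Definition _ (q : infpoint R) :=
  GRing.isZmodMorphism.Build germ germ (pull q) (pull_additive q).
HB.instance Definition _ (q : infpoint R) :=
  GRing.isMonoidMorphism.Build germ germ (pull q)
  (pull_mult q).

Lemma pull_unit (q : infpoint R) G : G \is a GRing.unit -> pull q G \is a GRing.unit.
Proof. by elim: q => [|d q IH] //= Gu; apply: (@blow_unit d); apply: IH. Qed.

Lemma pull00 (q : infpoint R) G : pull q G 0%N 0%N = G 0%N 0%N.
Proof. by elim: q => [|d q IH] //=; rewrite -IH -[LHS]/(blow d _ 0%N 0%N) blow00. Qed.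

Lemma pullM (q : infpoint R) G H : pull q (G * H) = pull q G * pull q H.
Proof. exact: rmorphM. Qed.
Lemma pullX (q : infpoint R) G n : pull q (G ^+ n) = pull q G ^+ n.
Proof. exact: rmorphXn. Qed.

End BlowMorphism.
Arguments blow {R} d f : simpl never.

(** * Multiplicity, leading forms and tangent directions *)

Section BlowUps.
Variable R : realType.
Local Notation C := R[i].
Local Notation germ := (germ R).
Implicit Types (f g h x y G H : germ) (d : direction R) (o : bool).

Local Notation u := (coord_u R).
Local Notation v := (coord_v R).

(** Coordinates in which [axis o] becomes {u = 0}, so that [lexlow] applies. *)
Definition ori o G : germ := if o then tr G else G.
Definition axis o : germ := if o then v else u.

Lemma oriK o : involutive (ori o). Proof. by case: o => // G; apply: trK. Qed.
Lemma ori_additive o : {morph ori o : G H / G - H}.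
Proof. by case: o => // G H; rewrite /ori raddfB. Qed.
Lemma ori_mult o : monoid_morphism (ori o).
Proof. by case: o; split=> // [|G H]; rewrite /ori ?rmorph1 ?rmorphM. Qed.
HB.instance Definition _ o := GRing.isZmodMorphism.Build germ germ (ori o) (ori_additive o).
HB.instance Definition _ o := GRing.isMonoidMorphism.Build germ germ (ori o) (ori_mult o).

Lemma ori_axis o : ori o (axis o) = u.
Proof. by case: o; rewrite /= ?tr_v. Qed.
Lemma ori_axisN o : ori o (axis (~~ o)) = v.
Proof. by case: o; rewrite /= ?tr_u. Qed.
Lemma ori_unit o G : (ori o G \is a GRing.unit) = (G \is a GRing.unit).
Proof. by case: o; rewrite /= ?tr_unit. Qed.
Lemma lexlow_unit o G : G \is a GRing.unit -> lexlow (ori o G) 0 0.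
Proof. by move=> Gu; apply/lexlow00; rewrite -germ_unitE ori_unit. Qed.
Lemma ori_neq0 o G : (ori o G != 0) = (G != 0).
Proof. by rewrite -(inj_eq (inv_inj (oriK o))) rmorph0 oriK. Qed.

(** The exceptional divisor of the blow-up is [{axis (atinf d) = 0}] at the point of
    direction [d]. *)
Definition atinf d : bool := d == None.

Lemma low_ex G : exists ij : nat * nat, G != 0 -> lexlow G ij.1 ij.2.
Proof.
case: (eqVneq G 0) => [_|G0]; first by exists (0, 0)%N.
by have [i [j H]] := lexlow_ex G0; exists (i, j).
Qed.
Definition low G : nat * nat := sval (cid (low_ex G)).
Lemma lowP G : G != 0 -> lexlow G (low G).1 (low G).2.
Proof. by rewrite /low; case: cid. Qed.
Lemma lowE G i j : lexlow G i j -> low G = (i, j).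
Proof.
move=> H; have [<- <-] := lexlow_uniq (lowP (lexlow_neq0 H)) H; exact: surjective_pairing.
Qed.

(** Both are read off the blown-up germ: its order along the exceptional divisor is the multiplicity
    in every chart ([lexlow_orb]), and the residual intersection number is the order of the leading
    form in the direction d. *)
Definition mult G := (low (blow (Some 0) G)).1.
Definition dord d G := (low (ori (atinf d) (blow d G))).2.

Lemma blow_inf_ori G : ori true (blow None G) = blow (Some 0) (tr G).
Proof. by rewrite /ori blow_infE trK. Qed.

Lemma hpart_eq0 G m : (hpart G m == 0) <-> (forall i j, (i + j)%N = m -> G i j = 0).
Proof.
split=> [/eqP e i j ij|H].
  have := congr1 (fun p : {poly C} => p`_j) e; rewrite coef_poly coef0 ltnS -ij leq_addl.
  by rewrite addnK.
apply/eqP/polyP => j; rewrite coef_poly coef0 ltnS; case: leqP => // jm.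
by rewrite H // subnK.
Qed.

Definition degree G m := hpart G m != 0 /\ forall m', (m' < m)%N -> hpart G m' = 0.

Lemma degree_ex G : G != 0 -> exists m, degree G m.
Proof.
move=> /lexlow_ex[i [j [nz _ _]]].
have ex : exists m, hpart G m != 0.
  by exists (i + j)%N; apply: contra_neqN nz => /hpart_eq0 ->.
case: (ex_minnP ex) => m nzm min; exists m; split=> // m' lt.
by apply/eqP/negPn/negP => nz'; have := min _ nz'; lia.
Qed.

Lemma degree_tr G m : degree G m -> degree (tr G) m.
Proof.
have e k : hpart (tr G) k == 0 <-> hpart G k == 0.
  rewrite !hpart_eq0; split=> H i j ij; last by apply: H; rewrite addnC.
  by apply: (H j i); rewrite addnC.
case=> nz low; split; first by apply: contraNN nz => /e.
by move=> m' /low/eqP/e/eqP.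
Qed.

Lemma degree_blow c G m : degree G m ->
  exists t, [/\ lexlow (blow (Some c) G) m t, (hpart G m \Po ('X + c%:P))`_t != 0 &
                forall t', (t' < t)%N -> (hpart G m \Po ('X + c%:P))`_t' = 0].
Proof.
move=> [nz low].
have : hpart G m \Po ('X + c%:P) != 0.
  by rewrite comp_poly2_eq0 // size_XaddC.
move=> nz'; have ex : exists t, (hpart G m \Po ('X + c%:P))`_t != 0.
  by exists (size (hpart G m \Po ('X + c%:P))).-1; rewrite -[_`_ _]/(lead_coef _) lead_coef_eq0.
case: (ex_minnP ex) => t nzt min; have min' t' : (t' < t)%N -> (hpart G m \Po ('X + c%:P))`_t' = 0.
  by move=> lt; apply/eqP/negPn/negP => /min; lia.
exists t; split=> //; split=> [|i j im|j jt]; rewrite blow_finE //; last exact: min'.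
by rewrite (low _ im) comp_poly0 coef0.
Qed.

Lemma degree_orb d G m : degree G m -> lexlow (ori (atinf d) (blow d G)) m (dord d G).
Proof.
move=> dG; have [t Ht] : exists t, lexlow (ori (atinf d) (blow d G)) m t.
  case: d => [c|]; first by have [t [H _ _]] := degree_blow c dG; exists t.
  by have [t [H _ _]] := degree_blow 0 (degree_tr dG); exists t; rewrite blow_inf_ori.
by rewrite /dord (lowE Ht).
Qed.

Lemma degree_mult G : G != 0 -> degree G (mult G).
Proof.
move=> /degree_ex[m dm]; suff -> : mult G = m by [].
by rewrite /mult (lowE (degree_orb (Some 0) dm)).
Qed.

Lemma lexlow_orb d G : G != 0 -> lexlow (ori (atinf d) (blow d G)) (mult G) (dord d G).
Proof. by move=> /degree_mult/degree_orb. Qed.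

Lemma blow_neq0 d G : G != 0 -> blow d G != 0.
Proof. by move=> /(lexlow_orb d)/lexlow_neq0; rewrite ori_neq0. Qed.

Lemma orb_mult d G m t : lexlow (ori (atinf d) (blow d G)) m t -> mult G = m /\ dord d G = t.
Proof.
move=> H; have G0 : G != 0.
  have := lexlow_neq0 H; rewrite ori_neq0; apply: contraNneq => ->.
  by rewrite -[X in X == _]/(blow d 0) raddf0.
exact: lexlow_uniq (lexlow_orb d G0) H.
Qed.

Lemma mult_le G i j : G i j != 0 -> (mult G <= i + j)%N.
Proof.
move=> nz; have G0 : G != 0 by apply: contraNneq nz => ->; rewrite germ0.
have [_ low] := degree_mult G0; rewrite leqNgt; apply/negP => /low/eqP/hpart_eq0 H.
by rewrite (H i j) // eqxx in nz.
Qed.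

Lemma multM G H : G != 0 -> H != 0 -> mult (G * H) = (mult G + mult H)%N.
Proof.
move=> G0 H0; have := lexlowM (lexlow_orb (Some 0) G0) (lexlow_orb (Some 0) H0).
by rewrite -!rmorphM => /orb_mult[].
Qed.

Lemma dordM d G H : G != 0 -> H != 0 -> dord d (G * H) = (dord d G + dord d H)%N.
Proof.
move=> G0 H0; have := lexlowM (lexlow_orb d G0) (lexlow_orb d H0).
by rewrite -!rmorphM => /orb_mult[].
Qed.

Lemma coef_blow0 G m n : blow (Some 0) G m n = if (n <= m)%N then G (m - n)%N n else 0.
Proof.
by rewrite blow_finE polyC0 addr0 comp_polyXr coef_poly ltnS.
Qed.

Lemma coef_blow_inf G m n : blow None G m n = if (m <= n)%N then G m (n - m)%N else 0.
Proof. by rewrite blow_infE -[LHS]/(blow (Some 0) (tr G) n m) coef_blow0. Qed.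

(** The monomial of the leading form with the least power of v; [dord_inf_coef] gives the one with
    the least power of u. They later serve as vertices of Newton polygons. *)
Lemma dord0_coef G : G != 0 -> (dord (Some 0%R) G <= mult G)%N /\
  G (mult G - dord (Some 0%R) G)%N (dord (Some 0) G) != 0.
Proof.
move=> /(lexlow_orb (Some 0)); rewrite /ori /=; case.
by rewrite coef_blow0; case: leqP => // _; rewrite eqxx.
Qed.

Lemma dord_inf_coef G : G != 0 -> (dord None G <= mult G)%N /\
  G (dord None G) (mult G - dord None G)%N != 0.
Proof.
move=> /(lexlow_orb None); rewrite blow_inf_ori => -[].
by rewrite coef_blow0; case: leqP => // _; rewrite eqxx.
Qed.

Lemma low_prod (r : seq C) t :
  (\prod_(z <- r) ('X - z%:P) : {poly C})`_t != 0 ->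
  (forall t', (t' < t)%N -> (\prod_(z <- r) ('X - z%:P) : {poly C})`_t' = 0) ->
  t = count_mem 0 r.
Proof.
elim: r t => [|z r IH] t; first by rewrite big_nil coef1 /=; case: t => //= t; rewrite eqxx.
rewrite big_cons mulrBl /=; set p := \prod_(_ <- _) _.
have cE k : ('X * p - z%:P * p)`_k = (if k is k'.+1 then p`_k' else 0) - z * p`_k.
  by rewrite coefB coefXM coefCM; case: k.
case: (eqVneq z 0) => [z0|z0] nz low.
  case: t nz low => [|t]; rewrite cE z0 mul0r subr0 ?eqxx // => nz low.
  by rewrite -(IH t) // => t' lt; have := low t'.+1; rewrite mul0r subr0 coefXM /= => ->.

have low' t' : (t' < t)%N -> p`_t' = 0.
  elim: t' => [|t' IHt] lt; have := low _ lt; rewrite cE ?IHt ?sub0r ?(ltnW lt) // => /eqP;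
    by rewrite oppr_eq0 mulf_eq0 (negPf z0) => /eqP.
rewrite -(IH t) //; move: nz; rewrite cE; case: (t) low' => [|t'] low'.
  by rewrite sub0r oppr_eq0 mulf_eq0 negb_or => /andP[].
by rewrite low' // sub0r oppr_eq0 mulf_eq0 negb_or => /andP[].
Qed.

(** Over the complex numbers the leading form splits into linear factors; the degree lost by
    dehomogenizing is the order in the direction infinity. *)
Lemma tangents G : G != 0 -> exists2 r : seq (direction R),
  size r = mult G & forall d, dord d G = count_mem d r.
Proof.
move=> G0; have dG := degree_mult G0; have [nz _] := dG.
have [r] := closed_field_poly_normal (hpart G (mult G)).
set a := lead_coef _ => rE.
have a0 : a != 0 by rewrite lead_coef_eq0.
have szr : size (hpart G (mult G)) = (size r).+1 by rewrite rE size_scale // size_prod_XsubC.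
have sz : (size r <= mult G)%N by rewrite -ltnS -szr size_poly.
exists (map Some r ++ nseq (mult G - size r) None).
  by rewrite size_cat size_map size_nseq subnKC.
case=> [c|]; rewrite count_cat count_map count_nseq /=; last first.
  rewrite (eq_count (a2 := pred0)) ?count_pred0 ?add0n ?mul1n //.
  have [t [Ht nzt lowt]] := degree_blow 0 (degree_tr dG).
  rewrite -blow_inf_ori in Ht; have [_ ->] := orb_mult (d := None) Ht.
  rewrite polyC0 addr0 comp_polyXr in nzt lowt.
  have e j : (j <= mult G)%N -> (hpart (tr G) (mult G))`_j = (hpart G (mult G))`_(mult G - j).
    by move=> jm; rewrite !coef_poly !ltnS jm leq_subr /= subKn.
  have tm : (t <= mult G)%N.
    by move: nzt; rewrite coef_poly ltnS; case: leqP => //; rewrite eqxx.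
  have e1 : (mult G - t <= size r)%N.
    by rewrite -ltnS -szr ltnNge; apply/negP => /leq_sizeP/(_ _ (leqnn _)); rewrite -e //; apply/eqP.
  case: (ltnP (mult G - size r) t) => lt; last first.
    by apply/eqP; rewrite eqn_leq lt leq_subLR addnC -leq_subLR.
  exfalso.
  have := lowt _ lt; rewrite e ?leq_subr // subKn // => /eqP.
  by rewrite -[size r]/((size r).+1.-1) -szr -[_`_ _]/(lead_coef _) lead_coef_eq0 (negPf nz).
rewrite /= mul0n addn0; have [t [Ht nzt lowt]] := degree_blow c dG.
have [_ ->] := orb_mult (d := Some c) Ht.
have pE : hpart G (mult G) \Po ('X + c%:P) =
    a *: \prod_(z <- [seq z - c | z <- r]) ('X - z%:P).
  rewrite {1}rE linearZ /= rmorph_prod big_map /=; congr (_ *: _); apply: eq_bigr => z _.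
  by rewrite rmorphB /= comp_polyX comp_polyC polyCB opprB addrA addrAC.
rewrite (@low_prod [seq z - c | z <- r] t).
- by rewrite count_map; apply: eq_count => z /=; rewrite subr_eq0.
- by move: nzt; rewrite pE coefZ mulf_eq0 negb_or => /andP[].
- by move=> t' /lowt/eqP; rewrite pE coefZ mulf_eq0 (negPf a0) => /eqP.
Qed.

Lemma sum_count_mem (T : eqType) (ts r : seq T) : uniq ts ->
  (\sum_(t <- ts) count_mem t r <= size r)%N /\
  ({subset r <= ts} -> (\sum_(t <- ts) count_mem t r)%N = size r).
Proof.
move=> uts; elim: r => [|z r [IH1 IH2]] /=; first by rewrite big1.
have e : (\sum_(t <- ts) (z == t))%N = (z \in ts).
  rewrite -(count_uniq_mem z uts) -sum1_count [RHS]big_mkcond /=.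
  by apply: eq_bigr => t _; rewrite eq_sym; case: eqP.
rewrite big_split /= e; split=> [|sub]; first by case: (z \in ts) => /=; lia.
by rewrite sub ?mem_head // IH2 // => t tr; apply: sub; rewrite inE tr orbT.
Qed.

Lemma sum_dord_le G (ds : seq (direction R)) : G != 0 -> uniq ds ->
  (\sum_(d <- ds) dord d G <= mult G)%N.
Proof.
move=> /tangents[r <- rE] uds; rewrite (eq_bigr (fun d => count_mem d r)) //.
exact: (sum_count_mem r uds).1.
Qed.

Lemma sum_dord G : G != 0 -> exists r : seq (direction R), forall ds, uniq ds ->
  {subset r <= ds} -> (\sum_(d <- ds) dord d G)%N = mult G.
Proof.
move=> /tangents[r <- rE]; exists r => ds uds sub.
by rewrite (eq_bigr (fun d => count_mem d r)) //; apply: (sum_count_mem r uds).2.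
Qed.

Lemma dord_le_mult d G : G != 0 -> (dord d G <= mult G)%N.
Proof. by move=> G0; have := @sum_dord_le G [:: d] G0 isT; rewrite big_seq1. Qed.

Lemma dord_pure d d' G : G != 0 -> dord d G = mult G -> d' != d -> dord d' G = 0%N.
Proof.
move=> G0 e nd; have := @sum_dord_le G [:: d'; d] G0.
by rewrite /= inE nd big_cons big_seq1 e => /(_ isT); lia.
Qed.

(** * Divisibility, irreducible germs and orders along curves *)

Implicit Types (w : germ).

Lemma conv_shift G : convergent (fun m n => G m.+1 n).
Proof.
have [K K1 Ha] := convE (Defs.coefC G); have K0 := le_trans ler01 K1.
apply: (@convI _ _ (K ^+ 2) K); rewrite ?exprn_ge0 // => m n.
by rewrite -exprD add2n -addSn.
Qed.

Lemma lexlow_factor G i j : lexlow G i j -> exists2 k, G = u ^+ i * k & lexlow k 0 j.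
Proof.
elim: i G => [|i IH] G [nz row col]; first by exists G; rewrite ?mul1r //; split.
have e : G = u * mk_germ (conv_shift G).
  by apply: germ_eq => -[|m] n; rewrite uM //= row.
have [|k kE lk] := IH (mk_germ (conv_shift G)).
  by split=> //= i' j' lt; rewrite row.
by exists k => //; rewrite {1}e kE exprS mulrA.
Qed.

Lemma orb_factor d G : G != 0 -> exists2 k,
  blow d G = axis (atinf d) ^+ mult G * k & lexlow (ori (atinf d) k) 0 (dord d G).
Proof.
move=> G0; have [k kE lk] := lexlow_factor (lexlow_orb d G0).
exists (ori (atinf d) k); last by rewrite oriK.
by apply: (inv_inj (oriK (atinf d))); rewrite kE rmorphM rmorphXn /= ori_axis oriK.
Qed.

Lemma divides_ori o h G : divides (ori o h) (ori o G) <-> divides h G.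
Proof.
split=> -[k kE]; exists (ori o k); last by rewrite kE rmorphM.
by apply: (inv_inj (oriK o)); rewrite kE rmorphM /= oriK.
Qed.

Lemma divides_trans h g f : divides h g -> divides g f -> divides h f.
Proof. by case=> k -> [l ->]; exists (k * l); rewrite mulrA. Qed.

Lemma divides_mulr h g k : divides h g -> divides h (g * k).
Proof. by case=> l ->; exists (l * k); rewrite mulrA. Qed.

Lemma divides_mull h g k : divides h g -> divides h (k * g).
Proof. by rewrite mulrC; apply: divides_mulr. Qed.

Lemma divides_sub h f g : divides h f -> divides h g -> divides h (f - g).
Proof. by case=> k -> [l ->]; exists (k - l); rewrite mulrBr. Qed.

Lemma lexlow0_ndvd G j : lexlow G 0 j -> ~ divides u G.
Proof. by move=> [nz _ _] [k kE]; rewrite kE uM eqxx in nz. Qed.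

Lemma ndvd_lexlow0 G : ~ divides u G -> exists j, lexlow G 0 j.
Proof.
move=> nd; have G0 : G != 0 by apply/eqP => e; apply: nd; exists 0; rewrite mulr0.
have [[|i] [j Hij]] := lexlow_ex G0; first by exists j.
by have [k kE _] := lexlow_factor Hij; case: nd; exists (u ^+ i * k); rewrite mulrA -exprS.
Qed.

Lemma axis_prime o (a b : germ) : divides (axis o) (a * b) -> divides (axis o) a \/ divides (axis o) b.
Proof.
move=> /(@divides_ori o); rewrite rmorphM /= ori_axis => d.
have [da|na] := pselect (divides u (ori o a)).
  by left; apply/(@divides_ori o); rewrite ori_axis.
have [db|nb] := pselect (divides u (ori o b)).
  by right; apply/(@divides_ori o); rewrite ori_axis.
have [j Ha] := ndvd_lexlow0 na; have [j' Hb] := ndvd_lexlow0 nb.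
by case: (lexlow0_ndvd (lexlowM Ha Hb) d).
Qed.

Lemma divides_unit w G : w \is a GRing.unit -> divides G w -> G \is a GRing.unit.
Proof. by move=> wu [k kE]; move: wu; rewrite kE unitrM => /andP[]. Qed.

(** A smooth branch transversal to {u = 0}. *)
Definition transversal y := lexlow y 0 1.

Lemma transversal_neq0 o y : transversal (ori o y) -> y != 0.
Proof. by move=> ty; rewrite -(ori_neq0 o); apply: lexlow_neq0 ty. Qed.

Lemma transversal_nunit y : transversal y -> y \isn't a GRing.unit.
Proof. by rewrite germ_unitE negbK => -[_ _ ->]. Qed.

Lemma transversal_ndvd y w i : transversal y -> w \is a GRing.unit ->
  ~ divides y (w * u ^+ i).
Proof.
move=> ty; rewrite germ_unitE => /lexlow00 lw [k kE].
have l1 := lexlowM lw (lexlowX i (lexlow_u R)).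
have k0 : k != 0.
  by apply: contraTneq (lexlow_neq0 l1) => k0; rewrite kE k0 mulr0 eqxx.
have [a [b lk]] := lexlow_ex k0; have := lexlowM ty lk; rewrite -kE => l2.
by have [_] := lexlow_uniq l1 l2; lia.
Qed.

(** Division by y leaves remainders in u alone. The lowest monomial of a nonzero product of such
    germs is a power of u, whereas that of a multiple of y contains v. *)
Lemma transversal_prime y a b : transversal y ->
  divides y (a * b) -> divides y a \/ divides y b.
Proof.
move=> ty dab; have [q1 H1] := weierstrass_division a ty.
have [q2 H2] := weierstrass_division b ty.
have [/eqP|r1] := eqVneq (a - q1 * y) 0.
  by rewrite subr_eq0 => /eqP ->; left; apply: divides_mull; exists 1; rewrite mulr1.
have [/eqP|r2] := eqVneq (b - q2 * y) 0.
  by rewrite subr_eq0 => /eqP ->; right; apply: divides_mull; exists 1; rewrite mulr1.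
have : divides y ((a - q1 * y) * (b - q2 * y)).
  have -> : (a - q1 * y) * (b - q2 * y) = a * b - y * (q1 * b + q2 * a - q1 * q2 * y) by ring.
  by apply: divides_sub => //; eexists; reflexivity.
case=> k kE; have k0 : k != 0.
  by apply: contraTneq (mulf_neq0 r1 r2) => k0; rewrite kE k0 mulr0 eqxx.
have [i1 [j1 L1]] := lexlow_ex r1; have [i2 [j2 L2]] := lexlow_ex r2.
have [i3 [j3 L3]] := lexlow_ex k0; have := lexlowM ty L3; rewrite -kE => L.
have [_] := lexlow_uniq (lexlowM L1 L2) L.
case: L1 => n1 _ _; case: L2 => n2 _ _.
case: j1 n1 => [|j1]; last by rewrite -add1n H1 eqxx.
by case: j2 n2 => [|j2]; last by rewrite -add1n H2 eqxx.
Qed.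

Lemma transversal_irreducible y : transversal y -> irreducible_germ y.
Proof.
move=> ty; have y0 := lexlow_neq0 ty; split=> //; first exact: transversal_nunit.
have cancel (a b k : germ) : a * b = y -> a = y * k -> b \is a GRing.unit.
  move=> ab aE; apply: (@divides_unit 1); first exact: unitr1.
  by exists k; apply: (mulfI y0); rewrite mulr1 -{1}ab aE; ring.
move=> a b yab; have [] := @transversal_prime y a b ty.
- by exists 1; rewrite mulr1 -yab.
- by case=> k kE; right; apply: (cancel a b k).
- by case=> k kE; left; apply: (cancel b a k) => //; rewrite mulrC.
Qed.

Lemma principal_assoc h g t : t \is a GRing.unit -> h = g * t -> principal h = principal g.
Proof.
move=> tu hE; apply/seteqP; split=> f [k kE].
  by exists (t * k); rewrite kE hE mulrA.
by exists (t^-1 * k); rewrite kE hE mulrA -[g * t * _]mulrA divrr // mulr1.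
Qed.

Lemma irreducible_assoc h g : irreducible_germ h -> g \isn't a GRing.unit ->
  divides g h -> principal h = principal g.
Proof.
case=> h0 hn hi gn [t tE]; have [gu|tu] := hi _ _ tE; first by rewrite gu in gn.
exact: principal_assoc tu tE.
Qed.

Lemma u_nunit : u \isn't a GRing.unit.
Proof. by rewrite germ_unitE /= /monom eqxx. Qed.
Lemma axis_nunit o : (axis o : germ) \isn't a GRing.unit.
Proof. by rewrite -(ori_unit o) ori_axis u_nunit. Qed.
Lemma u_neq0 : u != 0. Proof. exact: lexlow_neq0 (lexlow_u R). Qed.
Lemma v_neq0 : v != 0. Proof. exact: lexlow_neq0 (lexlow_v R). Qed.
Lemma axis_neq0 o : (axis o : germ) != 0. Proof. by case: o; rewrite ?u_neq0 ?v_neq0. Qed.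

Lemma irreducible_dvd_nc h w o y a b : irreducible_germ h -> w \is a GRing.unit ->
    y \isn't a GRing.unit -> y != 0 ->
    (forall s t, divides y (s * t) -> divides y s \/ divides y t) ->
    divides h (w * axis o ^+ a * y ^+ b) ->
  (principal h = principal (axis o)) \/ principal h = principal y.
Proof.
move=> hi wu yn y0 yp [k]; elim: a k => [|a IHa] k.
  elim: b k => [|b IHb] k.
    rewrite !expr0 !mulr1 => e; have [_ /negP[]] := hi.
    by apply: divides_unit wu _; exists k.
  move=> e; have [] := yp h k; first by rewrite -e exprSr mulrA; apply: divides_mull; exists 1; rewrite mulr1.
    by move=> yh; right; apply: irreducible_assoc.
  case=> l lE; apply: (IHb l); apply: (mulfI y0).
  by move: e; rewrite lE exprS => e; transitivity (w * axis o ^+ 0 * (y * y ^+ b)); [|rewrite e]; ring.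
move=> e; have [] := @axis_prime o h k.
- by rewrite -e; apply: divides_mulr; rewrite exprSr mulrA; apply: divides_mull; exists 1; rewrite mulr1.
- by move=> yh; left; apply: irreducible_assoc => //; apply: axis_nunit.
- case=> l lE; apply: (IHa l); apply: (mulfI (axis_neq0 o)).
  by move: e; rewrite lE exprS => e; transitivity (w * (axis o * axis o ^+ a) * y ^+ b); [|rewrite e]; ring.
Qed.

(** All generators of the ideal are associates, so the generator picked in [ideal_order] does not
    matter. *)
Lemma ideal_orderE h (k : germ) n : h != 0 -> ~ divides h k -> ideal_order (principal h) (h ^+ n * k) = n.
Proof.
move=> h0 nd; rewrite /ideal_order.
have dX m : divides (h ^+ m) (h ^+ n * k) <-> (m <= n)%N.
  split=> [[l lE]|mn]; last first.
    by exists (h ^+ (n - m) * k); rewrite mulrA -exprD subnKC.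
  rewrite leqNgt; apply/negP => lt; apply: nd.
  exists (h ^+ (m - n.+1) * l); apply: (mulfI (expf_neq0 n h0)).
  by rewrite lE !mulrA -exprSr -exprD subnKC.
have assoc h' : principal h = principal h' ->
    forall m, divides (h' ^+ m) (h ^+ n * k) <-> divides (h ^+ m) (h ^+ n * k).
  move=> e m; have [a hE] : divides h' h.
    by rewrite -[divides _ _]/(principal h' h) -e; exists 1; rewrite mulr1.
  have [b hE'] : divides h h'.
    by rewrite -[divides _ _]/(principal h h') e; exists 1; rewrite mulr1.
  split=> H; apply: (divides_trans _ H).
    by exists (b ^+ m); rewrite -exprMn -hE'.
  by exists (a ^+ m); rewrite -exprMn -hE.
have Hn : [set m | exists h', [/\ principal h = principal h',
    divides (h' ^+ m) (h ^+ n * k) & ~ divides (h' ^+ m.+1) (h ^+ n * k)]]%classic n.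
  by exists h; split; rewrite ?dX ?ltnn.
case: xgetP => [m _ [h' [e]]|/(_ n)//].
by rewrite !(assoc _ e) !dX => mn /negP; rewrite -leqNgt => nm; lia.
Qed.

Lemma ideal_order_axis o G i j : lexlow (ori o G) i j ->
  ideal_order (principal (axis o)) G = i.
Proof.
move=> H; have [k kE lk] := lexlow_factor H.
have -> : G = axis o ^+ i * ori o k.
  by apply: (inv_inj (oriK o)); rewrite kE rmorphM rmorphXn /= ori_axis oriK.
apply: ideal_orderE; first exact: axis_neq0.
by move=> /(@divides_ori o); rewrite ori_axis oriK; apply: lexlow0_ndvd lk.
Qed.

Lemma pull_neq0 (q : infpoint R) G : G != 0 -> pull q G != 0.
Proof. by move=> G0; elim: q => //= d q; apply: blow_neq0. Qed.

Lemma vord_exc (p : infpoint R) g : g != 0 -> vord (Exc p) g = mult (pull p g).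
Proof.
by move=> g0; apply: (@ideal_order_axis false); apply: (lexlow_orb (Some 0)); apply: pull_neq0.
Qed.

Lemma mult_unit G : G \is a GRing.unit -> mult G = 0%N.
Proof.
by rewrite germ_unitE => /mult_le; rewrite leqn0 => /eqP.
Qed.

Lemma mult_gt0 G : G != 0 -> G 0%N 0%N = 0 -> (0 < mult G)%N.
Proof.
move=> G0 z; have [le nz] := dord0_coef G0.
by rewrite lt0n; apply: contraNneq nz => e; rewrite e sub0n (_ : dord _ _ = 0%N) ?z //; lia.
Qed.

(** * Jacobians and the numbers k *)

Lemma jacobian_fin c f g :
  jacobian (blow (Some c) f) (blow (Some c) g) = u * blow (Some c) (jacobian f g).
Proof.
(* [DV] and [DU] are the chain rule for the chart (u, u(v + c)), whose Jacobian determinant is u,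
   checked on coefficients. *)
have DV G : dv (blow (Some c) G) = u * blow (Some c) (dv G).
  apply: germ_eq => m n; rewrite uM /= /coef_fin; case: m => [|m] /=.
    by rewrite big_ord1 /= mulr0n mul0rn.
  rewrite big_ord_recl /= mulr0n add0r -sumrMnl; apply: eq_bigr => j _.
  rewrite /bump /= add1n !subSS -mulrnA.
  rewrite (_ : ('C(j.+1, n.+1) * n.+1 = j.+1 * 'C(j, n))%N); last by rewrite mulnC -mul_bin_diag.
  by rewrite mulrnA mulrnAl.
have DU G : du (blow (Some c) G) =
    blow (Some c) (du G) + (v + germC c) * blow (Some c) (dv G).
  apply: germ_eq => m n; rewrite germD mulrDl germD vM germCM /= /coef_fin.
  pose A j := G (m.+1 - j)%N j * c ^+ (j - n) *+ 'C(j, n).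
  pose H k := \sum_(j < m.+1) (G (m - j)%N j.+1 *+ j.+1) * c ^+ (j - k) *+ 'C(j, k).
  (* Euler's relation: m + 1 = (m + 1 - j) + j separates the contributions of the two partial
     derivatives. *)
  have -> : (\sum_(j < m.+2) A j) *+ m.+1 =
      \sum_(j < m.+2) A j *+ (m.+1 - j) + \sum_(j < m.+2) A j *+ j.
    rewrite -sumrMnl -big_split; apply: eq_bigr => j _ /=.
    by rewrite -mulrnDr subnK // -ltnS.
  congr (_ + _).
    rewrite big_ord_recr /= subnn mulr0n addr0; apply: eq_bigr => j _.
    have jm : (j <= m)%N by rewrite -ltnS.
    by rewrite /A subSn // -!mulrnAl -!mulrnA mulnC.
  rewrite big_ord_recl mulr0n add0r mulr_sumr.
  have -> : (if (0 < n)%N then H n.-1 else 0) = \sum_(j < m.+1)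
     (G (m - j)%N j.+1 *+ j.+1) * (if (0 < n)%N then c ^+ (j - n.-1) *+ 'C(j, n.-1) else 0).
    case: ifP => _; first by apply: eq_bigr => j _; rewrite [RHS]mulrnAr.
    by rewrite big1 // => j _; rewrite mulr0.
  rewrite -big_split; apply: eq_bigr => j _ /=; rewrite /A /bump /= add1n subSS.
  set a := G _ _.
  transitivity (a *+ j.+1 * (c ^+ (j.+1 - n) *+ 'C(j.+1, n))).
    by rewrite mulrnAr mulrnAl -mulrnA mulnC mulrnA.
  rewrite -mulrnAr mulrCA -mulrDr; congr (_ * _).
  case: n {A H} => [|n] /=; first by rewrite !bin0 !mulr1n add0r !subn0 exprS.
  rewrite binS mulrnDr subSS addrC; congr (_ + _).
  case: (ltnP n j) => nj; last by rewrite bin_small // mulr0n mulr0.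
  by rewrite mulrnAr -exprS subnSK.
have -> : jacobian f g = du f * dv g - dv f * du g by [].
rewrite rmorphB !rmorphM /jacobian !DU !DV /=; ring.
Qed.

Implicit Types (p q : infpoint R).

Lemma jacobian_tr f g : jacobian (tr f) (tr g) = - tr (jacobian f g).
Proof.
have DU G : du (tr G) = tr (dv G) by apply: germ_eq.
have DV G : dv (tr G) = tr (du G) by apply: germ_eq.
rewrite /jacobian !DU !DV rmorphB !rmorphM /= opprB; ring.
Qed.

Lemma jacobian_blow d f g :
  jacobian (blow d f) (blow d g) = axis (atinf d) * blow d (jacobian f g).
Proof.
case: d => [c|]; first exact: jacobian_fin.
rewrite !blow_infE jacobian_tr jacobian_fin jacobian_tr rmorphN /= mulrN rmorphN opprK.
by rewrite rmorphM /= tr_u.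
Qed.

Lemma jac_cons d q : jac (d :: q) = axis (atinf d) * blow d (jac q).
Proof. exact: jacobian_blow. Qed.

(** The numbers k of the two axes at a point, with value 1 for an axis that is not an
    exceptional divisor. *)
Fixpoint kax q : nat * nat :=
  match q with
  | [::] => (1, 1)%N
  | Some c :: q' => ((kax q').1 + (kax q').2, if c == 0%R then (kax q').2 else 1)%N
  | None :: q' => ((kax q').1, (kax q').1 + (kax q').2)%N
  end.

Lemma kax_gt0 q : (0 < (kax q).1)%N /\ (0 < (kax q).2)%N.
Proof. by elim: q => [|[c|] q [IH1 IH2]] //=; [case: ifP | ]; lia. Qed.

Lemma kax_none q : ((axes q).1 = None -> (kax q).1 = 1%N) /\
  ((axes q).2 = None -> (kax q).2 = 1%N).
Proof.
elim: q => [|[c|] q [IH1 IH2]] //=; split=> //.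
by case: eqP.
Qed.

Definition mono G i j := exists2 w, w \is a GRing.unit & G = w * u ^+ i * v ^+ j.

Lemma mono_lexlow G i j : mono G i j -> lexlow G i j /\ lexlow (tr G) j i.
Proof.
case=> w; rewrite germ_unitE => /lexlow00 lw ->; split.
  by rewrite -mulrA; apply: (lexlowM lw (lexlow_uv R i j)).
rewrite !rmorphM !rmorphXn /= tr_u tr_v -mulrA [v ^+ i * _]mulrC.
have lw' : lexlow (tr w) 0 0 by case: lw => nz _ _; split.
exact: (lexlowM lw' (lexlow_uv R j i)).
Qed.

Lemma mono_unit w : w \is a GRing.unit -> mono w 0 0.
Proof. by exists w; rewrite // !expr0 !mulr1. Qed.

Lemma mono_axis o : mono (axis o) (~~ o) o.
Proof. by case: o; exists 1; rewrite ?unitr1 //= ?expr0 ?expr1 !mul1r ?mulr1. Qed.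

Lemma monoM G H i j i' j' : mono G i j -> mono H i' j' -> mono (G * H) (i + i')%N (j + j')%N.
Proof.
case=> w wu -> [w' wu' ->]; exists (w * w'); first by rewrite unitrM wu.
by rewrite !exprD; ring.
Qed.

Lemma monoX G i j n : mono G i j -> mono (G ^+ n) (n * i)%N (n * j)%N.
Proof.
move=> H; elim: n => [|n IH]; first by rewrite expr0; apply: mono_unit; rewrite unitr1.
by rewrite exprS !mulSn; apply: monoM.
Qed.

Lemma mono_blow_inf G i j : mono G i j -> mono (blow None G) i (i + j)%N.
Proof.
case=> w wu ->; exists (blow None w); first exact: blow_unit.
by rewrite !rmorphM !rmorphXn /= blow_inf_u blow_inf_v exprMn exprD; ring.
Qed.

Lemma mono_blow_fin c G i j : mono G i j ->
  mono (blow (Some c) G) (i + j)%N (if c == 0 then j else 0%N).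
Proof.
case=> w wu ->.
have -> : blow (Some c) (w * u ^+ i * v ^+ j) =
    blow (Some c) w * u ^+ (i + j) * (v + germC c) ^+ j.
  by rewrite !rmorphM !rmorphXn /= blow_fin_u blow_fin_v exprMn exprD; ring.
case: eqP => [->|/eqP c0].
  exists (blow (Some 0) w); first exact: blow_unit.
  by rewrite (_ : germC 0 = 0) ?addr0 //; apply: germ_eq => m n; rewrite /= if_same.
exists (blow (Some c) w * (v + germC c) ^+ j); last by rewrite expr0; ring.
by rewrite unitrM blow_unit // unitrX // germ_unitE germD /= /monom /= add0r.
Qed.

Lemma jac_mono q : mono (jac q) (kax q).1.-1 (kax q).2.-1.
Proof.
elim: q => [|d q IH].
  apply: mono_unit; rewrite germ_unitE /jac /jacobian germB !germM00 /= /monom /=.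
  by rewrite !mulr1n mulr0 subr0 mulr1 oner_eq0.
have [k1 k2] := kax_gt0 q; rewrite jac_cons; case: d => [c|] /=.
  have := monoM (mono_axis false) (mono_blow_fin c IH).
  by case: eqP => _; congr mono; lia.
by have := monoM (mono_axis true) (mono_blow_inf IH); congr mono; lia.
Qed.

Lemma knum_exc p : knum (Exc p) = ((kax p).1 + (kax p).2)%N.
Proof.
have [l _] := mono_lexlow (jac_mono (Some 0 :: p)).
rewrite /knum /= (@ideal_order_axis false _ _ _ l) /=.
by have [k1 k2] := kax_gt0 p; lia.
Qed.

(** * Descending curves through a blow-up *)

Lemma lexlow0_blow_inf G j : lexlow (blow None G) 0 j <-> lexlow G 0 j.
Proof.
(* The chart (uv, v) is the identity on {u = 0}. *)
have e n : blow None G 0%N n = G 0%N n by rewrite coef_blow_inf /= subn0.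
split=> -[nz _ col]; split=> //.
- by rewrite -e.
- by move=> j' lt; rewrite -e col.
- by rewrite e.
- by move=> j' lt; rewrite e col.
Qed.

(** By Weierstrass preparation, [h] may be replaced by a monic polynomial in [v] of
    degree [m] over the ring of germs in [u], which descends through the chart
    [(u, v) |-> (u, u(v + c))] after multiplication by [u ^+ m]. *)
Lemma blow_down_fin c h m : lexlow h 0 m -> exists h',
  (exists2 w, w \is a GRing.unit & blow (Some c) h' = w * u ^+ m * h) /\
  forall G, divides h (blow (Some c) G) -> divides h' G.
Proof.
move=> lh; have [q Hq] := weierstrass_division (v ^+ m) lh.
set r := v ^+ m - q * h in Hq.
pose P := q * h.
have Pv i j : P i j = (v ^+ m) i j - r i j by rewrite /r /P germB opprB addrC subrK.
have vm i j : (v ^+ m) i j = ((i == 0%N) && (j == m))%:R :> C.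
  by rewrite -[v ^+ m]mul1r -[1](expr0 u) -monom_uv.
have P0 i j : (m < j)%N -> P i j = 0.
  move=> mj; rewrite Pv vm -(subnKC (ltnW mj)) Hq subr0.
  by rewrite (_ : (_ == m) = false) ?andbF //; apply/eqP; lia.
have Pm i : P i m = (i == 0%N)%:R by rewrite Pv vm -[X in r _ X]addn0 Hq subr0 eqxx andbT.
have qu : q \is a GRing.unit.
  rewrite germ_unitE; have := Pm 0%N; rewrite eqxx /P germM big_ord1 /=.
  rewrite (bigD1 ord0) //= subn0 big1 ?addr0 => [e|j nj].
    by apply: contraTneq (oner_neq0 C) => q0; rewrite -[1]e q0 mul0r eqxx.
  case: lh => _ _ -> ; rewrite ?mulr0 //; case: j nj => -[|j] jm //= _.
  by move: jm; lia.
have conv_col j : convergent (fun i n => if n == 0%N then P i j else 0).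
  have [K K1 Ha] := convE (Defs.coefC P); have K0 := le_trans ler01 K1.
  apply: (@convI _ _ (K ^+ j.+1) K); rewrite ?exprn_ge0 // => i n.
  case: ifP => _; last by rewrite normr0 mulr_ge0 ?exprn_ge0.
  apply: le_trans (Ha i j) _; rewrite -exprD; apply: ler_weXn2l => //; lia.
pose col j := mk_germ (conv_col j).
have blow_col j : blow (Some c) (col j) = col j.
  apply: germ_eq => i n; rewrite blow_finE.
  have -> : hpart (col j) i = (col j i 0%N)%:P.
    apply/polyP => l; rewrite coef_poly coefC ltnS; case: l => [|l] /=; first by rewrite subn0.
    by rewrite if_same.
  by rewrite comp_polyC coefC; case: n.
have PE : P = \sum_(j < m.+1) col j * v ^+ j.
  apply: germ_eq => i n; rewrite germ_sum; case: (leqP n m) => nm.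
    rewrite (bigD1 (Ordinal (nm : (n < m.+1)%N))) // big1 ?addr0 => [|j nj].
      by rewrite mulrC vXE /= leqnn subnn addr0.
    rewrite mulrC vXE; case: leqP => //= jn; case: eqP => // e.
    by case/eqP: nj; apply: val_inj => /=; lia.
  rewrite P0 // big1 // => j _; rewrite mulrC vXE; case: leqP => //= jn; case: eqP => // e.
  by have := ltn_ord j; lia.
(* The chart sends v - c u to u v, so each term of the Weierstrass polynomial P acquires the factor
   u ^+ m. *)
pose h' := \sum_(j < m.+1) col j * u ^+ (m - j) * (v - germC c * u) ^+ j.
have bh' : blow (Some c) h' = q * u ^+ m * h.
  rewrite mulrAC -/P PE mulr_suml rmorph_sum; apply: eq_bigr => j _ /=.
  rewrite !rmorphM !rmorphXn rmorphB rmorphM /=.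
  rewrite blow_fin_u blow_fin_v blow_C blow_col.
  have -> : u * (v + germC c) - germC c * u = u * v by ring.
  rewrite exprMn; transitivity (col j * v ^+ j * (u ^+ (m - j) * u ^+ j)); first by ring.
  by rewrite -exprD subnK // -ltnS.
exists h'; split; first by exists q.
have lo : lexlow (blow (Some c) h') m m.
  have lq : lexlow q 0 0 by apply/lexlow00; rewrite -germ_unitE.
  rewrite bh' -mulrA; have := lexlowM lq (lexlowM (lexlow_uv R m 0) lh).
  by rewrite !add0n addn0 expr0 mulr1.
have [mh dh] := orb_mult (d := Some c) lo.
have h'0 : h' != 0.
  apply: contraTneq (lexlow_neq0 lo) => ->.
  by rewrite raddf0 eqxx.
(* The leading form of h' is concentrated in the direction c, so h' is not tangent to {u = 0} and
   can serve as a divisor of degree m. *)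
have lh' : lexlow h' 0 m.
  apply/lexlow0_blow_inf; have [k kE lk] := orb_factor None h'0.
  have d0 : dord None h' = 0%N by apply: (@dord_pure (Some c)); rewrite ?mh ?dh.
  rewrite kE mh; rewrite d0 in lk.
  have lk' : lexlow k 0 0 by apply/lexlow00; case: lk.
  by have := lexlowM (lexlow_uv R 0 m) lk'; rewrite expr0 mul1r !addn0.
move=> G hG; have [Q HQ] := weierstrass_division G lh'.
set s := G - Q * h' in HQ.
have [s0|s0] := eqVneq s 0.
  by exists Q; apply/eqP; rewrite mulrC -subr_eq0 -/s s0.
have [k kE] : divides h (blow (Some c) s).
  rewrite rmorphB; apply: divides_sub => //=; rewrite rmorphM /= bh'.
  by exists (blow (Some c) Q * q * u ^+ m); ring.
have b0 := blow_neq0 (Some c) s0.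
have k0 : k != 0 by apply: contraTneq b0 => k0; rewrite kE k0 mulr0 eqxx.
(* The lowest monomial of a multiple of h contains v^m, but the blown-up remainder still has degree
   below m in v. *)
have [i [j lk]] := lexlow_ex k0; have := lexlowM lh lk; rewrite -kE => -[nz _ _].
case/eqP: nz; rewrite blow_finE nth_default // size_comp_poly2 ?size_XaddC //.
apply: leq_trans (leq_addr _ _); apply/leq_sizeP => l ml.
by rewrite coef_poly -(subnKC ml) HQ if_same.
Qed.

(** The whole multiplicity of h' lies in the direction d, which makes the pull-backs in all other
    directions purely exceptional. *)
Lemma blow_down d h m : lexlow (ori (atinf d) h) 0 m -> exists2 h', h' != 0 &
  [/\ (exists2 w, w \is a GRing.unit & blow d h' = w * axis (atinf d) ^+ m * h),
      mult h' = m,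
      (forall d', d' != d -> exists2 w, w \is a GRing.unit &
         blow d' h' = w * axis (atinf d') ^+ m) &
      forall G, divides h (blow d G) -> divides h' G].
Proof.
move=> lh; have [h' [[w wu wE] dv]] : exists h',
  (exists2 w, w \is a GRing.unit & blow d h' = w * axis (atinf d) ^+ m * h) /\
  forall G, divides h (blow d G) -> divides h' G.
  case: d lh => [c|] lh; first exact: blow_down_fin.
  have [h' [[w wu wE] dv]] := blow_down_fin 0 lh.
  exists (tr h'); split.
    exists (tr w); first by rewrite tr_unit.
    by rewrite blow_infE trK wE !rmorphM rmorphXn /= trK tr_u.
  move=> G /(@divides_ori true); rewrite blow_inf_ori => /dv/(@divides_ori true).
  by rewrite /= trK.
have lo : lexlow (ori (atinf d) (blow d h')) m m.
  rewrite wE !rmorphM rmorphXn /= ori_axis.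
  have lw := lexlow_unit (atinf d) wu.
  by have := lexlowM (lexlowM lw (lexlow_uv R m 0)) lh; rewrite !add0n !addn0 expr0 mulr1.
have [mh dh] := orb_mult lo.
have h'0 : h' != 0.
  by apply: contraTneq (lexlow_neq0 lo) => ->; rewrite raddf0 rmorph0 eqxx.
exists h' => //; split=> //; first by exists w.
move=> d' nd; have [k kE lk] := orb_factor d' h'0.
have d0 : dord d' h' = 0%N by apply: (@dord_pure d); rewrite ?mh ?dh.
rewrite d0 in lk; exists k; last by rewrite kE mh mulrC.
by rewrite -(ori_unit (atinf d')) germ_unitE; apply/lexlow00.
Qed.

End BlowUps.
Arguments axis {R} o.

(** * Infinitely near points and their axes *)

Section InfinitelyNear.
Variable R : realType.
Local Notation germ := (germ R).
Local Notation infpoint := (infpoint R).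
Implicit Types (f g h G H w : germ) (d : direction R) (o : bool) (p q : infpoint).
Implicit Types (s : seq infpoint).

(** The points over [p] that lie on the strict transforms of the exceptional divisor of
    [p] and over its point of direction [d]. *)
Definition nxt d : direction R := if d is Some _ then None else Some 0.
Definition pt p d k : infpoint := nseq k (nxt d) ++ d :: p.

Definition ax o q : option infpoint := if o then (axes q).2 else (axes q).1.

(** The older exceptional divisor through the point of direction [d]. *)
Definition olda p d : option infpoint :=
  if d is Some c then (if c == 0 then (axes p).2 else None) else (axes p).1.

Lemma size_pt p d k : size (pt p d k) = (k + (size p).+1)%N.
Proof. by rewrite size_cat size_nseq. Qed.

Lemma pt_inj p d d' k k' : pt p d k = pt p d' k' -> d = d' /\ k = k'.
Proof.
move=> e; have kk : k = k' by have := congr1 size e; rewrite !size_pt; lia.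
subst k'; split=> //; have := congr1 (fun q : infpoint => nth None (rev q) (size p)) e.
by rewrite /pt !rev_cat !rev_cons !nth_cat !size_rcons !size_rev leqnn !nth_rcons !size_rev ltnn eqxx.
Qed.

Lemma ax_pt p d k : ax (atinf d) (pt p d k) = Some p.
Proof. by elim: k => [|k]; case: d => [c|] //=; rewrite eqxx. Qed.

Lemma ax_opt0 p d : ax (~~ atinf d) (pt p d 0) = olda p d.
Proof. by case: d => [c|]. Qed.
Lemma ax_optS p d k : ax (~~ atinf d) (pt p d k.+1) = Some (pt p d k).
Proof. by case: d => [c|]. Qed.

Lemma ax_inv o q p : ax o q = Some p -> exists d k, q = pt p d k /\ o = atinf d.
Proof.
elim: q o => [|d q IH] o; first by case: o.
have next o' d' k : q = pt p d' k -> d = nxt d' -> o' = atinf d' ->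
    exists d0 k0, d :: q = pt p d0 k0 /\ o' = atinf d0.
  by move=> -> -> ->; exists d', k.+1.
case: d next => [c|] next; case: o => /=.
- case: eqP => // c0 /(IH true)[d [k [qE dE]]].
  by apply: (next _ _ _ qE) => //; case: d dE {qE} => //; rewrite c0.
- by case=> ->; exists (Some c), 0%N.
- by case=> ->; exists None, 0%N.
- move=> /(IH false)[d [k [qE dE]]].
  by apply: (next _ _ _ qE) => //; case: d dE {qE}.
Qed.

Lemma ax_size o q p : ax o q = Some p -> (size p < size q)%N.
Proof. by move=> /ax_inv[d [k [-> _]]]; rewrite size_pt; lia. Qed.

Lemma ax_neq q p : ax false q = Some p -> ax true q = Some p -> False.
Proof.
move=> /ax_inv[d [k [qE dE]]] /ax_inv[d' [k' [qE' dE']]].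
by have [e _] := pt_inj (etrans (esym qE) qE'); subst d'; rewrite -dE in dE'.
Qed.

Lemma ax_olda p d a : olda p d = Some a -> ax (~~ atinf d) p = Some a.
Proof. by case: d => [c|] //=; case: ifP. Qed.

Lemma olda_dir p d a : olda p d = Some a -> d = if atinf d then None else Some 0.
Proof. by case: d => [c|] //=; case: eqP => // ->. Qed.

Lemma exc_eqP p q e : exc_eq p q = Some e <-> exists2 o, ax o q = Some p & e = axis o.
Proof.
rewrite /exc_eq; split; last first.
  case=> -[] /= aE ->; rewrite aE eqxx //.
  by case: ifP => // /eqP aE1; case: (ax_neq aE1 aE).
case: ifP => [/eqP aE [<-]|_]; first by exists false.
by case: ifP => // /eqP aE [<-]; exists true.
Qed.

Lemma exc_through p q : exc_eq p q <> None <-> exists o, ax o q = Some p.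
Proof.
split=> [|[o aE]].
  by case E: (exc_eq p q) => [e|//] _; have [o ? _] := (exc_eqP p q e).1 E; exists o.
by rewrite ((exc_eqP p q (axis o)).2 _) //; exists o.
Qed.

Lemma lexlow_blow_inf G i j : lexlow G i j -> lexlow (blow None G) i (j + i)%N.
Proof.
case=> nz row col; split=> [|i' j' lt|j' lt]; rewrite coef_blow_inf.
- by rewrite leq_addl addnK.
- by case: ifP => // _; apply: row.
- by case: ifP => // le; apply: col; lia.
Qed.

(** Seen from the strict transform of [Exc p], every later blow-up of a point on it is the chart at
    infinity, which adds the multiplicity to the residual intersection number. *)
Lemma lexlow_pt p d k g : g != 0 ->
  lexlow (ori (atinf d) (pull (pt p d k) g)) (mult (pull p g))
    (dord d (pull p g) + k * mult (pull p g))%N.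
Proof.
move=> g0; elim: k => [|k IH]; first by rewrite addn0; apply: lexlow_orb; apply: pull_neq0.
rewrite mulSn addnCA addnC; have := lexlow_blow_inf IH.
case: d {IH} => [c|] //=.
by rewrite -/(pt p None k) blow_infE trK.
Qed.

Lemma lexlow_ax o q p g : ax o q = Some p -> g != 0 ->
  exists j, lexlow (ori o (pull q g)) (vord (Exc p) g) j.
Proof.
move=> /ax_inv[d [k [-> ->]]] g0; rewrite vord_exc //.
by eexists; apply: lexlow_pt.
Qed.

Lemma mono_ori o G i j : mono G i j -> lexlow (ori o G) (if o then j else i) (if o then i else j).
Proof. by case: o => /mono_lexlow[]. Qed.

Lemma mono_vord o q p g i j : g != 0 -> mono (pull q g) i j -> ax o q = Some p ->
  vord (Exc p) g = if o then j else i.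
Proof.
move=> g0 mg /lexlow_ax/(_ g0)[j' l].
by have [] := lexlow_uniq l (mono_ori o mg).
Qed.

Lemma mono_vord_pt p d k g i j a : g != 0 -> mono (pull (pt p d k) g) i j ->
  ax (~~ atinf d) (pt p d k) = Some a ->
  vord (Exc a) g = (dord d (pull p g) + k * mult (pull p g))%N.
Proof.
move=> g0 mg aE; rewrite (mono_vord g0 mg aE).
by have := lexlow_uniq (mono_ori (atinf d) mg) (lexlow_pt p d k g0); case: (atinf d) => -[].
Qed.

Definition kcomp o q : nat := if o then (kax q).2 else (kax q).1.

(** [kdir p d] is k of the older divisor in the direction [d] (1 if there is none). *)
Definition kdir p d : nat :=
  if d is Some c then (if c == 0 then (kax p).2 else 1%N) else (kax p).1.

Lemma kcomp_pt p d k : kcomp (atinf d) (pt p d k) = knum (Exc p) /\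
  kcomp (~~ atinf d) (pt p d k) = (kdir p d + k * knum (Exc p))%N.
Proof.
rewrite knum_exc; elim: k => [|k [IH1 IH2]].
  by case: d => [c|]; rewrite /= addn0.
rewrite mulSn; case: d IH1 IH2 => [c|]; rewrite /pt /kcomp /= => IH1 IH2;
  rewrite ?eqxx IH1 IH2; lia.
Qed.

Lemma kcomp_ax o q p : ax o q = Some p -> kcomp o q = knum (Exc p).
Proof. by move=> /ax_inv[d [k [-> ->]]]; have [] := kcomp_pt p d k. Qed.

Lemma knum_opt p d k a : ax (~~ atinf d) (pt p d k) = Some a ->
  knum (Exc a) = (kdir p d + k * knum (Exc p))%N.
Proof. by move=> /kcomp_ax <-; have [] := kcomp_pt p d k. Qed.

Lemma kdir_none p d : olda p d = None -> kdir p d = 1%N.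
Proof.
have [k1 k2] := kax_none p; case: d => [c|] /=; last exact: k1.
by case: ifP.
Qed.

Lemma pt_notin s p d : exists k, pt p d k \notin s.
Proof.
have [n sn] : exists n, forall q, q \in s -> (size q <= n)%N.
  elim: s => [|q s [n IH]]; first by exists 0%N.
  exists (maxn (size q) n) => q'; rewrite inE => /orP[/eqP ->|/IH]; lia.
exists n.+1; apply/negP => /sn; rewrite size_pt; lia.
Qed.
(** The number of blow-ups of points of [Exc p] over the direction d: the point of Y there is
    [pt p d (ydepth s p d)]. *)
Definition ydepth s p d : nat := ex_minn (pt_notin s p d).

Section Blowups.
Variable s : seq infpoint.
Hypothesis bs : blowups s.

Lemma blowups_tail d q : d :: q \in s -> q \in s /\ (index q s < index (d :: q) s)%N.
Proof.
move=> ds; have [us /(_ (index (d :: q) s))] := bs.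
rewrite index_mem nth_index // => /(_ ds) qt.
by have := index_ltn qt; split=> //; apply: mem_take qt.
Qed.

Lemma blowups_suffix l q : l ++ q \in s -> q \in s /\ (index q s <= index (l ++ q) s)%N.
Proof.
elim: l => [|d l IH] //= /blowups_tail[/IH[qs le] lt]; split=> //.
by apply: leq_trans le (ltnW lt).
Qed.

Lemma ydepthP p d k : p \in s -> (pt p d k \in s) = (k < ydepth s p d)%N.
Proof.
move=> ps; rewrite /ydepth; case: ex_minnP => m nm min.
case: ltnP => km; first by apply/negPn/negP => /min; lia.
apply/negP => ks; case/negP: nm; move: ks; rewrite -(subnK km) /pt nseqD -catA.
by move=> /blowups_suffix[].
Qed.

Lemma on_Y_pt p d : p \in s -> on_Y s (pt p d (ydepth s p d)).
Proof.
move=> ps; split; first by rewrite ydepthP // ltnn.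
case E: (ydepth s p d) => [|m] //=.
by rewrite -/(pt p d m) ydepthP // E.
Qed.

Lemma on_Y_suffix l q : on_Y s (l ++ q) -> l != [::] -> q \in s.
Proof. by case: l => // d l [_ /=] /blowups_suffix[]. Qed.

Lemma ax_on_Y o q p : on_Y s q -> ax o q = Some p ->
  [/\ p \in s & exists2 d, q = pt p d (ydepth s p d) & o = atinf d].
Proof.
move=> yq /ax_inv[d [k [qE oE]]].
have ps : p \in s.
  by move: yq; rewrite qE /pt -cat1s catA => /on_Y_suffix; apply; case: (k).
split=> //; exists d => //; rewrite qE; congr pt.
have := yq; rewrite qE => -[nk]; rewrite ydepthP // in nk.
case: k {qE} nk => [|k] nk /=; first by lia.
by rewrite -/(pt p d k) ydepthP // => lt; lia.
Qed.

Lemma ax_mem o q p : on_Y s q \/ q \in s -> ax o q = Some p -> p \in s.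
Proof.
case=> [yq /(ax_on_Y yq)[]//|qs /ax_inv[d [k [qE _]]]].
by move: qs; rewrite qE /pt -cat1s catA => /blowups_suffix[].
Qed.

End Blowups.
End InfinitelyNear.

(** * Normal crossings at a point of an axis *)

Section NormalCrossings.
Variable R : realType.
Local Notation germ := (germ R).
Local Notation infpoint := (infpoint R).
Implicit Types (f g h x y G H w : germ) (d : direction R) (o : bool) (p q : infpoint).

Local Notation u := (coord_u R).
Local Notation v := (coord_v R).

Lemma jacobian00 x y : jacobian x y 0%N 0%N =
  x 1%N 0%N * y 0%N 1%N - x 0%N 1%N * y 1%N 0%N.
Proof. by rewrite /jacobian germB !germM00. Qed.

Lemma coordinate_systemC x y : coordinate_system x y -> coordinate_system y x.
Proof.
case=> x0 y0 j; split=> //; apply: contraNneq j => e; apply/eqP.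
have -> : jacobian x y = - jacobian y x by rewrite /jacobian; ring.
by rewrite germN e oppr0.
Qed.

Lemma coordinate_system_tr x y : coordinate_system x y -> coordinate_system (tr x) (tr y).
Proof. by case=> x0 y0 j; split=> //; rewrite jacobian_tr germN oppr_eq0. Qed.

Lemma normal_crossing_ori o G : normal_crossing G -> normal_crossing (ori o G).
Proof.
case: o => // -[w [x [y [a [b [wu c ->]]]]]].
exists (tr w), (tr x), (tr y), a, b; split; rewrite ?tr_unit //.
  exact: coordinate_system_tr.
by rewrite !rmorphM !rmorphXn.
Qed.

Lemma coordinate_system_u x : coordinate_system u x -> transversal x.
Proof.
case=> _ x0; rewrite jacobian00 /= /monom /=.
by rewrite mul1r mul0r subr0 => nz; split=> // -[].
Qed.

Lemma coordinate_axis o : coordinate_system (axis o) (axis (~~ o) : germ).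
Proof.
have cs : coordinate_system u v.
  split=> //; rewrite jacobian00 /= /monom /=.
  by rewrite mul0r subr0 mul1r oner_neq0.
by case: o => //; apply: coordinate_systemC.
Qed.

Lemma divides_axisX o G n : divides (axis o) (G ^+ n) -> divides (axis o) G.
Proof.
elim: n => [|n IH]; last by rewrite exprS => /axis_prime[].
rewrite expr0 => /divides_unit; rewrite unitr1 => /(_ isT) au.
by have := axis_nunit R o; rewrite au.
Qed.

Lemma coordinate_axis_dvd x y : coordinate_system x y -> divides u x ->
  exists2 t, t \is a GRing.unit & x = u * t /\ transversal y.
Proof.
move=> cs [t xE]; exists t.
  rewrite germ_unitE; apply/eqP => t0; case: cs => _ _.
  by rewrite jacobian00 xE !uM /= t0 !mul0r subr0 eqxx.
split=> //; case: cs => _ y0; rewrite xE jacobian00 !uM /= mul0r subr0 mulf_eq0 negb_or.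
by case/andP => _ nz; split=> // -[].
Qed.

(** The axis is prime, so it divides one of the two coordinates; the nonzero Jacobian makes the
    quotient a unit and the other coordinate transversal. *)
Lemma normal_crossing_axis o G : normal_crossing G -> divides (axis o) G ->
  exists w y a b, [/\ w \is a GRing.unit, transversal (ori o y) & G = w * axis o ^+ a * y ^+ b].
Proof.
wlog -> : o G / o = false => [hw nc|nc] dG; last first.
- case: nc => [w [x [y [a [b [wu cs GE]]]]]].
  have : divides u x \/ divides u y.
    move: dG; rewrite GE => /(@axis_prime R false)[/(@axis_prime R false)[|]|].
    + by move=> /divides_unit-/(_ wu); rewrite (negPf (u_nunit R)).
    + by move=> /(@divides_axisX false); left.
    + by move=> /(@divides_axisX false); right.
  case=> [/(coordinate_axis_dvd cs)|/(coordinate_axis_dvd (coordinate_systemC cs))] [t tu [xE ty]].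
    exists (w * t ^+ a), y, a, b; split=> //; first by rewrite unitrM wu unitrX.
    by rewrite GE xE exprMn /=; ring.
  exists (w * t ^+ b), x, b, a; split=> //; first by rewrite unitrM wu unitrX.
  by rewrite GE xE exprMn /=; ring.
- case: o dG => dG; last exact: hw.
  have [|w [y [a [b [wu ty GE]]]]] := hw false (ori true G) erefl (normal_crossing_ori true nc).
    by rewrite -[axis false]/(coord_u R) -(ori_axis R true); apply/divides_ori.
  exists (tr w), (tr y), a, b; split; rewrite ?tr_unit //=.
  by rewrite -[G]trK -[tr G]/(ori true G) GE !rmorphM !rmorphXn /= tr_u.
Qed.

Lemma normal_crossing_axes G : normal_crossing G -> divides u G -> divides v G ->
  exists i j, mono G i j.
Proof.
move=> nc dU dV; have [w [y [a [b [wu ty GE]]]]] := normal_crossing_axis (o := false) nc dU.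
exists a, b.
have [k yE] : divides v y.
  move: dV; rewrite GE => /(@axis_prime R true)[/(@axis_prime R true)[|]|].
  - by move=> /divides_unit-/(_ wu); rewrite (negPf (axis_nunit R true)).
  - move=> /(@divides_axisX true)[k /(congr1 (fun G : germ => G 1%N 0%N))].
    by rewrite vM /= /monom /= => /eqP; rewrite oner_eq0.
  - by move=> /(@divides_axisX true).
exists (w * k ^+ b); last by rewrite GE yE exprMn /=; ring.
rewrite unitrM wu unitrX // germ_unitE; case: ty => nz _ _.
by move: nz; rewrite /= yE vM.
Qed.

End NormalCrossings.

(** * Components of F_pi meeting a given exceptional divisor *)

Section AdjacentDivisors.
Variable R : realType.
Local Notation germ := (germ R).
Local Notation infpoint := (infpoint R).
Implicit Types (g h x y G H w : germ) (d : direction R) (o : bool) (p q : infpoint).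

Local Notation u := (coord_u R).
Local Notation v := (coord_v R).

Lemma blowupsP (s : seq infpoint) : blowups s <->
  uniq s /\ forall s1 d q s2, s = s1 ++ (d :: q) :: s2 -> q \in s1.
Proof.
split=> -[us H]; split=> //.
  move=> s1 d q s2 sE; have := H (size s1); rewrite sE size_cat /= addnS ltnS leq_addr.
  by move=> /(_ isT); rewrite nth_cat ltnn subnn take_size_cat.
move=> n ns; case E: (nth [::] s n) => [//|d q].
apply: (H (take n s) d q (drop n.+1 s)).
by rewrite -E -drop_nth // cat_take_drop.
Qed.

Implicit Types (J : set germ) (D : divisor R).

Variables (f : germ) (s : seq infpoint).
Hypotheses (f0 : f != 0) (f00 : f 0%N 0%N = 0) (hs : minimal_log_resolution f s).

Let bs : blowups s. Proof. by have [[]] := hs. Qed.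

(** Minimality: otherwise q and all the centers over it could be omitted. *)
Lemma center_not_nc q : q \in s -> ~ normal_crossing (pull q f).
Proof.
move=> qs nc; have [[_ lr] min] := hs.
pose s' := [seq r <- s | ~~ suffix q r].
suff /min/(_ q qs) : log_resolution f s' by rewrite mem_filter suffix_refl.
have tails r : on_Y s' r -> r = q \/ on_Y s r.
  case; rewrite mem_filter; case: (boolP (r \in s)) => rs; last first.
    by move=> _ t; right; split=> //; case: r t {rs} => // d r; rewrite mem_filter => /andP[].
  rewrite andbT negbK => /suffixP[l rE] t; left.
  case: l rE t => [-> //|d l] -> /=.
  by rewrite mem_filter suffix_suffix.
split; last by move=> r /tails[->|/lr].
have [us H] := (blowupsP s).1 bs.
apply/blowupsP; split.
  exact: filter_uniq.
move=> s1 d r s2 sE.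
have rs' : (d :: r) \in s'.
  by rewrite sE mem_cat inE eqxx orbT.
move: rs'. rewrite mem_filter. move=> /andP[nq rs].
have [t1 [t2 sE']] : exists t1 t2, s = t1 ++ (d :: r) :: t2.
  by case/splitPr: rs => t1 t2; exists t1, t2.
have rt := H _ _ _ _ sE'.
have -> : s1 = [seq r <- t1 | ~~ suffix q r].
  have us' : uniq s' by apply: filter_uniq.
  have e : s1 ++ (d :: r) :: s2 =
      [seq r <- t1 | ~~ suffix q r] ++ (d :: r) :: [seq r <- t2 | ~~ suffix q r].
    by rewrite -sE /s' sE' filter_cat /= nq.
  have i1 : index (d :: r) (s1 ++ (d :: r) :: s2) = size s1.
    move: us'; rewrite sE cat_uniq => /and3P[_ /hasPn/(_ _ (mem_head _ _)) n1 _].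
    by rewrite index_cat (negPf n1) /= eqxx addn0.
  have i2 : index (d :: r) (s1 ++ (d :: r) :: s2) = size [seq r <- t1 | ~~ suffix q r].
    move: us'; rewrite sE e cat_uniq => /and3P[_ /hasPn/(_ _ (mem_head _ _)) n1 _].
    by rewrite index_cat (negPf n1) /= eqxx addn0.
  by have := congr1 (take (size s1)) e; rewrite take_size_cat // -i1 i2 take_size_cat.
rewrite mem_filter rt andbT; apply: contraNN nq => /suffixP[l ->].
by apply/suffixP; exists (d :: l).
Qed.

Lemma mult_pull_gt0 p g : g != 0 -> g 0%N 0%N = 0 -> (0 < mult (pull p g))%N.
Proof. by move=> g0 g00; apply: mult_gt0; rewrite ?pull00 ?pull_neq0. Qed.

Lemma ax_other o q p p' : ax o q = Some p -> ax (~~ o) q = Some p' -> p <> p'.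
Proof.
case: o => /= a1 a2 e; subst p'; [exact: (@ax_neq _ q p)|].
exact: (@ax_neq _ q p).
Qed.

Let nc q : on_Y s q -> normal_crossing (pull q f). Proof. by have [[_]] := hs => + _; apply. Qed.

Lemma axis_divides o q p : ax o q = Some p -> divides (axis o) (pull q f).
Proof.
move=> /lexlow_ax/(_ f0)[j]; rewrite vord_exc //.
have := mult_pull_gt0 p f0 f00; case: (mult _) => // n _ /lexlow_factor[k kE _].
apply/(@divides_ori _ o); rewrite ori_axis kE.
by exists (coord_u R ^+ n * k); rewrite exprS mulrA.
Qed.

Lemma double_point q a b : on_Y s q -> ax false q = Some a -> ax true q = Some b ->
  exists i j, mono (pull q f) i j.
Proof.
move=> yq /axis_divides dU /axis_divides dV.
exact: normal_crossing_axes (nc yq) dU dV.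
Qed.

Lemma double_point_no_str q a b J : ax false q = Some a -> ax true q = Some b ->
  ~ component f s (Str q J).
Proof.
move=> aE bE [yq [h [hi JE hd he]]].
have [i [j [w wu E]]] := double_point yq aE bE; rewrite E in hd.
have eu : exc_eq a q = Some (axis false) by apply/exc_eqP; exists false.
have ev : exc_eq b q = Some (axis true) by apply/exc_eqP; exists true.
case: (@irreducible_dvd_nc _ h w false (axis true) i j hi wu) => //.
- exact: axis_nunit.
- exact: axis_neq0.
- exact: axis_prime.
- by move=> e; apply: (he _ _ eu); rewrite JE.
- by move=> e; apply: (he _ _ ev); rewrite JE.
Qed.

(** A point [pt p d k] with k > 0 also lies on a younger divisor. If there is no second divisor,
    then [d :: p] is not blown up and f has normal crossings at it. *)
Lemma free_point p d : p \in s -> ax (~~ atinf d) (pt p d (ydepth s p d)) = None ->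
  [/\ ydepth s p d = 0%N, olda p d = None, on_Y s (d :: p) &
   exists w i y, [/\ w \is a GRing.unit, transversal (ori (atinf d) y) &
     pull (d :: p) f = w * axis (atinf d) ^+ i * y ^+ dord d (pull p f)]].
Proof.
move=> ps; have := on_Y_pt bs d ps.
case E: (ydepth s p d) => [|m]; last by rewrite ax_optS.
rewrite ax_opt0 => yq od; split=> //.
have [w [y [a [b [wu ty GE]]]]] := normal_crossing_axis (nc yq) (axis_divides (ax_pt p d 0)).
exists w, a, y; split=> //; rewrite -[d :: p]/(pt p d 0) GE; congr (_ * _ ^+ _).
have l : lexlow (ori (atinf d) (pull (pt p d 0) f)) a b.
  rewrite GE !rmorphM !rmorphXn /= ori_axis.
  have lw := lexlow_unit (atinf d) wu.
  have := lexlowM (lexlowM lw (lexlow_uv R a 0)) (lexlowX b ty).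
  by rewrite expr0 mulr1 !add0n muln0 muln1 addn0.
by have [_] := lexlow_uniq l (lexlow_pt p d 0 f0); rewrite mul0n addn0.
Qed.

Lemma free_point_str p d w i y b J : on_Y s (d :: p) -> olda p d = None ->
    w \is a GRing.unit -> transversal (ori (atinf d) y) ->
    pull (d :: p) f = w * axis (atinf d) ^+ i * y ^+ b ->
  component f s (Str (d :: p) J) <-> (0 < b)%N /\ J = principal y.
Proof.
move=> yq od wu ty fE.
have y0 := transversal_neq0 ty.
have yn : y \isn't a GRing.unit by rewrite -(ori_unit (atinf d)); apply: transversal_nunit.
have yp (a c : germ) : divides y (a * c) -> divides y a \/ divides y c.
  move=> /(@divides_ori _ (atinf d)); rewrite rmorphM => /(transversal_prime ty).
  by case=> /divides_ori; [left|right].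
have nd : ~ divides y (w * axis (atinf d) ^+ i).
  move=> /(@divides_ori _ (atinf d)); rewrite rmorphM rmorphXn /= ori_axis.
  by apply: transversal_ndvd => //; rewrite ori_unit.
have ep : exc_eq p (d :: p) = Some (axis (atinf d)).
  by apply/exc_eqP; exists (atinf d) => //; apply: (ax_pt p d 0).
split=> [[_ [h [hi JE hd he]]]|[b0 ->]].
  rewrite fE in hd.
  have Jy : principal h = principal y.
    case: (irreducible_dvd_nc hi wu yn y0 yp hd) => // e.
    by case: (he _ _ ep); rewrite JE.
  split; last by rewrite JE.
  rewrite lt0n; apply/eqP => b0; apply: nd; move: hd; rewrite b0 expr0 mulr1.
  have : divides y h by rewrite -[divides _ _]/(principal y h) -Jy; exists 1; rewrite mulr1.
  exact: divides_trans.
split=> //; exists y; split=> //.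
- have [r0 rn ri] := transversal_irreducible ty.
  split=> // a c yE; have := ri (ori (atinf d) a) (ori (atinf d) c).
  by rewrite !ori_unit; apply; rewrite yE rmorphM.
- by rewrite fE -(prednK b0) exprS mulrCA; eexists; reflexivity.
- move=> p' e /exc_eqP[o aE ->] Je; apply: nd.
  have : ax o (d :: p) = Some p' -> o = atinf d.
    move: od; case: (d) => [c|]; case: o {aE Je} => //=; last by move->.
    by case: ifP => // _ ->.
  move=> /(_ aE) oE; have : divides y (axis o).
    by rewrite -[divides _ _]/(principal y (axis o)) Je; exists 1; rewrite mulr1.
  case=> t tE; exfalso; have [_ _ ri] := transversal_irreducible ty.
  move: Je => /(congr1 (fun J : set germ => J y)) e'.
  have : divides (axis o) y.
    by rewrite -[divides _ _]/(principal (axis o) y) -e'; exists 1; rewrite mulr1.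
  by move=> /(@divides_ori _ o); rewrite ori_axis oE; apply: lexlow0_ndvd ty.
Qed.

(** If the leading form of f did not vanish in the direction d, then f would be purely exceptional
    at [d :: p], a normal crossing, and minimality would forbid the center. *)
Lemma blown_up_dord p d : p \in s -> d :: p \in s -> (0 < dord d (pull p f))%N.
Proof.
move=> ps qs; rewrite lt0n; apply/eqP => c0; apply: (center_not_nc qs).
have [k kE lk] := orb_factor d (pull_neq0 p f0); rewrite c0 in lk.
exists k, (axis (atinf d)), (axis (~~ atinf d)), (mult (pull p f)), 0%N.
split; [|exact: coordinate_axis|by rewrite /= kE expr0 mulr1 mulrC].
by rewrite -(ori_unit (atinf d)) germ_unitE; apply/lexlow00.
Qed.

(** The component of F_pi, other than [Exc p], that meets [Exc p] over the direction
    [d]; it exists under the condition [hasdiv p d]. *)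
Definition ddiv p d : divisor R :=
  if ax (~~ atinf d) (pt p d (ydepth s p d)) is Some a then Exc a
  else Str (d :: p) (xget set0 [set J | component f s (Str (d :: p) J)]%classic).

Definition hasdiv p d : Prop := olda p d <> None \/ (0 < dord d (pull p f))%N.

(** A free direction carries a component only if its point is blown up or lies on the strict
    transform, and either requires a zero of the leading form of f there. *)
Lemma adjacentP p D : p \in s ->
  adjacent f s p D <-> exists2 d, hasdiv p d & D = ddiv p d.
Proof.
move=> ps; split=> [[cD nD [q [yq /exc_through[o oE] tD]]]|[d hd ->]].
  have [_ [d qE odE]] := ax_on_Y bs yq oE; exists d.
    case E: (olda p d) => [a|]; first by left; rewrite E.
    right; case E': (ydepth s p d) => [|m]; last by apply: blown_up_dord => //; rewrite -[_ :: _]/(pt p d 0) ydepthP // E'.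
    case: D cD nD tD => [p2 cD nD /exc_through[o' oE']|q' J cD _ qE'].
      case: nD; have oo : o' = o.
        case: (o' =P o) => // no; have oN : o' = ~~ atinf d by move: no; rewrite odE; case: (o') (atinf d) => -[].
        by move: oE'; rewrite qE E' oN ax_opt0 E.
      by move: oE'; rewrite oo oE => -[->].
    have [|_ _ yq' [w [i [y [wu ty fE]]]]] := free_point (p := p) (d := d) ps.
      by rewrite E' ax_opt0.
    have := free_point_str J yq' E wu ty fE; rewrite -[d :: p]/(pt p d 0) -E' -qE qE'.
    by case=> /(_ cD)[].
  case: D cD nD tD => [p2 cD nD /exc_through[o' oE']|q' J cD _ qE'].
    suff -> : ddiv p d = Exc p2 by [].
    rewrite /ddiv -qE; have oN : o' = ~~ atinf d.
      apply/eqP; rewrite -odE; case: (o' =P o) => [oo|].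
        by case: nD; move: oE'; rewrite oo oE => -[->].
      by case: (o') (o) => -[].
    by rewrite -oN oE'.
  have {}qE' : q = q' := qE'; subst q'; rewrite /ddiv -qE.
  case E: (ax (~~ atinf d) q) => [a|].
    exfalso; move: oE E; rewrite -odE; case: (o) => /= oE E.
      exact: (double_point_no_str E oE cD).
    exact: (double_point_no_str oE E cD).
  have [|m0 od yq' [w [i [y [wu ty fE]]]]] := free_point (p := p) (d := d) ps.
    by rewrite -qE.
  have qE0 : q = d :: p by rewrite qE m0.
  rewrite -qE0; congr Str; case: xgetP => [J' _ cJ'|/(_ J)/(_ cD)//].
  have H K := free_point_str K yq' od wu ty fE.
  have [_ ->] := (H J).1 (eq_ind q (fun q => component f s (Str q J)) cD _ qE0).
  by have [_ ->] := (H J').1 (eq_ind q (fun q => component f s (Str q J')) cJ' _ qE0).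
have yq := on_Y_pt bs d ps; rewrite /ddiv.
case E: (ax _ _) => [a|].
  split; first by apply: (ax_mem bs _ E); left.
    by case=> e; apply: (ax_other (ax_pt p d _) E).
  by exists (pt p d (ydepth s p d)); split=> //; apply/exc_through; eexists;
    [apply: ax_pt|apply: E].
have [m0 od yq' [w [i [y [wu ty fE]]]]] := free_point ps E.
have H K := free_point_str K yq' od wu ty fE.
have c0 : (0 < dord d (pull p f))%N by case: hd; rewrite ?od.
have cs : component f s (Str (d :: p) (xget set0 [set J | component f s (Str (d :: p) J)]%classic)).
  by apply: (@xgetPex _ set0 [set J | component f s (Str (d :: p) J)]%classic);
    exists (principal y); apply/H.
split=> //; exists (d :: p); split=> //.
by apply/exc_through; exists (atinf d); apply: (ax_pt p d 0).
Qed.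

(** Older divisors have shorter centers than p and are told apart by the axis; the center of a
    younger one records the direction. *)
Lemma ddiv_inj p d d' : ddiv p d = ddiv p d' -> d = d'.
Proof.
have old e a : ax (~~ atinf e) (pt p e 0) = Some a -> (size a < size p)%N.
  by rewrite ax_opt0 => /ax_olda/ax_size.
rewrite /ddiv; case E: (ax _ _) => [a|]; case E': (ax _ _) => [a'|] //; last by case.
case=> aE; subst a'.
case m: (ydepth s p d) E => [|m1] E; case m': (ydepth s p d') E' => [|m2] E'.
- rewrite !ax_opt0 in E E'; have dE := olda_dir E; have dE' := olda_dir E'.
  move: E E' => /ax_olda E /ax_olda E'.
  suff dd : atinf d = atinf d' by rewrite dE dE' dd.
  move: E E'; case: (atinf d); case: (atinf d') => //= E E'.
    by case: (ax_neq E E').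
  by case: (ax_neq E' E).
- move: E'; rewrite ax_optS => -[aE]; have := old _ _ E; rewrite -aE size_pt; lia.
- move: E; rewrite ax_optS => -[aE]; have := old _ _ E'; rewrite -aE size_pt; lia.
- by move: E E'; rewrite !ax_optS => -[<-] [] /pt_inj[].
Qed.

(** [g] is monomial in the local equations of [Exc p] and of the adjacent component over
    the direction [d]. *)
Definition clean p d g : Prop :=
  if ax (~~ atinf d) (pt p d (ydepth s p d)) is Some _
  then exists i j, mono (pull (pt p d (ydepth s p d)) g) i j
  else exists w i y a, [/\ w \is a GRing.unit, transversal (ori (atinf d) y),
    component f s (Str (d :: p) (principal y)) & pull (d :: p) g = w * axis (atinf d) ^+ i * y ^+ a].

Lemma ddiv_str p d y : p \in s -> ax (~~ atinf d) (pt p d (ydepth s p d)) = None ->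
  component f s (Str (d :: p) (principal y)) -> ddiv p d = Str (d :: p) (principal y).
Proof.
move=> ps E cy; rewrite /ddiv E; congr Str.
have [m0 od yq' [w [i [z [wu ty fE]]]]] := free_point ps E.
have H K := free_point_str K yq' od wu ty fE.
case: xgetP => [J' _ cJ'|/(_ (principal y))/(_ cy)//].
by have [_ ->] := (H J').1 cJ'; have [_ ->] := (H _).1 cy.
Qed.

Lemma vord_ddiv p d g : p \in s -> g != 0 -> clean p d g ->
  vord (ddiv p d) g = (dord d (pull p g) + ydepth s p d * mult (pull p g))%N.
Proof.
move=> ps g0; rewrite /clean; case E: (ax _ _) => [a|].
  by case=> i [j mg]; rewrite /ddiv E; apply: mono_vord_pt mg E.
case=> w [i [y [a [wu ty cy gE]]]].
rewrite (ddiv_str ps E cy); have [m0 _ _ _] := free_point ps E.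
rewrite m0 mul0n addn0 /vord [base _]/= [local_ideal _]/= gE mulrC ideal_orderE.
- have l : lexlow (ori (atinf d) (pull (pt p d 0) g)) i a.
    rewrite [pull _ _]gE !rmorphM !rmorphXn /= ori_axis.
    have lw := lexlow_unit (atinf d) wu.
    have := lexlowM (lexlowM lw (lexlow_uv R i 0)) (lexlowX a ty).
    by rewrite expr0 mulr1 !add0n muln0 muln1 addn0.
  by have [_] := lexlow_uniq l (lexlow_pt p d 0 g0); rewrite mul0n addn0.
- exact: transversal_neq0 ty.
- move=> /(@divides_ori _ (atinf d)); rewrite rmorphM rmorphXn /= ori_axis.
  by apply: transversal_ndvd => //; rewrite ori_unit.
Qed.

Lemma knum_ddiv p d : p \in s -> hasdiv p d ->
  knum (ddiv p d) = (kdir p d + ydepth s p d * knum (Exc p))%N.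
Proof.
move=> ps hd; case E: (ax (~~ atinf d) (pt p d (ydepth s p d))) => [a|].
  by rewrite /ddiv E; apply: knum_opt E.
have [m0 od yq' [w [i [y [wu ty fE]]]]] := free_point ps E.
have c0 : (0 < dord d (pull p f))%N by case: hd; rewrite ?od.
have cy : component f s (Str (d :: p) (principal y)) by apply/(free_point_str _ yq' od wu ty fE).
rewrite (ddiv_str ps E cy) m0 mul0n addn0 (kdir_none od) /knum [base _]/= [local_ideal _]/=.
congr S.
have [w' wu' ->] := jac_mono (d :: p).
have k1 : kcomp (~~ atinf d) (d :: p) = 1%N.
  by have [_] := kcomp_pt p d 0; rewrite mul0n addn0 (kdir_none od).
have y0 := transversal_neq0 ty.
have [j jE] : exists j, w' * coord_u R ^+ (kax (d :: p)).1.-1 * coord_v R ^+ (kax (d :: p)).2.-1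
    = w' * axis (atinf d) ^+ j.
  move: k1; rewrite /kcomp; case: (atinf d) => /= ->; rewrite expr0 mulr1; eexists; reflexivity.
rewrite jE -[w' * _]mul1r -[1 in LHS](expr0 y) ideal_orderE //.
move=> /(@divides_ori _ (atinf d)); rewrite rmorphM rmorphXn /= ori_axis.
by apply: transversal_ndvd => //; rewrite ori_unit.
Qed.

Lemma clean_self p d : p \in s -> hasdiv p d -> clean p d f.
Proof.
move=> ps hd; have yq := on_Y_pt bs d ps; rewrite /clean; case E: (ax _ _) => [a|].
  have aE := ax_pt p d (ydepth s p d).
  move: aE E; case: (atinf d) => aE E; [exact: double_point yq E aE|exact: double_point yq aE E].
have [m0 od yq' [w [i [y [wu ty fE]]]]] := free_point ps E.
have c0 : (0 < dord d (pull p f))%N by case: hd; rewrite ?od.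
by exists w, i, y, (dord d (pull p f)); split=> //; apply/(free_point_str _ yq' od wu ty fE).
Qed.

Lemma sigmaE p g : g != 0 ->
  sigma f p g = - ((knum (Exc p) + mult (pull p g))%:R / (mult (pull p f))%:R).
Proof. by move=> g0; rewrite /sigma !vord_exc. Qed.

(** The [ydepth] further blow-ups add a multiple of N sigma + k + v, which is 0. So only the leading
    forms at p matter. *)
Lemma residue_ddiv p d g : p \in s -> g != 0 -> hasdiv p d -> clean p d g ->
  residue f p g (Some (ddiv p d)) =
    (dord d (pull p f))%:R * sigma f p g + (kdir p d)%:R + (dord d (pull p g))%:R.
Proof.
move=> ps g0 hd cg; rewrite /residue knum_ddiv // !vord_ddiv //; last exact: clean_self.
rewrite sigmaE // !natrD !natrM.
have N0 : (mult (pull p f))%:R != 0 :> rat by rewrite pnatr_eq0 -lt0n mult_pull_gt0.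
by field.
Qed.

End AdjacentDivisors.

(** * Toric data and values of germs *)

Section ToricData.
Variable R : realType.
Local Notation germ := (germ R).
Local Notation infpoint := (infpoint R).
Implicit Types (g h x y G H : germ) (d : direction R) (o : bool) (p q : infpoint).

Local Notation u := (coord_u R).
Local Notation v := (coord_v R).

(** Toric data of a point [p]. Let E_b be the exceptional divisor on which the last free
    point Q preceding or equal to [p] lies. In suitable coordinates at Q, with E_b and a
    curvette of E_b as axes, the two axes at [p] are the toric divisors of weights
    [(ta1, tb1)] and [(ta2, tb2)]; the first of them, on the side of E_b, is
    [axis tor]. The values at E_b of a curvette of E_b and of k are [tn] and [tk], and
    [tG] is the semigroup of values of the valuation of E_b. If [p] is free, then its
    second axis is virtual; if [p = [::]], both are. *)
Record tdata := TData { tor : bool; tn : nat; tk : nat; tG : nat -> Prop;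
  ta1 : nat; tb1 : nat; ta2 : nat; tb2 : nat }.

(** Let x and y be the equations at Q of E_b and of the strict transform of its curvette. Then [tal]
    and [tP] are the orders along [Exc p] of x and of that curvette. A curvette of [Exc p] looks
    like y^tal - x^tbe at Q; [nval] is its order along [Exc p], and [xplus] and [xminus] are its
    orders along the two axes at p. [kval] is k of [Exc p], and [gval] its semigroup of values. *)
Definition tal D := (ta1 D + ta2 D)%N.
Definition tbe D := (tb1 D + tb2 D)%N.
Definition tP D := (tal D * tn D + tbe D)%N.
Definition nval D := (tal D * tP D)%N.
Definition kval D := (tal D * tk D + tbe D)%N.
Definition gval D (z : nat) : Prop := exists w T, tG D w /\ z = (tal D * w + tP D * T)%N.
Definition xplus D := (tal D * (ta1 D * tn D + tb1 D))%N.
Definition xminus D := (ta2 D * tP D)%N.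
(** The exponents of the two axes in the monomial of value [w] at E_b and of order [T]
    along the curvette. *)
Definition tm1 D w T := (ta1 D * (w + tn D * T) + tb1 D * T)%N.
Definition tm2 D w T := (ta2 D * (w + tn D * T) + tb2 D * T)%N.

(** The tangent direction of [axis o]. *)
Definition adir o : direction R := if o then Some 0 else None.

(** At a satellite point one weight vector is replaced by the sum of both, as in the Stern-Brocot
    tree; at a free point everything restarts with [Exc q] as E_b. *)
Fixpoint tdat p : tdata :=
  if p is d :: q then
    let D := tdat q in
    if olda q d is Some _ then
      if d == adir (tor D) then
        TData (tor D) (tn D) (tk D) (tG D) (ta1 D) (tb1 D) (tal D) (tbe D)
      else TData (tor D) (tn D) (tk D) (tG D) (tal D) (tbe D) (ta2 D) (tb2 D)
    else TData (atinf d) (nval D) (kval D) (gval D) 1 0 0 1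
  else TData false 0 1 (fun=> True) 1 0 0 1.

Lemma adir_neq o : adir o != adir (~~ o). Proof. by case: o. Qed.
Lemma atinf_adir o : atinf (adir o) = ~~ o. Proof. by case: o. Qed.
Lemma olda_adir q o : olda q (adir o) = ax o q.
Proof. by case: o => //=; rewrite eqxx. Qed.
Lemma olda_some q d a : olda q d = Some a -> exists2 o, d = adir o & ax o q = Some a.
Proof.
move=> E; exists (~~ atinf d); last exact: ax_olda.
by rewrite [LHS](olda_dir E); case: (atinf d).
Qed.
Lemma olda_free q d o : olda q d = None -> ax o q <> None -> d != adir o.
Proof. by move=> E nz; apply: contra_notN nz => /eqP dE; rewrite -olda_adir -dE. Qed.
Lemma ax_cons_adir q o : ax o (adir o :: q) = ax o q /\ ax (~~ o) (adir o :: q) = Some q.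
Proof. by case: o => //=; rewrite eqxx. Qed.
Lemma ax_cons_free q d : olda q d = None ->
  ax (atinf d) (d :: q) = Some q /\ ax (~~ atinf d) (d :: q) = None.
Proof. by case: d => [c|] /=. Qed.

Lemma tdat_sat q d a : olda q d = Some a -> let D := tdat q in
  (d = adir (tor D) /\ tdat (d :: q) =
     TData (tor D) (tn D) (tk D) (tG D) (ta1 D) (tb1 D) (tal D) (tbe D)) \/
  (d = adir (~~ tor D) /\ tdat (d :: q) =
     TData (tor D) (tn D) (tk D) (tG D) (tal D) (tbe D) (ta2 D) (tb2 D)).
Proof.
move=> E /=; rewrite E; have [o -> _] := olda_some E.
case: eqP => [|ne]; first by left.
by right; split=> //; move: ne; case: o (tor _) => -[].
Qed.

Lemma tdat_free q d : olda q d = None -> let D := tdat q in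
  tdat (d :: q) = TData (atinf d) (nval D) (kval D) (gval D) 1 0 0 1.
Proof. by move=> /= ->. Qed.

Lemma tdat_det p : (ta1 (tdat p) * tb2 (tdat p) = ta2 (tdat p) * tb1 (tdat p) + 1)%N.
Proof.
elim: p => [|d q IH] //; case E: (olda q d) => [a|]; last by rewrite (tdat_free E).
by case: (tdat_sat E) => -[_ ->] /=; rewrite /tal /tbe; nia.
Qed.

Lemma tdat_ax p : let o := tor (tdat p) in
  (ax o p = None -> p = [::]) /\
  (ax (~~ o) p = None -> [/\ ta1 (tdat p) = 1, tb1 (tdat p) = 0, ta2 (tdat p) = 0 & tb2 (tdat p) = 1]%N).
Proof.
elim: p => [|d q [IH1 IH2]] //.
case E: (olda q d) => [a|]; last first.
  by rewrite (tdat_free E) /=; have [-> _] := ax_cons_free E.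
have [o dE aE] := olda_some E.
case: (tdat_sat E) => -[dE' ->] /=; have := ax_cons_adir q o; rewrite -dE aE.
  have -> : o = tor (tdat q) by move: dE; rewrite dE'; case: o (tor _) {aE} => -[].
  by case=> -> ->.
have -> : o = ~~ tor (tdat q) by move: dE; rewrite dE'; case: o (tor _) {aE} => -[].
by rewrite negbK => -[-> ->].
Qed.

Lemma tdat_k p : let D := tdat p in
  kcomp (tor D) p = (ta1 D * tk D + tb1 D)%N /\ kcomp (~~ tor D) p = (ta2 D * tk D + tb2 D)%N.
Proof.
elim: p => [|d q [IH1 IH2]] //.
have kq : ((kax q).1 + (kax q).2 = kval (tdat q))%N.
  by move: IH1 IH2; rewrite /kval /tal /tbe /kcomp; case: (tor _) => /= -> ->; lia.
case E: (olda q d) => [a|]; last first.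
  have [h1 h2] := kcomp_pt q d 0.
  rewrite (tdat_free E) /= -[d :: q]/(pt q d 0) h1 h2 knum_exc kdir_none // kq; lia.
case: (tdat_sat E) => -[-> ->] /=; move: IH1 IH2; rewrite /kcomp /adir /tal /tbe;
  case: (tor _) => /=; rewrite ?eqxx /=; lia.
Qed.

Lemma tdat_gt0 p : (0 < tal (tdat p))%N /\ (0 < tP (tdat p))%N.
Proof.
have := tdat_det p; rewrite /tP /tal /tbe.
by case: (ta1 _) => [|a]; case: (tb2 _) => [|b]; lia.
Qed.

Lemma tdat_kn p : (tk (tdat p) <= (tn (tdat p)).+1)%N.
Proof.
elim: p => [|d q IH] //; case E: (olda q d) => [a|]; first by case: (tdat_sat E) => -[_ ->].
rewrite (tdat_free E) /=; set D := tdat q in IH *; have det := tdat_det q; rewrite -/D in det.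
have [al0 P0] := tdat_gt0 q; rewrite -/D in al0 P0.
have : (kval D <= tP D + tal D)%N by rewrite /kval /tP; nia.
by rewrite /nval; nia.
Qed.

(** The conductor bound passes from E_b to [Exc q]: [ta1] inverts [tP] modulo [tal], so z is
    congruent to [tP] times some T < tal, and what remains of z is large enough for the bound at
    E_b. *)
Lemma tdat_semigroup p : let D := tdat p in
  [/\ tG D 0%N, forall w w', tG D w -> tG D w' -> tG D (w + w')%N &
      forall w, (tn D < w + tk D)%N -> tG D w].
Proof.
elim: p => [|d q] //; case E: (olda q d) => [a|]; first by case: (tdat_sat E) => -[_ ->].
rewrite (tdat_free E) /=; set D := tdat q => -[G0 GD Gc]; split.
- by exists 0%N, 0%N; rewrite !muln0.
- move=> z z' [w [T [Gw ->]]] [w' [T' [Gw' ->]]]; exists (w + w')%N, (T + T')%N.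
  by split; [apply: GD|lia].
- move=> z; rewrite /nval /kval => zlt.
  have det := tdat_det q; have kn := tdat_kn q; rewrite -/D in det kn.
  have [al0 P0] := tdat_gt0 q; rewrite -/D in al0 P0.
  pose T := ((ta1 D * z) %% tal D)%N.
  have Tlt : (T < tal D)%N by rewrite ltn_mod.
  have e1 : (tP D * ta1 D = tal D * (tn D * ta1 D + tb1 D) + 1)%N.
    by rewrite /tP /tal /tbe; nia.
  have Ez : (tP D * T = z %[mod tal D])%N.
    by rewrite /T modnMmr mulnA e1 mulnDl mul1n -mulnA [(tal D * _)%N]mulnC modnMDl.
  have PE : tP D = (tal D * tn D + tbe D)%N by [].
  have PT : (tP D * T + tP D <= tP D * tal D)%N by rewrite -mulnSr leq_mul2l Tlt orbT.
  have [le|lt] := leqP (tP D * T) z.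
    have /dvdnP[w wE] : (tal D %| z - tP D * T)%N by rewrite -eqn_mod_dvd //; apply/eqP.
    exists w, T; split; last by lia.
    apply: Gc; rewrite -(ltn_pmul2l al0) mulnDr.
    by have := PE; have := PT; lia.
  have /dvdnP[r rE] : (tal D %| tP D * T - z)%N by rewrite -eqn_mod_dvd ?(ltnW lt) //; apply/eqP.
  have r0 : (0 < r)%N by rewrite lt0n; apply: contraTneq lt => r0; move: rE; rewrite r0; lia.
  have := leq_mul (leqnn (tal D)) kn; have := leq_mul (leqnn (tal D)) r0.
  by have := PE; have := PT; lia.
Qed.

Lemma toric_nval D : (ta1 D * tb2 D = ta2 D * tb1 D + 1)%N -> nval D = (xplus D + xminus D + 1)%N.
Proof. by rewrite /nval /xplus /xminus /tP /tal /tbe; nia. Qed.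

Lemma nvalE p : nval (tdat p) = (xplus (tdat p) + xminus (tdat p) + 1)%N.
Proof. exact/toric_nval/tdat_det. Qed.

(** No strict transform passes through q: the germ is a unit times equations of exceptional
    divisors, and a virtual axis has exponent 0. *)
Definition excmono q G : Prop := exists i j, [/\ mono G i j,
  (axes q).1 = None -> i = 0%N & (axes q).2 = None -> j = 0%N].

Lemma excmonoM q G H : excmono q G -> excmono q H -> excmono q (G * H).
Proof.
move=> [i [j [m z1 z2]]] [i' [j' [m' z1' z2']]]; exists (i + i')%N, (j + j')%N.
by split; [apply: monoM|move=> /[dup]/z1 -> /z1' ->|move=> /[dup]/z2 -> /z2' ->].
Qed.

Lemma excmono_unit q G : G \is a GRing.unit -> excmono q G.
Proof. by move=> Gu; exists 0%N, 0%N; split=> //; apply: mono_unit. Qed.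

Lemma excmono_axis q o n : (ax o q = None -> n = 0%N) -> excmono q (axis o ^+ n).
Proof.
move=> z; have := monoX n (mono_axis R o); case: o z => z m; do 2!eexists;
  split; (try exact: m) => //=; by rewrite ?muln0 // muln1.
Qed.

Lemma excmono_blow q d G : excmono q G -> excmono (d :: q) (blow d G).
Proof.
move=> [i [j [m z1 z2]]]; case: d => [c|].
  exists (i + j)%N, (if c == 0 then j else 0%N); split=> //; first exact: mono_blow_fin.
  by rewrite /=; case: eqP.
by exists i, (i + j)%N; split=> //; apply: mono_blow_inf.
Qed.

Lemma excmono_pull l q G : excmono q (pull q G) -> excmono (l ++ q) (pull (l ++ q) G).
Proof. by elim: l => //= d l IH /IH; apply: excmono_blow. Qed.

Lemma blow_axis_adir o : blow (adir o) (axis o) = axis o * axis (atinf (adir o)).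
Proof.
case: o => /=; last exact: blow_inf_u.
by rewrite blow_fin_v mulrC (_ : germC 0 = 0) ?addr0 //; apply: germ_eq => m n; rewrite /= if_same.
Qed.

Lemma blow_axis_free o d : d != adir o -> exists2 w, w \is a GRing.unit &
  blow d (axis o) = w * axis (atinf d).
Proof.
case: o d => -[c|] //= nd.
- exists (v + germC c); last by rewrite blow_fin_v mulrC.
  rewrite germ_unitE germD /= /monom /= add0r.
  by apply: contraNneq nd => ->.
- by exists 1; rewrite ?unitr1 // mul1r blow_inf_v.
- by exists 1; rewrite ?unitr1 // mul1r blow_fin_u.
Qed.

Lemma ori_blow_adir o G : ori o (blow (adir o) G) = blow None (ori o G).
Proof. by case: o => //=; rewrite blow_infE trK. Qed.
Lemma ori_blow_adirN o G : ori o (blow (adir (~~ o)) G) = blow (Some 0) (ori o G).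
Proof. by case: o => //=; rewrite blow_infE trK. Qed.

Lemma excmono_incomparable q d m H (M h : germ) : pull q H = M * h -> excmono q M ->
    (forall d', d' != d -> exists2 w, w \is a GRing.unit & blow d' h = w * axis (atinf d') ^+ m) ->
    (forall q2, ~~ suffix q q2 -> ~~ suffix q2 q -> excmono q2 (pull q2 H)) ->
  forall q2, ~~ suffix (d :: q) q2 -> ~~ suffix q2 (d :: q) -> excmono q2 (pull q2 H).
Proof.
move=> HE eM dh IH q2 n1 n2; case: (boolP (suffix q q2)) => [/suffixP[l q2E]|nq]; last first.
  apply: IH => //; apply: contraNN n2 => /suffixP[l ->].
  by apply/suffixP; exists (d :: l).
case/lastP: l q2E => [|l d'] q2E.
  by case/negP: n2; apply/suffixP; exists [:: d]; rewrite q2E.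
have nd : d' != d.
  by apply: contraNneq n1 => <-; rewrite q2E cat_rcons; apply/suffixP; exists l.
rewrite q2E cat_rcons; apply: excmono_pull; rewrite /= HE rmorphM /=.
apply: excmonoM; first exact: excmono_blow.
have [w wu ->] := dh _ nd; apply: excmonoM; first exact: excmono_unit.
by apply: excmono_axis; rewrite (ax_pt q d' 0).
Qed.

(** The exponents of the two axes in the pull-back of the germ to which a curve descends
    whose intersection numbers with the axes are [t o]. *)
Definition ttau D (t : bool -> nat) := (ta1 D * t (tor D) + ta2 D * t (~~ tor D))%N.
Definition te1 D t := (ttau D t * (ta1 D * tn D + tb1 D))%N.
Definition te2 D t := (ta2 D * (ttau D t * tn D + tb1 D * t (tor D) + tb2 D * t (~~ tor D)))%N.

(** Induction on q by [blow_down]. The divisibility clause later identifies the result with any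
    given curvette. *)
Lemma descent q h (t : bool -> nat) : h != 0 ->
    (forall o, ax o q <> None -> lexlow (ori o h) 0 (t o)) ->
  exists2 H, H != 0 & exists M,
  [/\ exists2 w, w \is a GRing.unit & M = w * axis (tor (tdat q)) ^+ te1 (tdat q) t
                                             * axis (~~ tor (tdat q)) ^+ te2 (tdat q) t,
      excmono q M, pull q H = M * h,
      (forall G, divides h (pull q G) -> divides H G) &
      forall q2, ~~ suffix q q2 -> ~~ suffix q2 q -> excmono q2 (pull q2 H)].
Proof.
elim: q h t => [|d q IH] h t h0 lh.
  exists h => //; exists 1; split=> //.
  - exists 1; rewrite ?unitr1 // /te1 /te2 /= !(muln0, mul0n) !expr0 !mulr1 //.
  - by apply: excmono_unit; rewrite unitr1.
  - by rewrite mul1r.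
  - by move=> q2; rewrite suffix0s.
set m := t (atinf d).
have lm : lexlow (ori (atinf d) h) 0 m by apply: lh; rewrite (ax_pt q d 0).
have [h' h'0 [[w1 w1u bh] mh bd dv]] := blow_down lm.
(* Noether's formula: an axis has multiplicity 1, so its intersection number with h' is m, plus that
   of the strict transforms if its direction is d. *)
pose t' o := if d == adir o then (m + t o)%N else m.
have lh' o : ax o q <> None -> lexlow (ori o h') 0 (t' o).
  move=> aq; apply/lexlow0_blow_inf; rewrite -ori_blow_adir /t'.
  have lw (w : germ) : w \is a GRing.unit -> lexlow (ori o w) 0 0.
    by move=> wu; apply/lexlow00; rewrite -germ_unitE ori_unit.
  have lX : lexlow (ori o (axis (~~ o) : germ) ^+ m) 0 m.
    by rewrite ori_axisN; have := lexlow_uv R 0 m; rewrite expr0 mul1r.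
  case: (eqVneq d (adir o)) => [dE|]; last first.
    rewrite eq_sym => /bd[w wu ->].
    by rewrite atinf_adir rmorphM rmorphXn; have := lexlowM (lw _ wu) lX; rewrite !add0n.
  rewrite -{1}dE bh {1}dE atinf_adir !rmorphM rmorphXn.
  have lo : lexlow (ori o h) 0 (t o) by apply: lh; rewrite dE; have [-> _] := ax_cons_adir q o.
  by have := lexlowM (lexlowM (lw _ w1u) lX) lo; rewrite !add0n.
have [H H0 [M [[w wu ME] eM pM dM iM]]] := IH h' t' h'0 lh'.
exists H => //; exists (blow d M * (w1 * axis (atinf d) ^+ m)).
split; last exact: (excmono_incomparable pM eM bd iM).
- have det := tdat_det q; have [a1E a2E] := tdat_ax q.
  rewrite {}ME {eM pM dM iM IH}; move: (tdat_sat (q := q) (d := d)) (tdat_free (q := q) (d := d)) => sat free.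
  set D := tdat q in det a1E a2E sat free *; set o := tor D in a1E a2E sat free *.
  rewrite !blowM !blowX; case E: (olda q d) => [a|]; last first.
    rewrite (free E) /te1 /te2 /ttau /= -/m.
    have [w2 w2u e2] : exists2 w2, w2 \is a GRing.unit &
        blow d (axis o) ^+ te1 D t' * blow d (axis (~~ o)) ^+ te2 D t' =
        w2 * axis (atinf d) ^+ (te1 D t' + te2 D t').
      have ex b k : (ax b q = None -> k = 0%N) -> exists2 w2, w2 \is a GRing.unit &
          blow d (axis b) ^+ k = w2 * axis (atinf d) ^+ k.
        case Eb: (ax b q) => [a'|] z; last first.
          by exists 1; rewrite ?unitr1 // (z erefl) !expr0 mulr1.
        have [|w2 w2u ->] := @blow_axis_free b d; first by apply: (olda_free E); rewrite Eb.
        by exists (w2 ^+ k); rewrite ?unitrX // exprMn.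
      have [|w2 w2u ->] := ex o (te1 D t').
        by move=> /a1E q0; rewrite /te1 /D q0 /=; lia.
      have [|w3 w3u ->] := ex (~~ o) (te2 D t').
        by move=> /a2E[_ _ z _]; rewrite /te2 z.
      by exists (w2 * w3); rewrite ?unitrM ?w2u // exprD; ring.
    exists (blow d w * w2 * w1); first by rewrite !unitrM w1u w2u blow_unit.
    rewrite mul0n expr0 mulr1.
    transitivity (blow d w * (blow d (axis o) ^+ te1 D t' * blow d (axis (~~ o)) ^+ te2 D t')
      * (w1 * axis (atinf d) ^+ m)); first by rewrite -/o; ring.
    rewrite e2; transitivity (blow d w * w2 * w1 * axis (atinf d) ^+ (te1 D t' + te2 D t' + m)).
      by rewrite !exprD; ring.
    congr (_ * _ ^+ _).
    have tm b : ax b q <> None -> t' b = m.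
      by move=> /(olda_free E)/negPf; rewrite /t' => ->.
    case Eo: (ax o q) => [a'|]; last first.
      have q0 := a1E Eo; rewrite /te1 /te2 /ttau /nval /tP /tal /tbe /D q0 /=; lia.
    have t1 := tm o; rewrite Eo in t1.
    case Eo': (ax (~~ o) q) => [a''|].
      have t2 := tm (~~ o); rewrite Eo' in t2.
      by rewrite /te1 /te2 /ttau -/o t1 // t2 // /nval /tP /tal /tbe; nia.
    have [z1 z2 z3 z4] := a2E Eo'.
    by rewrite /te1 /te2 /ttau -/o t1 // /nval /tP /tal /tbe z1 z2 z3 z4; lia.
  have [] := sat _ E => -[dE ->]; rewrite /te1 /te2 /ttau /= -/o -/te1 -/te2.
    have [|w2 w2u e2] := @blow_axis_free (~~ o) d; first by rewrite dE adir_neq.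
    have e1 : blow d (axis o) = axis o * axis (~~ o) by rewrite dE blow_axis_adir atinf_adir.
    have t1 : t' o = (t (~~ o) + t o)%N by rewrite /t' /m dE eqxx atinf_adir.
    have t2 : t' (~~ o) = t (~~ o) by rewrite /t' /m dE (negPf (adir_neq o)) atinf_adir.
    exists (blow d w * w2 ^+ te2 D t' * w1); first by rewrite !unitrM w1u unitrX // blow_unit.
    rewrite e1 e2 /m dE atinf_adir !exprMn.
    transitivity (blow (adir o) w * w2 ^+ te2 D t' * w1 * axis o ^+ te1 D t' *
      axis (~~ o) ^+ (te1 D t' + te2 D t' + t (~~ o))); first by rewrite !exprD; ring.
    by congr (_ * _ ^+ _ * _ ^+ _); rewrite /te1 /te2 /ttau -/o t1 t2 /tal /tbe; nia.
  have [|w2 w2u e2] := @blow_axis_free o d; first by rewrite dE eq_sym adir_neq.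
  have e1 : blow d (axis (~~ o)) = axis (~~ o) * axis o by rewrite dE blow_axis_adir atinf_adir negbK.
  have t1 : t' (~~ o) = (t o + t (~~ o))%N by rewrite /t' /m dE eqxx atinf_adir negbK.
  have t2 : t' o = t o by rewrite /t' /m dE eq_sym (negPf (adir_neq o)) atinf_adir negbK.
  exists (blow d w * w2 ^+ te1 D t' * w1); first by rewrite !unitrM w1u unitrX // blow_unit.
  rewrite e1 e2 /m dE atinf_adir negbK !exprMn.
  transitivity (blow (adir (~~ o)) w * w2 ^+ te1 D t' * w1 *
    axis o ^+ (te1 D t' + te2 D t' + t o) * axis (~~ o) ^+ te2 D t'); first by rewrite !exprD; ring.
  by congr (_ * _ ^+ _ * _ ^+ _); rewrite /te1 /te2 /ttau -/o t1 t2 /tal /tbe; nia.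
- apply: excmonoM; first exact: excmono_blow.
  apply: excmonoM; first exact: excmono_unit.
  by apply: excmono_axis; rewrite (ax_pt q d 0).
- by rewrite /= pM rmorphM /= bh; ring.
- by move=> G /dv/dM.
Qed.

(** In a free direction h is smooth and transversal to the exceptional axes at p, so all
    intersection numbers in [descent] are 1. *)
Lemma curvette_germ p d y : olda p d = None -> transversal (ori (atinf d) y) ->
  exists2 H, H != 0 & exists M h,
  [/\ exists2 w, w \is a GRing.unit & M = w * axis (tor (tdat p)) ^+ xplus (tdat p)
                                           * axis (~~ tor (tdat p)) ^+ xminus (tdat p),
      excmono p M, pull p H = M * h & mult h = 1%N] /\
  [/\ exists2 w, w \is a GRing.unit & blow d h = w * axis (atinf d) * y,
      (forall d', d' != d -> exists2 w, w \is a GRing.unit & blow d' h = w * axis (atinf d')),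
      (forall G, divides y (pull (d :: p) G) -> divides H G) &
      forall q2, ~~ suffix (d :: p) q2 -> ~~ suffix q2 (d :: p) -> excmono q2 (pull q2 H)].
Proof.
move=> E ty; have [h h0 [[w wu bh] mh bd dv]] := blow_down ty.
have lh o : ax o p <> None -> lexlow (ori o h) 0 1.
  move=> aq; apply/lexlow0_blow_inf; rewrite -ori_blow_adir.
  have [|w' w'u ->] := bd (adir o); first by rewrite eq_sym; apply: (olda_free E).
  rewrite atinf_adir rmorphM rmorphXn /= ori_axisN.
  have lw := lexlow_unit o w'u.
  by have := lexlowM lw (lexlow_v R); rewrite !add0n.
have [H H0 [M [ME eM pM dM iM]]] := descent (t := fun=> 1%N) h0 lh.
exists H => //; exists M, h; split; split=> //.
- case: ME => w' w'u ->; exists w' => //.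
  by congr (_ * _ ^+ _ * _ ^+ _); rewrite /te1 /te2 /ttau /xplus /xminus /tP /tal /tbe !muln1; lia.
- by exists w.
- by move=> G /dv/dM.
- exact: excmono_incomparable pM eM bd iM.
Qed.

Lemma ext_plus o G : G != 0 -> [/\ (dord (adir o) G <= mult G)%N,
  (ori o G) (dord (adir o) G) (mult G - dord (adir o) G)%N != 0 &
  (ori o G) (mult G - dord (adir (~~ o)) G)%N (dord (adir (~~ o)) G) != 0].
Proof.
move=> G0; have [l1 n1] := dord0_coef G0; have [l2 n2] := dord_inf_coef G0.
by case: o; split; [exact: l1|exact: n1|exact: n2|exact: l2|exact: n2|exact: n1].
Qed.

Lemma mult_ori_le o G i j : (ori o G) i j != 0 -> (mult G <= i + j)%N.
Proof. by case: o => nz; [rewrite addnC; exact: (@mult_le _ G j i)|exact: (@mult_le _ G i j)]. Qed.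

(** The monomials of least weight, for any weights, are toric images of monomials
    [(w + n T, T)] at the last free point, with [w] a value of E_b. *)
Definition toric_support p : Prop := forall g (x y i j : nat), g != 0 -> (0 < x)%N -> (0 < y)%N ->
  (ori (tor (tdat p)) (pull p g)) i j != 0 ->
  (forall i' j', (ori (tor (tdat p)) (pull p g)) i' j' != 0 -> (x * i + y * j <= x * i' + y * j')%N) ->
  exists w T, [/\ tG (tdat p) w, i = tm1 (tdat p) w T & j = tm2 (tdat p) w T].

(** From one extreme monomial of the leading form to the other, T drops by [tal] per linear factor
    off the axes and stays nonnegative. So the first T is at least [tal * dord d], and taking out
    this part lowers the value by [nval * dord d]. *)
Lemma value_split q d g : toric_support q -> g != 0 -> olda q d = None ->
  exists2 w, gval (tdat q) w & mult (pull q g) = (w + nval (tdat q) * dord d (pull q g))%N.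
Proof.
move=> ts g0 E; set G := pull q g; have G0 : G != 0 by apply: pull_neq0.
set D := tdat q; set o := tor D.
have [a1E a2E] := tdat_ax q; rewrite -/D -/o in a1E a2E.
have det := tdat_det q; rewrite -/D in det.
have dle := dord_le_mult d G0.
case Eo: (ax o q) => [a|]; last first.
  exists (mult G - dord d G)%N; last by rewrite /D (a1E Eo) /nval /tP /tal /tbe /=; lia.
  exists (mult G - dord d G)%N, 0%N; split; first by rewrite /D (a1E Eo).
  by rewrite /D (a1E Eo) /tal /=; lia.
have no : d != adir o by apply: (olda_free E); rewrite Eo.
have [e1 n1 n2] := ext_plus o G0.
have min i j : (ori o G) i j != 0 -> (i + j = mult G)%N ->
    exists w T, [/\ tG D w, i = tm1 D w T & j = tm2 D w T].
  move=> nz ij; apply: (ts g 1%N 1%N i j) => // i' j' /mult_ori_le.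
  by rewrite -/G -ij; lia.
have [|w [T [Gw iE jE]]] := min _ _ n1; first by lia.
have le2 : (dord (adir (~~ o)) G <= mult G)%N by apply: dord_le_mult.
have [|w' [T' [_ iE' jE']]] := min _ _ n2; first by lia.
have s2 : (dord d G + dord (adir o) G <= mult G)%N.
  by have := @sum_dord_le _ G [:: d; adir o] G0; rewrite /= inE no big_cons big_seq1 => /(_ isT).
have Tt : (tal D * dord d G <= T)%N.
  case Eo': (ax (~~ o) q) => [a'|]; last first.
    have [z1 z2 z3 z4] := a2E Eo'.
    by move: jE; rewrite /tm2 /tal z1 z3 z4; lia.
  have no' : d != adir (~~ o) by apply: (olda_free E); rewrite Eo'.
  have s3 : (dord d G + dord (adir o) G + dord (adir (~~ o)) G <= mult G)%N.
    have := @sum_dord_le _ G [:: d; adir o; adir (~~ o)] G0.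
    rewrite /= !inE negb_or no no' adir_neq !big_cons big_nil => /(_ isT); lia.
  have TE : (T + ta2 D * dord (adir o) G = ta1 D * (mult G - dord (adir o) G))%N.
    by rewrite {1}iE jE /tm1 /tm2; nia.
  have TE' : (T' + ta2 D * (mult G - dord (adir (~~ o)) G) = ta1 D * dord (adir (~~ o)) G)%N.
    by rewrite iE' jE' /tm1 /tm2; nia.
  have := leq_mul (leqnn (tal D)) s3; move: TE TE'.
  rewrite /tal !mulnBr; have := leq_mul (leqnn (ta1 D)) e1; have := leq_mul (leqnn (ta2 D)) le2.
  have := leq_mul (leqnn (ta1 D)) le2; have := leq_mul (leqnn (ta2 D)) e1; lia.
exists (tal D * w + tP D * (T - tal D * dord d G))%N; first by exists w, (T - tal D * dord d G)%N.
have -> : mult G = (tal D * w + tP D * T)%N.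
  by rewrite -(subnKC e1) jE {1}iE /tm1 /tm2 /tP /tal /tbe; lia.
rewrite /nval -[in LHS](subnKC Tt); set X := (T - _)%N; lia.
Qed.

(** A monomial minimal for the weights (x, y) at a satellite point comes from one minimal for (x +
    y, y) or (x, x + y) at the previous point. At a free point the lowest monomial is given by
    [value_split]; any other candidate has a smaller j, and its w then exceeds a value by more than
    [nval], an excess beyond the conductor. *)
Lemma toric_supportP p : toric_support p.
Proof.
elim: p => [|d q IH] g x y i j g0 x0 y0.
  by move=> nz _; exists i, j; rewrite /tm1 /tm2 /=; split=> //; lia.
have xy0 : (0 < x + y)%N by lia.
case E: (olda q d) => [a|].
  have det := tdat_det q.
  have [] := tdat_sat E; set D := tdat q in det IH * => -[dE ->];
      rewrite [tor _]/= [pull _ _]/= dE ?ori_blow_adir ?ori_blow_adirN.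
    move=> nz min; have ij : (i <= j)%N by move: nz; rewrite coef_blow_inf; case: leqP => //; rewrite eqxx.
    have [||w [T [Gw iE jE]]] := IH g (x + y)%N y i (j - i)%N g0 xy0 y0.
    - by move: nz; rewrite coef_blow_inf ij.
    - move=> i' j' nz'; have := min i' (i' + j')%N; rewrite coef_blow_inf leq_addr addKn => /(_ nz').
      by nia.
    have jE' : j = (tm1 D w T + tm2 D w T)%N by rewrite -jE -iE subnKC.
    by exists w, T; split=> //; rewrite jE' /tm1 /tm2 /= /tal /tbe; lia.
  move=> nz min; have ij : (j <= i)%N by move: nz; rewrite coef_blow0; case: leqP => //; rewrite eqxx.
  have [||w [T [Gw iE jE]]] := IH g x (x + y)%N (i - j)%N j g0 x0 xy0.
  - by move: nz; rewrite coef_blow0 ij.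
  - move=> i' j' nz'; have := min (i' + j')%N j'; rewrite coef_blow0 leq_addl addnK => /(_ nz').
    by nia.
  have iE' : i = (tm1 D w T + tm2 D w T)%N by rewrite -iE -jE subnK.
  by exists w, T; split=> //; rewrite iE' /tm1 /tm2 /= /tal /tbe; lia.
have [_ GD Gc] := tdat_semigroup (d :: q).
have [w0 Gw0 ME] := value_split IH g0 E.
rewrite (tdat_free E) in GD Gc *; rewrite [tor _]/= => nz min.
have [nz' row col] := lexlow_orb d (pull_neq0 q g0).
have iM : (mult (pull q g) <= i)%N.
  by rewrite leqNgt; apply: contraNN nz => lt; rewrite [pull _ _]/= row.
have le := min _ _ nz'; case: (ltngtP i (mult (pull q g))) => [|lt|iE]; first by lia.
  have jt : (j < dord d (pull q g))%N by nia.
  exists (i - nval (tdat q) * j)%N, j; split; rewrite /tm1 /tm2 /=; last by lia.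
    have -> : (i - nval (tdat q) * j = w0 + (i - mult (pull q g) + nval (tdat q) * (dord d (pull q g) - j)))%N.
      by rewrite mulnBr ME; have := leq_mul (leqnn (nval (tdat q))) (ltnW jt); lia.
    apply: GD => //; apply: Gc => /=.
    have : (nval (tdat q) <= nval (tdat q) * (dord d (pull q g) - j))%N by rewrite leq_pmulr // subn_gt0.
    by lia.
  by have := leq_mul (leqnn (nval (tdat q))) (ltnW jt); lia.
have jt : j = dord d (pull q g).
  apply/eqP; rewrite eqn_leq; apply/andP; split; first by nia.
  by rewrite leqNgt; apply: contraNN nz => lt; rewrite [pull _ _]/= iE col.
by exists w0, j; split; rewrite /tm1 /tm2 //= ?iE ?ME jt; lia.
Qed.

(** The converse of [toric_support]. At a free point the second axis is virtual, and any smooth germ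
    transversal to the first may take its place. *)
Definition realizes p : Prop := forall y w T,
  (ax (~~ tor (tdat p)) p <> None -> y = axis (~~ tor (tdat p))) ->
  transversal (ori (tor (tdat p)) y) -> tG (tdat p) w ->
  exists2 g, g != 0 & exists2 t, t \is a GRing.unit &
    pull p g = t * axis (tor (tdat p)) ^+ tm1 (tdat p) w T * y ^+ tm2 (tdat p) w T.

Lemma transversal_axisN o : transversal (ori o (axis (~~ o) : germ)).
Proof. by rewrite ori_axisN; apply: lexlow_v. Qed.

Lemma realizes_value q d z : realizes q -> olda q d = None -> gval (tdat q) z ->
  exists2 g, g != 0 & exists2 t, t \is a GRing.unit & pull (d :: q) g = t * axis (atinf d) ^+ z.
Proof.
move=> rq E [w [T [Gw zE]]]; set D := tdat q in rq Gw zE; set o := tor D.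
have [a1E a2E] := tdat_ax q; rewrite -/D -/o in a1E a2E.
have [y ty [yE [t2 t2u by_]]] : exists2 y, transversal (ori o y) &
    (ax (~~ o) q <> None -> y = axis (~~ o)) /\
    exists2 t2, t2 \is a GRing.unit & blow d y = t2 * axis (atinf d).
  case: (eqVneq d (adir (~~ o))) => [dE|nd]; last first.
    exists (axis (~~ o)); first exact: transversal_axisN.
    by split=> //; apply: blow_axis_free.
  have nE : ax (~~ o) q = None by rewrite -olda_adir -dE.
  (* If d is the direction of the virtual axis, that axis is tilted, so that its pull-back at
     [d :: q] is purely exceptional. *)
  exists (axis (~~ o) + axis o).
    rewrite rmorphD /= ori_axisN ori_axis; split=> // [|[|j] //]; rewrite germD /= /monom /=.
      by rewrite addr0 oner_eq0.
    by rewrite addr0.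
  split=> [|]; first by rewrite nE.
  have [|t2 t2u e2] := @blow_axis_free o d; first by rewrite dE eq_sym adir_neq.
  exists (axis (~~ o) + t2).
    move: t2u; rewrite !germ_unitE germD.
    suff -> : (axis (~~ o) : germ) 0%N 0%N = 0 by rewrite add0r.
    by have := axis_nunit R (~~ o); rewrite germ_unitE negbK => /eqP.
  by rewrite raddfD /= e2 {1}dE blow_axis_adir -dE mulrDl.
case Eo: (ax o q) => [a|]; last first.
  have q0 := a1E Eo.
  have [|g g0 [t tu gE]] := rq y 0%N z yE ty; first by rewrite /D q0.
  exists g => //; exists (blow d t * t2 ^+ z); first by rewrite unitrM blow_unit // unitrX.
  have [e1 e2] : tm1 D 0 z = 0%N /\ tm2 D 0 z = z by rewrite /tm1 /tm2 /D q0 /=; lia.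
  by rewrite /= gE e1 e2 expr0 mulr1 blowM blowX by_ exprMn; ring.
have [g g0 [t tu gE]] := rq y w T yE ty Gw.
have [|t1 t1u e1] := @blow_axis_free o d; first by apply: (olda_free E); rewrite Eo.
exists g => //; exists (blow d t * t1 ^+ tm1 D w T * t2 ^+ tm2 D w T).
  by rewrite !unitrM blow_unit // !unitrX.
rewrite /= gE !blowM !blowX by_ -/D -/o e1 !exprMn.
have -> : z = (tm1 D w T + tm2 D w T)%N by rewrite zE /tm1 /tm2 /tP /tal /tbe; lia.
by rewrite exprD; ring.
Qed.

Lemma realizesP p : realizes p.
Proof.
elim: p => [|d q IH] y w T yE ty Gw.
  have y0 : y != 0 by apply: lexlow_neq0 ty.
  exists (u ^+ tm1 (tdat ([::] : infpoint)) w T * y ^+ tm2 (tdat ([::] : infpoint)) w T).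
    by rewrite mulf_neq0 ?expf_neq0 // u_neq0.
  by exists 1; rewrite ?unitr1 ?mul1r.
case E: (olda q d) => [a|]; last first.
  have [eq1 eq2] := ax_cons_free E.
  rewrite (tdat_free E) in yE ty Gw *.
  (* At a free point g provides the value w, and the T-th power of a curvette with strict transform
     y provides the order T. *)
  have [g g0 [t tu gE]] := realizes_value IH E Gw.
  have y0 := transversal_neq0 ty.
  have [|H H0 [M [[t' t'u ME] _ pM _ _]]] := @descent (d :: q) y (fun=> 1%N) y0.
    move=> o no; have -> : o = atinf d.
      by move: no; case: (o =P atinf d) => // ne; case: o (atinf d) ne eq2 => -[] //= _ ->.
    exact: ty.
  exists (g * H ^+ T); first by rewrite mulf_neq0 ?expf_neq0.
  exists (t * t' ^+ T); first by rewrite unitrM tu unitrX.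
  rewrite pullM pullX gE pM ME (tdat_free E); set D := TData _ _ _ _ _ _ _ _.
  have -> : te1 D (fun=> 1%N) = tn D by rewrite /te1 /ttau /=; lia.
  have -> : te2 D (fun=> 1%N) = 0%N by rewrite /te2 /=; lia.
  have -> : tm1 D w T = (w + tn D * T)%N by rewrite /tm1 /=; lia.
  have -> : tm2 D w T = T by rewrite /tm2 /=; lia.
  by rewrite expr0 mulr1 exprD [axis _ ^+ (_ * _)]exprM !exprMn; ring.
have [o dE aE] := olda_some E.
have [] := tdat_sat E; set D := tdat q in IH * => -[dE' TE]; rewrite TE /= in yE ty Gw *.
  have [|w2 w2u e2] := @blow_axis_free (~~ tor D) d; first by rewrite dE' adir_neq.
  have e1 : blow d (axis (tor D)) = axis (tor D) * axis (~~ tor D).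
    by rewrite dE' blow_axis_adir atinf_adir.
  have -> : y = axis (~~ tor D).
    by apply: yE; rewrite dE'; have [_ ->] := ax_cons_adir q (tor D).
  have [g g0 [t tu gE]] := IH (axis (~~ tor D)) w T (fun=> erefl) (transversal_axisN _) Gw.
  exists g => //; exists (blow d t * w2 ^+ tm2 D w T); first by rewrite unitrM blow_unit // unitrX.
  rewrite gE !blowM !blowX -/D e1 e2 dE' atinf_adir !exprMn.
  have -> : tm2 (TData (tor D) (tn D) (tk D) (tG D) (ta1 D) (tb1 D) (tal D) (tbe D)) w T =
    (tm1 D w T + tm2 D w T)%N by rewrite /tm1 /tm2 /tal /tbe /=; lia.
  by rewrite -[tm1 (TData _ _ _ _ _ _ _ _) w T]/(tm1 D w T) exprD; ring.
have [|w2 w2u e2] := @blow_axis_free (tor D) d; first by rewrite dE' eq_sym adir_neq.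
have e1 : blow d (axis (~~ tor D)) = axis (~~ tor D) * axis (tor D).
  by rewrite dE' blow_axis_adir atinf_adir negbK.
have -> : y = axis (~~ tor D).
  apply: yE; rewrite dE'; have [-> _] := ax_cons_adir q (~~ tor D).
  by rewrite -olda_adir -dE' E.
have [g g0 [t tu gE]] := IH (axis (~~ tor D)) w T (fun=> erefl) (transversal_axisN _) Gw.
exists g => //; exists (blow d t * w2 ^+ tm1 D w T); first by rewrite unitrM blow_unit // unitrX.
rewrite gE !blowM !blowX -/D e1 e2 dE' atinf_adir negbK !exprMn.
have -> : tm1 (TData (tor D) (tn D) (tk D) (tG D) (tal D) (tbe D) (ta2 D) (tb2 D)) w T =
  (tm1 D w T + tm2 D w T)%N by rewrite /tm1 /tm2 /tal /tbe /=; lia.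
by rewrite -[tm2 (TData _ _ _ _ _ _ _ _) w T]/(tm2 D w T) exprD; ring.
Qed.

End ToricData.
Arguments adir {R} o.

(** * Arithmetic of the toric data *)

Section ToricArithmetic.
Variable D : tdata.
Hypothesis det : (ta1 D * tb2 D = ta2 D * tb1 D + 1)%N.

Lemma toric_gt0 : [/\ (0 < tal D)%N, (0 < tP D)%N & (0 < tbe D)%N].
Proof.
move: det; rewrite /tP /tal /tbe.
by case: (ta1 _) => [|a]; case: (tb2 _) => [|b]; split; lia.
Qed.

(** B1 and B2 are the exponents left on the axes once S curvettes are taken out. Unimodularity
    solves for (W, T) in integers, and the last two equations express W and T without S. *)
Lemma toric_coordinates (A1 A2 S v : int) : v = A1 + A2 + S ->
  let B1 := A1 - S * (xplus D)%:Z in let B2 := A2 - S * (xminus D)%:Z in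
  let T := (ta1 D)%:Z * B2 - (ta2 D)%:Z * B1 in
  let W := (tb2 D)%:Z * B1 - (tb1 D)%:Z * B2 - (tn D)%:Z * T in
  [/\ B1 = (ta1 D)%:Z * (W + (tn D)%:Z * T) + (tb1 D)%:Z * T,
      B2 = (ta2 D)%:Z * (W + (tn D)%:Z * T) + (tb2 D)%:Z * T,
      (tP D)%:Z * T = A2 * (nval D)%:Z - (xminus D)%:Z * v &
      (tal D)%:Z * W = A1 * (nval D)%:Z - (xplus D)%:Z * v].
Proof.
move=> vE B1 B2 T W.
have detZ : (ta1 D)%:Z * (tb2 D)%:Z - (ta2 D)%:Z * (tb1 D)%:Z = 1 :> int.
  by clear -det; lia.
have v2 : v = S * (nval D)%:Z + B1 + B2.
  by rewrite (toric_nval det) !PoszD vE /B1 /B2; ring.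
split.
- transitivity (B1 * ((ta1 D)%:Z * (tb2 D)%:Z - (ta2 D)%:Z * (tb1 D)%:Z)).
    by rewrite detZ mulr1.
  by rewrite /W /T; ring.
- transitivity (B2 * ((ta1 D)%:Z * (tb2 D)%:Z - (ta2 D)%:Z * (tb1 D)%:Z)).
    by rewrite detZ mulr1.
  by rewrite /W /T; ring.
- have -> : A2 = S * (xminus D)%:Z + B2 by rewrite /B2; ring.
  rewrite v2; transitivity ((nval D)%:Z * B2 - (xminus D)%:Z * (B1 + B2)); last by ring.
  by rewrite /nval /xminus !PoszM /tal PoszD /T; ring.
- have -> : A1 = S * (xplus D)%:Z + B1 by rewrite /B1; ring.
  rewrite v2; transitivity ((nval D)%:Z * B1 - (xplus D)%:Z * (B1 + B2)); last by ring.
  by rewrite /W /T /nval /xplus /tP /tal /tbe !(PoszD, PoszM); ring.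
Qed.

(** Together with [toric_k1], this turns the windows of the residue numbers into T > -1 and W + tk >
    tn. *)
Lemma toric_k2 : ((ta2 D * tk D + tb2 D) * nval D = xminus D * kval D + tP D)%N.
Proof. by rewrite /nval /xminus /kval /tP /tal /tbe; move: det; nia. Qed.

Lemma toric_k1 :
  ((ta1 D * tk D + tb1 D) * nval D + tal D * tn D = xplus D * kval D + tal D * tk D)%N.
Proof. by rewrite /nval /xplus /kval /tP /tal /tbe; move: det; nia. Qed.

(** The curvette of the divisor, x^(tn tal) (y^tal - x^tbe) at Q, has two monomials. Dividing by one
    or the other lowers T by [tal] or w by [tP]; this takes [xplus] and [xminus] off the exponents,
    and one more unit on the second, respectively the first, axis. *)
Lemma tm1_subT w T : (tal D <= T)%N -> (tm1 D w T = tm1 D w (T - tal D) + xplus D)%N.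
Proof. by move=> le; rewrite -{1}(subnK le) /tm1 /xplus; lia. Qed.

Lemma tm2_subT w T : (tal D <= T)%N -> (tm2 D w T = tm2 D w (T - tal D) + xminus D + 1)%N.
Proof.
move=> le; rewrite -{1}(subnK le) /tm2 /xminus /tP.
have : (tal D * tb2 D = ta2 D * tbe D + 1)%N by move: det; rewrite /tal /tbe; lia.
by lia.
Qed.

Lemma tm1_addw w T : (tm1 D (w + tP D) T = tm1 D w T + xplus D + 1)%N.
Proof.
rewrite /tm1 /xplus /tP.
have : (ta1 D * tbe D = tal D * tb1 D + 1)%N by move: det; rewrite /tal /tbe; lia.
by lia.
Qed.

Lemma tm2_addw w T : (tm2 D (w + tP D) T = tm2 D w T + xminus D)%N.
Proof. by rewrite /tm2 /xminus; lia. Qed.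

(** T and Ts solve the same congruence modulo [tal], of which T < tal is the least solution. *)
Lemma toric_congruence v w T ws Ts : (T < tal D)%N -> v = (tal D * ws + tP D * Ts)%N ->
  (tm1 D w T + tm2 D w T = v + nval D)%N -> exists m, w = (ws + tP D * m + tP D)%N.
Proof.
move=> Tal vs vN; have [al0 _ _] := toric_gt0.
have cmp : (tal D * w + tP D * T = tal D * ws + tP D * Ts + tal D * tP D)%N.
  by move: vN; rewrite /nval vs /tm1 /tm2 /tP /tal /tbe; lia.
have [m mE] : exists m : nat, Ts = (T + tal D * m)%N.
  have e : (ta1 D * tP D = tal D * (tn D * ta1 D + tb1 D) + 1)%N.
    by rewrite /tP /tal /tbe; move: det; lia.
  have : (T = Ts %[mod tal D])%N.
    have := congr1 (fun n => (ta1 D * n) %% tal D)%N cmp.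
    have -> : (ta1 D * (tal D * w + tP D * T) = (ta1 D * w + (tn D * ta1 D + tb1 D) * T) * tal D + T)%N.
      by have e' : (ta1 D * tP D * T = (tal D * (tn D * ta1 D + tb1 D) + 1) * T)%N; [rewrite e|clear -e'; lia].
    have -> : (ta1 D * (tal D * ws + tP D * Ts + tal D * tP D) =
      (ta1 D * ws + (tn D * ta1 D + tb1 D) * Ts + ta1 D * tP D) * tal D + Ts)%N.
      by have e' : (ta1 D * tP D * Ts = (tal D * (tn D * ta1 D + tb1 D) + 1) * Ts)%N; [rewrite e|clear -e'; lia].
    by rewrite !modnMDl.
  rewrite (modn_small Tal) => TsE; exists (Ts %/ tal D)%N.
  by rewrite {1}(divn_eq Ts (tal D)) -TsE addnC mulnC.
exists m; apply/eqP; rewrite -(eqn_pmul2l al0); apply/eqP; move: cmp; rewrite mE; lia.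
Qed.

End ToricArithmetic.

Lemma int_nat (z : int) : 0 <= z -> exists n : nat, z = n%:Z.
Proof. by case: z => // n _; exists n. Qed.

(** * Choice of the residue numbers *)

Section Windows.

Lemma window (x : rat) (b : bool) : exists z : int,
  if b then 0 < z%:~R + x <= 1 else 0 <= z%:~R + x < 1.
Proof.
case: b; [exists (Num.floor (- x) + 1)|exists (- Num.floor x)].
  by have := floor_itv (- x); rewrite !intrD /=; lra.
by have := floor_itv x; rewrite intrD mulrNz /=; lra.
Qed.

(** Lets [lra] refute hypotheses among the rationals whatever the goal is. *)
Lemma rat_absurd (P : Prop) : (1 : rat) <= 0 -> P.
Proof. by rewrite ler10. Qed.

Lemma int_gtN2 (z : int) : - 2 < z -> -1 <= z. Proof. by lia. Qed.
Lemma int_ltS0 (z : int) : 0 < z + 1 -> 0 <= z. Proof. by lia. Qed.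

(** N and v are the orders of f and g along the divisor, r lists the free directions in which f has
    orders c > 0, and c1, c2 are the orders of f in the older directions, 0 for a virtual axis. *)
Variables (D : tdata) (I : eqType) (r : seq I) (c : I -> nat) (N v c1 c2 : nat).
Hypothesis det : (ta1 D * tb2 D = ta2 D * tb1 D + 1)%N.
Hypothesis kn : (tk D <= (tn D).+1)%N.
Hypothesis semi : [/\ tG D 0%N, forall w w', tG D w -> tG D w' -> tG D (w + w')%N &
      forall w, (tn D < w + tk D)%N -> tG D w].
Hypotheses (ur : uniq r) (N0 : (0 < N)%N) (c0 : forall j, j \in r -> (0 < c j)%N).
Hypothesis NE : (N = c1 + c2 + \sum_(j <- r) c j)%N.
Hypotheses (X1 : (xplus D * N <= c1 * nval D)%N) (X2 : (xminus D * N <= c2 * nval D)%N).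
Hypothesis gv : gval D v.

Let s : rat := (kval D + v)%:R / N%:R.
Let k1 := (ta1 D * tk D + tb1 D)%N.
Let k2 := (ta2 D * tk D + tb2 D)%N.

Let e1 (a : nat) : rat := k1%:R + a%:R - s * c1%:R.
Let e2 (a : nat) : rat := k2%:R + a%:R - s * c2%:R.
Let ej (a : I -> nat) j : rat := 1 + (a j)%:R - s * (c j)%:R.

(** a1 and a2 are the orders of g' in the older directions, a gives those in r, and ar curvettes
    pass through a general point. *)
Let good (w T : nat) (a : I -> nat) (ar : nat) : Prop :=
  let S := (\sum_(j <- r) a j + ar)%N in
  let a1 := (tm1 D w T + S * xplus D)%N in
  let a2 := (tm2 D w T + S * xminus D)%N in
  [/\ tG D w, (a1 + a2 + S = v)%N,
   [/\ -1 <= e1 a1 <= 1, -1 <= e2 a2 <= 1 & forall j, j \in r -> -1 <= ej a j < 1],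
   (e1 a1 = 1 -> (c1 * nval D = xplus D * N)%N) /\
   (e2 a2 = 1 -> (c2 * nval D = xminus D * N)%N) &
   (e1 a1 = -1 \/ e2 a2 = -1 -> r = [::]) /\
   (forall j, j \in r -> ej a j = -1 -> [/\ size r = 1%N, (c1 * nval D = xplus D * N)%N &
                                             (c2 * nval D = xminus D * N)%N])].

(** Each residue number is placed in [0, 1), or in (0, 1] for an old direction whose
    component contains no arrowhead. The multiplicity [ar] that is left over for general
    points is then at least -1; if it is -1, one of the residue numbers is lowered by 1. *)
Lemma residue_windows : exists w T a ar, good w T a ar.
Proof.
have [al0 P0 be0] := toric_gt0 det; have nvE := toric_nval det.
have kvE : kval D = (k1 + k2)%N by rewrite /kval /k1 /k2 /tal /tbe; lia.
have NR : N%:R != 0 :> rat by rewrite pnatr_eq0 -lt0n.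
have NR0 : 0 < N%:R :> rat by rewrite ltr0n.
have kv0 : (0 < kval D)%N by rewrite addn_gt0 be0 orbT.
have s0 : 0 < s by rewrite divr_gt0 // ltr0n addn_gt0 kv0.
have sN : s * N%:R = (kval D)%:R + v%:R by rewrite /s natrD mulfVK.
have nv0 : 0 < (nval D)%:R :> rat by rewrite ltr0n nvE addn1.
(* The third conclusion is the positivity from which W and T get their bounds; q = 0 has to be
   excluded only in the case of equality. *)
have win (q : rat) (ci xi : nat) : (xi * N <= ci * nval D)%N ->
    (if (ci * nval D == xi * N)%N then 0 < q <= 1 else 0 <= q < 1) ->
  [/\ 0 <= q <= 1, q = 1 -> (ci * nval D = xi * N)%N &
      0 < (nval D)%:R * q + s * ((ci * nval D)%:R - (xi * N)%:R)].
  case: eqP => [-> _|/eqP ne le] qw.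
    by split; [lra|by []|rewrite subrr mulr0 addr0 mulr_gt0 //; lra].
  split; [lra|by move=> ?; apply: rat_absurd; lra|].
  apply: ltr_wpDl; first by rewrite mulr_ge0 ?ler0n //; lra.
  by rewrite mulr_gt0 // subr_gt0 ltr_nat ltn_neqAle le andbT eq_sym.
have [A1 /(win _ _ _ X1)] := window (k1%:R - s * c1%:R) (c1 * nval D == xplus D * N)%N.
have [A2 /(win _ _ _ X2)] := window (k2%:R - s * c2%:R) (c2 * nval D == xminus D * N)%N.
set q2 := A2%:~R + _ => -[i2 f2 g2]; set q1 := A1%:~R + _ => -[i1 f1 g1].
have [a aP] : exists a : I -> nat, forall j, j \in r -> 0 <= ej a j < 1.
  have /choice[a aP] : forall j, exists aj : nat, (0 < c j)%N -> 0 <= 1 + aj%:R - s * (c j)%:R < 1.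
    move=> j; have [z] := window (1 - s * (c j)%:R) false; case: (posnP (c j)) => [->|cj].
      by exists 0%N.
    have sc : 0 < s * (c j)%:R by rewrite mulr_gt0 // ltr0n.
    move=> zP; have : -1 < z%:~R :> rat by lra.
    rewrite -[-1]/((-1)%:~R) ltr_int => z1.
    case: z z1 zP => // z _ zP; exists z => _.
    by move: zP; rewrite -[(Posz z)%:~R]/(z%:R : rat); lra.
  by exists a => j /c0/aP.
(* t is 1 minus the residue number; E - q1 - q2 is then the multiplicity left for general points. *)
pose t j := s * (c j)%:R - (a j)%:R; pose E := \sum_(j <- r) t j.
have t01 j : j \in r -> 0 < t j <= 1 by move=> /aP; rewrite /ej /t; lra.
have EE : E = s * (\sum_(j <- r) c j)%:R - (\sum_(j <- r) a j)%:R.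
  by rewrite /E sumrB -mulr_sumr !natr_sum.
have Esplit j : j \in r -> exists2 F, E = t j + F & 0 <= F /\ (F = 0 -> size r = 1%N).
  move=> jr; exists (\sum_(i <- r | i != j) t i); first by rewrite /E (bigD1_seq j).
  split.
    by rewrite big_seq_cond sumr_ge0 // => i /andP[/t01 + _]; lra.
  move=> F0; have : all (fun i => i == j) r.
    move/eqP: F0; rewrite big_seq_cond psumr_eq0 => [/allP H|i /andP[/t01 + _]]; last by lra.
    apply/allP => i ir; have := H i ir; rewrite ir /=; case: eqP => //= _ /eqP ti.
    by have := t01 _ ir; rewrite ti; lra.
  case: (r) ur jr => [|i [|i' l]] //= /andP[ni _] _ /and3P[/eqP ei /eqP ei' _].
  by move: ni; rewrite ei ei' mem_head.
have E0 : 0 <= E by rewrite /E big_seq_cond sumr_ge0 // => i /andP[/t01 + _]; lra.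
have Er : E <= 0 -> r = [::].
  move=> El; case E0' : r => [//|j l]; have jr : j \in r by rewrite E0' mem_head.
  by apply: rat_absurd; have [F EF [F0 _]] := Esplit _ jr; have := t01 _ jr; lra.
pose sa : nat := (\sum_(j <- r) a j)%N; pose S : int := v%:Z - A1 - A2.
pose ar : int := S - sa%:Z.
have arE : ar%:~R = E - q1 - q2 :> rat.
  rewrite EE /ar /S /q1 /q2 !intrB -!pmulrn -/sa.
  have := sN; rewrite NE kvE !natrD !mulrDr; lra.
have ar1 : -1 <= ar.
  suff : -2 < ar%:~R :> rat by rewrite -[-2]/((-2)%:~R) ltr_int; apply: int_gtN2.
  rewrite arE; case: (ltrP 0 E) => Ep; first by lra.
  suff : q1 < 1 \/ q2 < 1 by case=> ?; lra.
  case: (ltrP q1 1) => h1; first by left.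
  case: (ltrP q2 1) => h2; first by right.
  (* Both residue numbers 1 and r empty would give N n = (n - 1) N for n = [nval]. *)
  have q1E : q1 = 1 by lra.
  have q2E : q2 = 1 by lra.
  have : (N * nval D = (xplus D + xminus D) * N)%N.
    by rewrite {1}NE (Er Ep) big_nil addn0 mulnDl (f1 q1E) (f2 q2E) -mulnDl.
  by rewrite nvE mulnDr muln1 mulnC => /eqP; rewrite -[X in _ == X]addn0 eqn_add2l eqn0Ngt N0.
have vS : v%:Z = A1 + A2 + S by rewrite /S; ring.
have [] := toric_coordinates det vS.
set B1 := A1 - _; set B2 := A2 - _; set TT := _ - (ta2 D)%:Z * B1; set WW := _ - (tn D)%:Z * TT.
move=> B1E B2E TE WE.
have q1E : q1 = A1%:~R + k1%:R - s * c1%:R by rewrite /q1; ring.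
have q2E : q2 = A2%:~R + k2%:R - s * c2%:R by rewrite /q2; ring.
have T0 : 0 <= TT.
  have kE : (k2%:R * (nval D)%:R = (xminus D)%:R * (kval D)%:R + (tP D)%:R :> rat).
    by rewrite -!natrM -natrD (toric_k2 det).
  have e : (tP D)%:R * TT%:~R = (nval D)%:R * q2 - (tP D)%:R
      + s * ((c2 * nval D)%:R - (xminus D * N)%:R) :> rat.
    transitivity (A2%:~R * (nval D)%:R - (xminus D)%:R * v%:R : rat).
      by have := congr1 (fun z : int => z%:~R : rat) TE; rewrite intrB !intrM.
    have -> : (tP D)%:R = k2%:R * (nval D)%:R - (xminus D)%:R * (kval D)%:R :> rat.
      by rewrite kE; ring.
    have -> : v%:R = s * N%:R - (kval D)%:R :> rat by rewrite sN; ring.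
    by rewrite q2E !natrM; ring.
  have : (tP D)%:R * (TT + 1)%:~R = (tP D)%:R * TT%:~R + (tP D)%:R :> rat by rewrite intrD; ring.
  rewrite e => e'; have : 0 < (tP D)%:R * (TT + 1)%:~R :> rat by rewrite e'; lra.
  by rewrite pmulr_rgt0 ?ltr0n // -[0]/(0%:~R) ltr_int; apply: int_ltS0.
have W0 : (tn D)%:Z - (tk D)%:Z < WW.
  have kE : (k1%:R * (nval D)%:R + (tal D)%:R * (tn D)%:R =
      (xplus D)%:R * (kval D)%:R + (tal D)%:R * (tk D)%:R :> rat).
    by rewrite -!natrM -!natrD (toric_k1 det).
  have e : (tal D)%:R * WW%:~R = (nval D)%:R * q1 - ((tal D)%:R * (tk D)%:R - (tal D)%:R * (tn D)%:R)
      + s * ((c1 * nval D)%:R - (xplus D * N)%:R) :> rat.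
    transitivity (A1%:~R * (nval D)%:R - (xplus D)%:R * v%:R : rat).
      by have := congr1 (fun z : int => z%:~R : rat) WE; rewrite intrB !intrM.
    have -> : (tal D)%:R * (tk D)%:R - (tal D)%:R * (tn D)%:R =
        k1%:R * (nval D)%:R - (xplus D)%:R * (kval D)%:R :> rat by lra.
    have -> : v%:R = s * N%:R - (kval D)%:R :> rat by rewrite sN; ring.
    by rewrite q1E !natrM; ring.
  have e' : (tal D)%:R * (WW - ((tn D)%:Z - (tk D)%:Z))%:~R =
      (tal D)%:R * WW%:~R + (tal D)%:R * (tk D)%:R - (tal D)%:R * (tn D)%:R :> rat.
    by rewrite !intrB -!pmulrn; ring.
  rewrite e in e'.
  have : 0 < (tal D)%:R * (WW - ((tn D)%:Z - (tk D)%:Z))%:~R :> rat by rewrite e'; lra.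
  by rewrite pmulr_rgt0 ?ltr0n // -[0]/(0%:~R) ltr_int subr_gt0.
have [w wE] : exists w : nat, WW = w%:Z by apply: int_nat; clear -W0 kn; lia.
have [T tE] := int_nat T0.
have [G0 GD Gc] := semi.
have Gw : tG D w by apply: Gc; clear -W0 wE; lia.
have tm1E : (tm1 D w T)%:Z = B1 by rewrite B1E wE tE /tm1 !(PoszD, PoszM).
have tm2E : (tm2 D w T)%:Z = B2 by rewrite B2E wE tE /tm2 !(PoszD, PoszM).
have e1E (n : nat) z : n%:Z = A1 + z -> e1 n = q1 + z%:~R.
  by move=> h; rewrite /e1 q1E [n%:R]pmulrn h intrD; ring.
have e2E (n : nat) z : n%:Z = A2 + z -> e2 n = q2 + z%:~R.
  by move=> h; rewrite /e2 q2E [n%:R]pmulrn h intrD; ring.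
have sumE (n1 n2 m : nat) : n1%:Z + n2%:Z + m%:Z = v%:Z -> (n1 + n2 + m = v)%N.
  by move=> h; apply/eqP; rewrite -eqz_nat !PoszD h.
have arS : S = sa%:Z + ar by rewrite /ar; ring.
case: (lerP 0 ar) => ar0.
  have [ar' ar'E] := int_nat ar0.
  have SE : S = (sa + ar')%N%:Z by rewrite arS ar'E.
  have E1 : (tm1 D w T + (sa + ar') * xplus D)%N%:Z = A1 + 0 by rewrite PoszD PoszM -SE tm1E /B1; ring.
  have E2 : (tm2 D w T + (sa + ar') * xminus D)%N%:Z = A2 + 0 by rewrite PoszD PoszM -SE tm2E /B2; ring.
  exists w, T, a, ar'; split=> //; rewrite -/sa ?(e1E _ _ E1) ?(e2E _ _ E2) ?addr0.
  - by apply: sumE; rewrite E1 E2 -SE /S; ring.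
  - by split; [lra|lra|move=> j /aP; lra].
  - by [].
  - split=> [[h|h]|j /aP h1 h2]; apply: rat_absurd; lra.
have {ar1 ar0} arN : ar = -1 by clear -ar1 ar0; lia.
have Eq : E = q1 + q2 - 1 by rewrite arN in arE; lra.
have SE : S + 1 = sa%:Z by rewrite arS arN; ring.
(* The missing curvette is saved in a free direction if some a j is positive; otherwise S = -1 and
   the toric monomial has to give up one curvette. *)
case: (boolP (has (fun j => 0 < a j)%N r)) => [/hasP[j jr aj]|none].
  pose a' i := if i == j then (a j).-1 else a i.
  have sa' : (\sum_(i <- r) a' i + 1 = sa)%N.
    rewrite /sa !(bigD1_seq j) //= /a' eqxx.
    rewrite (eq_bigr a) => [|i /negPf ->] //.
    by rewrite addn1 -addSn prednK.
  have ejE : ej a' j = ej a j - 1.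
    by rewrite /ej /a' eqxx -[in RHS](prednK aj) -addn1 natrD; ring.
  have eiE i : i != j -> ej a' i = ej a i by rewrite /ej /a' => /negPf ->.
  have SE' : (\sum_(i <- r) a' i + 0)%N%:Z = S.
    by apply: (addIr 1); rewrite SE -sa' addn0 PoszD.
  have E1 : (tm1 D w T + (\sum_(i <- r) a' i + 0) * xplus D)%N%:Z = A1 + 0.
    by rewrite PoszD PoszM SE' tm1E /B1; ring.
  have E2 : (tm2 D w T + (\sum_(i <- r) a' i + 0) * xminus D)%N%:Z = A2 + 0.
    by rewrite PoszD PoszM SE' tm2E /B2; ring.
  exists w, T, a', 0%N; split=> //; rewrite ?(e1E _ _ E1) ?(e2E _ _ E2) ?addr0.
  - by apply: sumE; rewrite E1 E2 SE' /S; ring.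
  - split; [lra|lra|move=> i ir]; case: (eqVneq i j) => [->|/eiE ->]; last by have := aP _ ir; lra.
    by rewrite ejE; have := aP _ jr; lra.
  - by [].
  - split=> [[h|h]|i ir]; [apply: rat_absurd; lra|apply: rat_absurd; lra|].
    case: (eqVneq i j) => [->|/eiE -> h]; last by apply: rat_absurd; have := aP _ ir; lra.
    (* The value -1 forces t j = 1, hence F = q1 + q2 - 2 <= 0: j is the only free direction and q1
       = q2 = 1. *)
    rewrite ejE => h; have [F EF [F0 Fs]] := Esplit _ jr.
    have tj : t j = 1 by move: h; rewrite /ej /t; lra.
    by split; [apply: Fs; lra|apply: f1; lra|apply: f2; lra].
have sa0 : sa = 0%N.
  apply/eqP; rewrite /sa sum_nat_seq_eq0; apply/allP => i ir /=.
  by move/hasPn: none => /(_ _ ir); rewrite -eqn0Ngt.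
have SN : S = -1 by apply: (addIr 1); rewrite SE sa0.
have vN : (v + nval D)%N%:Z = B1 + B2 by rewrite nvE !PoszD vS /B1 /B2 SN; ring.
(* Either T can be lowered by [tal], at the cost of q2, or the congruence shows that w can be
   lowered by [tP] within the semigroup, at the cost of q1. A value -1 then leaves E <= 0, so r is
   empty. *)
case: (leqP (tal D) T) => [alT|Tal].
  have T1 := tm1_subT det w alT; have T2 := tm2_subT det w alT.
  have E1 : (tm1 D w (T - tal D) + (sa + 0) * xplus D)%N%:Z = A1 + 0.
    by move: tm1E; rewrite T1 /B1 SN sa0; clear; lia.
  have E2 : (tm2 D w (T - tal D) + (sa + 0) * xminus D)%N%:Z = A2 + (- 1).
    by move: tm2E; rewrite T2 /B2 SN sa0; clear; lia.
  have E21 : e2 (tm2 D w (T - tal D) + (sa + 0) * xminus D) = q2 - 1 by rewrite (e2E _ _ E2) mulrN1z.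
  exists w, (T - tal D)%N, a, 0%N; split=> //; rewrite -/sa ?(e1E _ _ E1) ?E21 ?addr0.
  - by apply: sumE; rewrite E1 E2 addn0 -SE /S; ring.
  - by split; [lra|lra|move=> j /aP; lra].
  - by split=> [//|h]; apply: rat_absurd; lra.
  - split=> [[h|h]|j /aP h1 h2]; [apply: rat_absurd; lra| |apply: rat_absurd; lra].
    by apply: Er; lra.
have [ws [Ts [Gws vs]]] := gv.
have [|m wP] := toric_congruence det (w := w) Tal vs.
  by apply/eqP; rewrite -eqz_nat vN PoszD tm1E tm2E.
(* A positive multiple of [tP] lies beyond the conductor, since [tP] exceeds [tn]. *)
have Gw' : tG D (ws + tP D * m).
  apply: GD => //; case: m {wP} => [|m]; first by rewrite muln0.
  apply: Gc; have : (tn D <= tal D * tn D)%N by rewrite leq_pmull.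
  have : (tP D <= tP D * m.+1)%N by rewrite leq_pmulr.
  by clear -be0; rewrite {1}/tP; lia.
set w' := (ws + _)%N in wP Gw'.
have T1 : (tm1 D w T = tm1 D w' T + xplus D + 1)%N by rewrite wP tm1_addw //.
have T2 : (tm2 D w T = tm2 D w' T + xminus D)%N by rewrite wP tm2_addw //.
have E1 : (tm1 D w' T + (sa + 0) * xplus D)%N%:Z = A1 + (- 1).
  by move: tm1E; rewrite T1 /B1 SN sa0; clear; lia.
have E2 : (tm2 D w' T + (sa + 0) * xminus D)%N%:Z = A2 + 0.
  by move: tm2E; rewrite T2 /B2 SN sa0; clear; lia.
have E11 : e1 (tm1 D w' T + (sa + 0) * xplus D) = q1 - 1 by rewrite (e1E _ _ E1) mulrN1z.
exists w', T, a, 0%N; split=> //; rewrite -/sa ?(e2E _ _ E2) ?E11 ?addr0.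
- by apply: sumE; rewrite E1 E2 addn0 -SE /S; ring.
- by split; [lra|lra|move=> j /aP; lra].
- by split=> // h; apply: rat_absurd; lra.
- split=> [[h|h]|j /aP h1 h2]; [|apply: rat_absurd; lra|apply: rat_absurd; lra].
  by apply: Er; lra.
Qed.

End Windows.

(** * The dual graph *)

Section ResidueNumbers.
Variable R : realType.
Local Notation germ := (germ R).
Local Notation infpoint := (infpoint R).
Implicit Types (g h x y G H : germ) (d : direction R) (o : bool) (p q : infpoint).

Lemma suffix_pt p d k : suffix (d :: p) (pt p d k).
Proof. by apply/suffixP; exists (nseq k (nxt d)). Qed.

Lemma suffix_size_eq p q (r : infpoint) : suffix p r -> suffix q r -> size p = size q -> p = q.
Proof.
move=> /suffixP[l ->] /suffixP[l' e] sz.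
have sl : size l = size l' by have := congr1 size e; rewrite !size_cat sz => /addIn.
by move/eqP: e; rewrite eqseq_cat // => /andP[_ /eqP].
Qed.

Lemma suffix_nsize p q : (size q < size p)%N -> ~~ suffix p q.
Proof. by apply: contraL => /suffixP[l ->]; rewrite size_cat; lia. Qed.

Lemma ax_over p d q o b : suffix (d :: p) q -> ax o q = Some b ->
  [\/ b = p, suffix (d :: p) b | olda p d = Some b].
Proof.
move=> /suffixP[l ->]; elim: l o => [|e l IH] o /=.
  case: o; case: d => [c|] /=.
  - by case: ifP => // c0 H; apply: Or33.
  - by case=> ->; apply: Or31.
  - by case=> ->; apply: Or31.
  - by move=> H; apply: Or33.
case: e => [c|]; case: o => /=.
- by case: ifP => // _; apply: (IH true).
- by case=> <-; apply: Or32; apply: suffix_suffix.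
- by case=> <-; apply: Or32; apply: suffix_suffix.
- exact: (IH false).
Qed.

Lemma olda_inj p d d' a : olda p d = Some a -> olda p d' = Some a -> d = d'.
Proof.
move=> /olda_some[o -> aE] /olda_some[o' -> aE']; case: (o =P o') => [->//|ne].
by case: o o' ne aE aE' => -[] // _ aE aE'; [case: (ax_neq aE' aE)|case: (ax_neq aE aE')].
Qed.

Section Graph.
Variable s : seq infpoint.
Hypothesis bs : blowups s.

Lemma meetC D D' : meet s D D' -> meet s D' D.
Proof. by case=> q [yq t t']; exists q. Qed.

Lemma edgeC a b : edge s a b = edge s b a.
Proof.
rewrite /edge andbCA eq_sym; congr [&& _, _, _ & _].
by apply/asboolP/asboolP => /meetC.
Qed.

Lemma on_Y_or_center q d : q \in s -> on_Y s (d :: q) \/ d :: q \in s.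
Proof. by move=> qs; case: (boolP (d :: q \in s)) => [|nq]; [right|left]. Qed.

(** If q is blown up, its divisor separates a from b, and the two new intersection points are
    treated by induction on the number of centers over q. *)
Lemma path_axes q o a b : on_Y s q \/ q \in s -> ax o q = Some a -> ax (~~ o) q = Some b ->
  exists2 ps, path (edge s) a (rcons ps b) & all (suffix q) ps.
Proof.
have [n] := ubnP (count (suffix q) s); elim: n q a b => // n IH q a b lt yq aE bE.
case: (boolP (q \in s)) => qs; last first.
  have {}yq : on_Y s q by case: yq => // qs'; rewrite qs' in qs.
  exists [::] => //=; rewrite andbT /edge (ax_mem bs (or_introl yq) aE) (ax_mem bs (or_introl yq) bE) /=.
  apply/andP; split; first by apply/eqP; apply: (ax_other aE bE).
  by apply/asboolP; exists q; split=> //; apply/exc_through; eexists; [exact: aE|exact: bE].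
have cnt d : (count (suffix (d :: q)) s < n)%N.
  rewrite -ltnS; apply: leq_trans lt; rewrite ltnS.
  have [s1 [s2 sE]] : exists s1 s2, s = s1 ++ q :: s2.
    by case/splitPr: qs => s1 s2; exists s1, s2.
  have nq : suffix (d :: q) q = false.
    by apply: negbTE; apply: suffix_nsize => /=.
  have sub r : suffix (d :: q) r -> suffix q r.
    by move=> /suffixP[l ->]; apply/suffixP; exists (rcons l d); rewrite cat_rcons.
  rewrite sE !count_cat /= suffix_refl nq add0n add1n addnS ltnS.
  by apply: leq_add; apply: sub_count.
have [e1 e2] := ax_cons_adir q o; have [e3 e4] := ax_cons_adir q (~~ o).
rewrite negbK in e4.
have [ps1 P1 A1] := IH _ _ _ (cnt _) (on_Y_or_center (adir o) qs) (etrans e1 aE) e2.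
have [ps2 P2 A2] := IH _ _ _ (cnt _) (on_Y_or_center (adir (~~ o)) qs) e4 (etrans e3 bE).
exists (ps1 ++ q :: ps2).
  by rewrite rcons_cat /= -cat_rcons cat_path last_rcons P1.
have sub d : subpred (suffix (d :: q)) (suffix q).
  by move=> r /suffixP[l ->]; apply/suffixP; exists (rcons l d); rewrite cat_rcons.
by rewrite all_cat /= suffix_refl (sub_all (sub _) A1) (sub_all (sub _) A2).
Qed.

Definition conn a b := exists2 ps, path (edge s) a ps & last a ps = b.

Lemma conn_trans a b c : conn a b -> conn b c -> conn a c.
Proof.
by move=> [ps P <-] [ps' P' <-]; exists (ps ++ ps'); rewrite ?last_cat // cat_path P.
Qed.

Lemma connC a b : conn a b -> conn b a.
Proof.
move=> [ps P <-]; exists (rev (belast a ps)).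
  by rewrite rev_path (eq_path (e' := edge s)) // => x' y'; rewrite edgeC.
by case: ps {P} => //= c ps; rewrite rev_cons last_rcons.
Qed.

Lemma conn_nil p : p \in s -> conn p [::].
Proof.
elim: p => [|d b IH] ps; first by exists [::].
have [bsm _] := blowups_tail bs ps; apply: conn_trans (IH bsm).
have [e1 e2] := ax_cons_adir (d :: b) (atinf d).
have aE := ax_pt b d 0.
have [ps' P _] := path_axes (on_Y_or_center (adir (atinf d)) ps) (etrans e1 aE) e2.
by apply: connC; exists (rcons ps' (d :: b)); rewrite ?last_rcons.
Qed.

Lemma connP p q : p \in s -> q \in s -> conn p q.
Proof. by move=> /conn_nil cp /conn_nil cq; apply: conn_trans cp (connC cq). Qed.

Lemma edge_over p d a b : olda p d = None -> suffix (d :: p) a -> edge s a b -> b != p ->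
  suffix (d :: p) b.
Proof.
move=> E da /and4P[_ _ ne /asboolP[q [yq /exc_through[o aE] /exc_through[o' bE]]]] bp.
have dq : suffix (d :: p) q.
  have [e [k [-> _]]] := ax_inv aE; case/suffixP: da => l ->; apply/suffixP.
  by exists (nseq k (nxt e) ++ e :: l); rewrite -catA.
by case: (ax_over dq bE) => // [bpE|]; [rewrite bpE eqxx in bp|rewrite E].
Qed.

Lemma path_over p d a ps : olda p d = None -> suffix (d :: p) a -> path (edge s) a ps ->
  p \notin ps -> suffix (d :: p) (last a ps).
Proof.
move=> E; elim: ps a => //= b ps IH a da /andP[ab P]; rewrite inE negb_or => /andP[pb np].
by apply: IH => //; apply: edge_over da ab _ => //; rewrite eq_sym.
Qed.

Lemma towards_free p d t p' : olda p d = None -> suffix (d :: p) p' -> towards s p t p' ->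
  suffix (d :: p) t.
Proof.
move=> E dp' [ps [/= /andP[_ P] /andP[+ _] <-]]; rewrite inE negb_or => /andP[_ np].
exact: path_over E dp' P np.
Qed.

Lemma index_suffix_lt l d p : l ++ d :: p \in s -> (index p s < index (l ++ d :: p) s)%N.
Proof.
move=> /(blowups_suffix bs)[ds le]; have [_ lt] := blowups_tail bs ds.
exact: leq_trans lt le.
Qed.

(** [path_axes] leads from p to a over [d :: p]. After shortening the path, the lengths of the
    centers show that its first step is the neighbour in the direction d. *)
Lemma towards_old p d a : p \in s -> olda p d = Some a ->
  exists2 p', towards s p a p' & exists q o, [/\ on_Y s q, ax o q = Some p', q = pt p d (ydepth s p d)
     & o = ~~ atinf d].
Proof.
move=> ps E; have aE := ax_pt p d 0; have bE := ax_opt0 p d; rewrite E in bE.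
have asz : (size a < size p)%N by have [o _ /ax_size] := olda_some E.
have [l P A] := path_axes (on_Y_or_center d ps) aE bE.
case: (shortenP P) (last_rcons p l a) => -[|p' l'] P' U sub /= la.
  by move: asz; rewrite la ltnn.
exists p'; first by exists l'.
have /andP[pp' _] := P'.
have p'l : p' \in rcons l a by apply: sub; rewrite mem_head.
case/and4P: pp' => _ _ ne /asboolP[q [yq /exc_through[o oE] /exc_through[o' oE']]].
have [_ [d2 qE oE2]] := ax_on_Y bs yq oE.
have o'E : o' = ~~ atinf d2.
  rewrite -oE2; case: (o' =P o) => [oo|]; last by case: o o' {oE oE' oE2} => -[].
  by move: oE'; rewrite oo oE => -[e]; rewrite e eqxx in ne.
suff dd : d2 = d by subst d2; exists q, o'; split.
move: oE'; rewrite o'E qE; case: (ydepth s p d2) => [|m].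
  rewrite ax_opt0 => E2; have p'sz : (size p' < size p)%N by have [? _ /ax_size] := olda_some E2.
  move: p'l; rewrite mem_rcons inE => /orP[/eqP p'a|/(allP A)].
    by subst p'; apply: olda_inj E2 E.
  by move=> dp'; exfalso; move: dp'; apply/negP; apply: suffix_nsize; apply: leqW.
rewrite ax_optS => -[p'E].
move: p'l; rewrite mem_rcons inE => /orP[/eqP p'a|/(allP A) dp'].
  by move: asz; rewrite -p'a -p'E size_pt ltnNge (leq_trans (leqnSn _) (leq_addl _ _)).
have := suffix_pt p d2 m; rewrite p'E => /suffix_size_eq/(_ dp' erefl).
by case.
Qed.

End Graph.

(** * Orders of curvettes and propagation of the minimal ratio *)

Lemma unit_neq0 (w : germ) : w \is a GRing.unit -> w != 0.
Proof. by apply: contraTneq => ->; rewrite unitr0. Qed.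

Lemma dord_unit d (w : germ) : w \is a GRing.unit -> mult w = 0%N /\ dord d w = 0%N.
Proof.
move=> wu; apply: orb_mult; apply/lexlow00.
by rewrite -germ_unitE ori_unit blow_unit.
Qed.

Lemma dord_axis d o : mult (axis o : germ) = 1%N /\ dord d (axis o) = (d == adir o).
Proof.
have lw (w : germ) b : w \is a GRing.unit -> lexlow (ori b w) 0 0.
  by move=> wu; apply/lexlow00; rewrite -germ_unitE ori_unit.
apply: orb_mult; case: eqP => [->|/eqP ne].
  rewrite blow_axis_adir atinf_adir rmorphM /= ori_axis -{2}[o]negbK ori_axisN.
  exact: (lexlowM (lexlow_v R) (lexlow_u R)).
have [w wu ->] := blow_axis_free ne; rewrite rmorphM /= ori_axis.
by have := lexlowM (lw w (atinf d) wu) (lexlow_u R).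
Qed.

Lemma multX G n : G != 0 -> mult (G ^+ n) = (n * mult G)%N.
Proof.
move=> G0; elim: n => [|n IH]; last by rewrite exprS multM ?expf_neq0 // IH mulSn.
by rewrite expr0 mul0n; have [] := dord_unit None (unitr1 germ).
Qed.

Lemma dordX d G n : G != 0 -> dord d (G ^+ n) = (n * dord d G)%N.
Proof.
move=> G0; elim: n => [|n IH]; last by rewrite exprS dordM ?expf_neq0 // IH mulSn.
by rewrite expr0 mul0n; have [] := dord_unit d (unitr1 germ).
Qed.

Lemma dord_axes d o (w : germ) i j : w \is a GRing.unit ->
  let G := w * axis o ^+ i * axis (~~ o) ^+ j in
  [/\ G != 0, mult G = (i + j)%N &
      dord d G = (i * (d == adir o) + j * (d == adir (~~ o)))%N].
Proof.
move=> wu; have w0 := unit_neq0 wu; have a1 := axis_neq0 R o; have a2 := axis_neq0 R (~~ o).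
have [mw dw] := dord_unit d wu.
have [m1 d1] := dord_axis d o; have [m2 d2] := dord_axis d (~~ o).
split; first by rewrite !mulf_neq0 ?expf_neq0.
  by rewrite !multM ?mulf_neq0 ?expf_neq0 // !multX // mw m1 m2 !muln1.
by rewrite !dordM ?mulf_neq0 ?expf_neq0 // !dordX // dw d1 d2.
Qed.

Lemma curvette_orders p d H M h y : H != 0 ->
    (exists2 w, w \is a GRing.unit & M = w * axis (tor (tdat p)) ^+ xplus (tdat p)
                                           * axis (~~ tor (tdat p)) ^+ xminus (tdat p)) ->
    pull p H = M * h -> mult h = 1%N -> transversal (ori (atinf d) y) ->
    (exists2 w, w \is a GRing.unit & blow d h = w * axis (atinf d) * y) ->
  mult (pull p H) = nval (tdat p) /\ forall d', dord d' (pull p H) =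
    ((d' == d) + xplus (tdat p) * (d' == adir (tor (tdat p))) +
     xminus (tdat p) * (d' == adir (~~ tor (tdat p))))%N.
Proof.
move=> H0 [w wu ME] pH mh ty [w' w'u bh].
have h0 : h != 0 by apply: contraTneq (pull_neq0 p H0) => h0; rewrite pH h0 mulr0 eqxx.
have dh : dord d h = 1%N.
  have lw := lexlow_unit (atinf d) w'u.
  suff /orb_mult[_ ->] : lexlow (ori (atinf d) (blow d h)) 1 1 by [].
  rewrite bh !rmorphM /= ori_axis.
  by have := lexlowM (lexlowM lw (lexlow_u R)) ty.
have dh' d' : dord d' h = (d' == d).
  by case: (eqVneq d' d) => [->|ne] //; apply: (dord_pure h0 _ ne); rewrite dh mh.
split=> [|d']; rewrite pH ME.
  have [M0 mM _] := dord_axes d (tor (tdat p)) (xplus (tdat p)) (xminus (tdat p)) wu.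
  by rewrite multM // mM mh nvalE.
have [M0 _ dM] := dord_axes d' (tor (tdat p)) (xplus (tdat p)) (xminus (tdat p)) wu.
by rewrite dordM // dM dh' addnC addnA.
Qed.

Lemma fresh_direction (ds : seq (direction R)) : exists2 c : R[i], c != 0 & Some c \notin ds.
Proof.
have [M M0 HM] : exists2 M : R[i], 0 <= M & forall c, Some c \in ds -> `|c| <= M.
  elim: ds => [|d ds [M M0 HM]]; first by exists 0.
  case: d => [c|]; last by exists M => // c; rewrite inE => /HM.
  exists (`|c| + M) => [|c']; first by rewrite addr_ge0.
  rewrite inE => /orP[/eqP[->]|/HM le]; first by rewrite lerDl.
  by apply: le_trans le _; rewrite lerDr.
exists (M + 1); first by rewrite gt_eqF // ltr_wpDl.
apply/negP => /HM; rewrite ger0_norm ?addr_ge0 //.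
by rewrite gerDl ler10.
Qed.

Variables (f : germ) (s : seq infpoint).
Hypotheses (f0 : f != 0) (f00 : f 0%N 0%N = 0) (hs : minimal_log_resolution f s).

Let bs : blowups s. Proof. by have [[]] := hs. Qed.

Lemma fresh_free G p (ds : seq (direction R)) : G != 0 -> exists d,
  [/\ olda p d = None, d \notin ds, d :: p \notin s & dord d (pull p G) = 0%N].
Proof.
move=> G0; have [r rE] := sum_dord (pull_neq0 p G0).
have [c c0] := fresh_direction (ds ++ r ++ [seq head None q | q <- s]).
rewrite !mem_cat !negb_or => /and3P[cds cr cs]; exists (Some c); split=> //.
- by rewrite /= (negPf c0).
- by apply: contraNN cs => cs; apply/mapP; exists (Some c :: p).
- have u := undup_uniq r; have su : {subset r <= undup r} by move=> e; rewrite mem_undup.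
  have := @sum_dord_le _ (pull p G) (Some c :: undup r) (pull_neq0 p G0).
  rewrite /= mem_undup cr u big_cons rE // => /(_ isT); lia.
Qed.

(** The strict transform of [H] meets, among the exceptional divisors, that of [p] only, at
    a point of direction [d]. *)
Definition general_curvette p d H : Prop :=
  [/\ H != 0, H 0%N 0%N = 0, olda p d = None, d :: p \notin s &
  [/\ mult (pull p H) = nval (tdat p),
    (forall d', dord d' (pull p H) =
    ((d' == d) + xplus (tdat p) * (d' == adir (tor (tdat p))) +
     xminus (tdat p) * (d' == adir (~~ tor (tdat p))))%N) &
    forall q2, ~~ suffix (d :: p) q2 -> ~~ suffix q2 (d :: p) -> excmono q2 (pull q2 H)]].

Lemma general_curvette_ex p : exists d H, general_curvette p d H.
Proof.
have [d [od _ ds _]] := fresh_free p [::] f0.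
have ty := transversal_axisN R (atinf d).
have [H H0 [M [h [[ME eM pH mh] [bh bd dH iH]]]]] := curvette_germ od ty.
have [mH dH'] := curvette_orders H0 ME pH mh ty bh.
exists d, H; split=> //.
apply/eqP/negPn/negP => nz; have /(mult_unit) : pull p H \is a GRing.unit.
  by rewrite germ_unitE pull00.
by rewrite mH nvalE addn1.
Qed.

Section Propagation.
Variables (p : infpoint) (d0 : direction R) (H : germ).
Hypotheses (ps : p \in s) (gH : general_curvette p d0 H).

Let N q := mult (pull q f).
Let n q := mult (pull q H).

Lemma curvette_clean q k : on_Y s q -> (exists o, ax o q = Some k) -> k <> p ->
  excmono q (pull q H).
Proof.
move=> yq [o aE] kp; have [H0 H00 od dns [_ _ iH]] := gH.
have y0 : on_Y s (d0 :: p) by split.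
have ne : q <> d0 :: p.
  move=> qE; apply: kp; move: aE; rewrite qE; have [e1 e2] := ax_cons_free od.
  case: (o =P atinf d0) => [->|oN]; first by rewrite e1 => -[].
  have -> : o = ~~ atinf d0 by case: o (atinf d0) oN => -[].
  by rewrite e2.
apply: iH; apply/negP => /suffixP[l e].
  by case: l e => [//|d l] e; case: dns; move: yq; rewrite e => /(on_Y_suffix bs)->.
case: l e => [e|d l e]; first by apply: ne.
by have [/negP[]] := yq; move: y0; rewrite e => /(on_Y_suffix bs)->.
Qed.

Lemma propagation (A B : nat) k : (0 < A)%N ->
    (forall k', k' \in s -> (B * n k' <= A * N k')%N) -> k \in s -> k <> p ->
    (B * n k = A * N k)%N ->
  forall d, hasdiv f k d -> exists2 k', ddiv f s k d = Exc k' & (B * n k' = A * N k')%N.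
Proof.
move=> A0 le ks kp ke; have [H0 H00 od dns _] := gH.
pose F := pull k f; pose G := pull k H.
have F0 : F != 0 by apply: pull_neq0.
have G0 : G != 0 by apply: pull_neq0.
(* Over a direction with an exceptional component a, the inequality is that at a minus [ydepth]
   times the equality at k; elsewhere the curvette has order 0. *)
have loc d : (B * dord d G <= A * dord d F)%N /\ (forall a,
    ax (~~ atinf d) (pt k d (ydepth s k d)) = Some a ->
    (B * dord d G = A * dord d F)%N -> (B * n a = A * N a)%N) /\
    (ax (~~ atinf d) (pt k d (ydepth s k d)) = None -> dord d G = 0%N).
  have yq := on_Y_pt bs d ks; have aE := ax_pt k d (ydepth s k d).
  have [i [j [mG zi zj]]] := curvette_clean yq (ex_intro _ _ aE) kp.
  case E: (ax _ _) => [a|].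
    have as_ : a \in s by apply: (ax_mem bs (or_introl yq) E).
    have [i' [j' mF]] : exists i j, mono (pull (pt k d (ydepth s k d)) f) i j.
      move: aE E; case: (atinf d) => aE E.
        exact: (double_point f0 f00 hs yq E aE).
      exact: (double_point f0 f00 hs yq aE E).
    have eF : N a = (dord d F + ydepth s k d * N k)%N.
      by rewrite /N -vord_exc // (mono_vord_pt f0 mF E).
    have eG : n a = (dord d G + ydepth s k d * n k)%N.
      by rewrite /n -vord_exc // (mono_vord_pt H0 mG E).
    have e : (B * (ydepth s k d * n k) = A * (ydepth s k d * N k))%N.
      by rewrite !mulnA ![(_ * ydepth _ _ _)%N]mulnC -!mulnA ke.
    split; first by have := le _ as_; rewrite eF eG !mulnDr e leq_add2r.
    by split=> // a' [<-] ee; rewrite eF eG !mulnDr e ee.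
  have [m0 _ _ _] := free_point f0 f00 hs ks E.
  rewrite m0 in aE E mG zi zj.
  have := lexlow_uniq (mono_ori (atinf d) mG) (lexlow_pt k d 0 H0).
  rewrite mul0n addn0 -/G => -[_ <-].
  have -> : (if atinf d then i else j) = 0%N.
    by move: E; case: (atinf d) => /= E; [apply: zi|apply: zj].
  by rewrite muln0.
have [r1 r1E] := sum_dord F0; have [r2 r2E] := sum_dord G0.
(* Both multiplicities are sums over one list containing all tangent directions, so equality of the
   sums makes every term an equality. *)
have tight d : (B * dord d G = A * dord d F)%N.
  pose ds := undup (d :: r1 ++ r2).
  have s1 : (\sum_(e <- ds) dord e F)%N = N k.
    by apply: r1E (undup_uniq _) _ => e er; rewrite mem_undup inE mem_cat er orbT.
  have s2 : (\sum_(e <- ds) dord e G)%N = n k.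
    by apply: r2E (undup_uniq _) _ => e er; rewrite mem_undup inE mem_cat er !orbT.
  have : (\sum_(e <- ds) (A * dord e F - B * dord e G))%N = 0%N.
    rewrite sumnB; last by move=> e _; have [] := loc e.
    by rewrite -!big_distrr /= s1 s2 ke subnn.
  move/eqP; rewrite sum_nat_seq_eq0 => /allP/(_ d); rewrite mem_undup mem_head => /(_ isT) /=.
  by rewrite subn_eq0 => le'; apply/eqP; rewrite eqn_leq le' andbT; have [] := loc d.
move=> d hd; have [_ [h1 h2]] := loc d; rewrite /ddiv.
case E: (ax _ _) h1 h2 => [a|] h1 h2; first by exists a => //; apply: h1.
have [_ odk _ _] := free_point f0 f00 hs ks E.
exfalso; have c0 : (0 < dord d F)%N by case: hd; rewrite ?odk.
by have := tight d; rewrite h2 // muln0 => /esym/eqP; rewrite muln_eq0 !eqn0Ngt A0 c0.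
Qed.

Lemma n_gt0 k : (0 < n k)%N.
Proof. by have [H0 H00 _ _ _] := gH; apply: mult_pull_gt0. Qed.

Lemma min_ratio : exists2 k, k \in s & forall k', k' \in s -> (N k * n k' <= n k * N k')%N.
Proof.
have mr : forall l : seq infpoint, l != [::] ->
    exists2 k, k \in l & forall k', k' \in l -> (N k * n k' <= n k * N k')%N.
  elim=> // a l IH _; case: (eqVneq l [::]) => [->|/IH[k kl km]].
    by exists a; rewrite ?mem_head // => k'; rewrite inE => /eqP ->; rewrite mulnC.
  have nk := n_gt0 k; have na := n_gt0 a.
  case: (leqP (N k * n a) (n k * N a)) => c.
    by exists k; rewrite ?inE ?kl ?orbT // => k'; rewrite inE => /orP[/eqP ->|/km].
  exists a; rewrite ?mem_head // => k'; rewrite inE => /orP[/eqP ->|/km h]; first by rewrite mulnC.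
  rewrite -(leq_pmul2l nk); apply: (@leq_trans (n a * (N k * n k'))%N); last first.
    by rewrite [leqRHS]mulnCA leq_mul2l h orbT.
  by rewrite !mulnA [(n a * _)%N]mulnC leq_mul2r (ltnW c) orbT.
by apply: mr; apply: contraTneq ps => ->.
Qed.

Lemma edge_ddiv k k' : edge s k k' -> exists2 d, hasdiv f k d & ddiv f s k d = Exc k'.
Proof.
move=> /and4P[ks k's ne /asboolP m].
have [|d hd dE] := (adjacentP f0 f00 hs (Exc k') ks).1; last by exists d.
by split=> //; case=> e; rewrite e eqxx in ne.
Qed.

Lemma ratio_min k : k \in s -> (N p * n k <= n p * N k)%N.
Proof.
have [k0 k0s kmin] := min_ratio; have A0 := n_gt0 k0.
suff e : (N k0 * n p = n k0 * N p)%N.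
  move=> /kmin h; rewrite -(leq_pmul2l A0).
  have -> : (n k0 * (N p * n k) = n p * (N k0 * n k))%N by rewrite mulnA -e; ring.
  by rewrite [leqRHS]mulnCA leq_mul2l h orbT.
have [l P le] := connP bs k0s ps.
have step l' k1 : path (edge s) k1 l' -> last k1 l' = p -> k1 \in s ->
    (N k0 * n k1 = n k0 * N k1)%N -> (N k0 * n p = n k0 * N p)%N.
  elim: l' k1 => [|k2 l' IH] k1 /=; first by move=> _ ->.
  case: (eqVneq k1 p) => [->|/eqP kp] // /andP[e12 P'] le' k1s e1.
  have k2s : k2 \in s by have /and4P[] := e12.
  have [d hd dE] := edge_ddiv e12.
  have [k' kE e2] := propagation A0 kmin k1s kp e1 hd.
  by apply: IH P' le' k2s _; move: kE e2; rewrite dE => -[->].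
by apply: (step l k0) => //; rewrite mulnC.
Qed.

Lemma curvette_no_arrowheads d p' : d <> d0 -> ddiv f s p d = Exc p' ->
    (dord d (pull p f) * n p = dord d (pull p H) * N p)%N -> no_arrowheads f s p p'.
Proof.
move=> dd0 dE X; have [H0 H00 od dns [_ _ iH]] := gH; have A0 := n_gt0 p.
have yq := on_Y_pt bs d ps; have aE := ax_pt p d (ydepth s p d).
have sq : suffix (d :: p) (pt p d (ydepth s p d)) by apply: suffix_pt.
have ne q : suffix (d :: p) q -> suffix (d0 :: p) q -> False.
  by move=> h1 h2; apply: dd0; have := suffix_size_eq h1 h2 erefl => -[].
have [||i [j [mG _ _]]] := iH (pt p d (ydepth s p d)).
- by apply/negP => /(ne _ sq).
- by apply/negP => h; apply: (ne _ (suffix_trans sq h) (suffix_refl _)).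
move: dE; rewrite /ddiv; case E: (ax _ _) => [a|] // -[aE']; subst a.
have p's : p' \in s by apply: (ax_mem bs (or_introl yq) E).
have [i' [j' mF]] : exists i j, mono (pull (pt p d (ydepth s p d)) f) i j.
  by move: aE E; case: (atinf d) => aE E;
    [apply: (double_point f0 f00 hs yq E aE)|apply: (double_point f0 f00 hs yq aE E)].
(* The [ydepth] terms of n and N at p' are proportional to n and N at p, so equality in the
   direction d is equality of the ratios at p and p'. *)
have e' : (N p * n p' = n p * N p')%N.
  rewrite /N /n -!(@vord_exc _ p') // (mono_vord_pt f0 mF E) (mono_vord_pt H0 mG E).
  rewrite -/(N p) -/(n p) !mulnDr -[(N p * dord _ _)%N]mulnC -X; ring.
move=> l P np q J cJ mt.
have [ks [kp ke]] : last p' l \in s /\ last p' l <> p /\ (N p * n (last p' l) = n p * N (last p' l))%N.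
  elim: l (p') p's e' P np {mt} => [|k2 l IH] k1 k1s e1 /=.
    by rewrite inE => _ /eqP kp; split=> //; split=> // kp'; case: kp.
  move=> /andP[e12 P]; rewrite inE negb_or => /andP[/eqP pk1 np].
  have [d1 hd1 dE1] := edge_ddiv e12.
  have [|k' kE e2] := propagation A0 ratio_min k1s _ e1 hd1; first by move=> e; case: pk1.
  by apply: IH => //; [have /and4P[] := e12|move: kE e2; rewrite dE1 => -[->]].
have [|d1 hd1 dE1] := (adjacentP f0 f00 hs (Str q J) ks).1; first by [].
by have [k'] := propagation A0 ratio_min ks kp ke hd1; rewrite -dE1.
Qed.

End Propagation.

(** The order of a curvette of [p] along an older direction. *)
Definition dweight p d : nat :=
  (xplus (tdat p) * (d == adir (tor (tdat p))) + xminus (tdat p) * (d == adir (~~ tor (tdat p))))%N.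

Lemma no_arrowheadsP p d p' : p \in s -> olda p d <> None -> ddiv f s p d = Exc p' ->
    (dord d (pull p f) * nval (tdat p) = dweight p d * mult (pull p f))%N ->
  no_arrowheads f s p p'.
Proof.
move=> ps od dE X; have [d0 [H gH]] := general_curvette_ex p.
have [H0 H00 od0 _ [mH dH _]] := gH.
have ne : d <> d0 by move=> e; apply: od; rewrite e.
apply: (curvette_no_arrowheads ps gH ne dE); rewrite mH dH X /dweight.
by have /eqP/negPf-> := ne.
Qed.

(** * Germs with prescribed orders that are monomial at the neighbours *)

Lemma mono_pull l q G i j : mono (pull q G) i j -> exists i' j', mono (pull (l ++ q) G) i' j'.
Proof.
move=> m0; elim: l => [|d l [i' [j' m]]]; first by exists i, j.
case: d => [c|]; first by do 2!eexists; apply: mono_blow_fin m.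
by do 2!eexists; apply: mono_blow_inf m.
Qed.

Lemma transversal_principal o y y' : transversal (ori o y) -> transversal (ori o y') ->
  principal y = principal y' -> exists2 t, t \is a GRing.unit & y' = t * y.
Proof.
move=> ty ty' e; have [t tE] : divides y y'.
  by rewrite -[divides _ _]/(principal y y') e; exists 1; rewrite mulr1.
exists t; last by rewrite mulrC.
have [_ _ /(_ (ori o y) (ori o t))] := transversal_irreducible ty'.
rewrite tE rmorphM !ori_unit => /(_ erefl)[] // yu.
by have := transversal_nunit ty; rewrite ori_unit yu.
Qed.

Lemma cleanM p d G H : p \in s -> clean f s p d G -> clean f s p d H -> clean f s p d (G * H).
Proof.
move=> ps; rewrite /clean; case E: (ax _ _) => [a|].
  by move=> [i [j m]] [i' [j' m']]; do 2!eexists; rewrite pullM; apply: monoM m m'.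
move=> [w [i [y [a [wu ty cy gE]]]]] [w' [i' [y' [a' [wu' ty' cy' gE']]]]].
have [m0 od yq [w0 [i0 [z [wu0 tz fE]]]]] := free_point f0 f00 hs ps E.
have [_ e] := (free_point_str (principal y) yq od wu0 tz fE).1 cy.
have [_ e'] := (free_point_str (principal y') yq od wu0 tz fE).1 cy'.
have [t tu tE] := transversal_principal ty ty' (etrans e (esym e')).
exists (w * w' * t ^+ a'), (i + i')%N, y, (a + a')%N; split=> //.
  by rewrite !unitrM wu wu' unitrX.
by rewrite pullM gE gE' tE exprMn !exprD; ring.
Qed.

Lemma clean_excmono p d G : p \in s -> hasdiv f p d -> excmono (d :: p) (pull (d :: p) G) ->
  clean f s p d G.
Proof.
move=> ps hd [i [j [mG z1 z2]]]; rewrite /clean; case E: (ax _ _) => [a|].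
  exact: mono_pull mG.
have [m0 od yq [w [i0 [y [wu ty fE]]]]] := free_point f0 f00 hs ps E.
have c0 : (0 < dord d (pull p f))%N by case: hd; rewrite ?od.
have [w' wu' GE] := mG; have [_ aN] := ax_cons_free od.
exists w', (if atinf d then j else i), y, 0%N; split=> //.
  by apply/(free_point_str _ yq od wu ty fE).
rewrite GE expr0 mulr1; move: aN z1 z2; case: (atinf d) => /= e z1 z2.
  by rewrite z1 // expr0 mulr1.
by rewrite z2 // expr0 mulr1.
Qed.

Lemma clean1 p d : p \in s -> hasdiv f p d -> clean f s p d 1.
Proof.
by move=> ps hd; apply: clean_excmono => //; apply: excmono_unit; rewrite rmorph1 unitr1.
Qed.

Lemma cleanX p d G n : p \in s -> hasdiv f p d -> clean f s p d G -> clean f s p d (G ^+ n).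
Proof.
move=> ps hd cG; elim: n => [|n IH]; first by rewrite expr0; apply: clean1.
by rewrite exprS; apply: cleanM.
Qed.

(** Where the component is a strict transform, a curvette is monomial only if it follows that
    component, so y is the equation of the latter. Where [d :: p] is blown up, further charts keep
    any monomial in the axes monomial. *)
Lemma free_section p d : p \in s -> hasdiv f p d -> olda p d = None ->
  exists2 y, transversal (ori (atinf d) y) & forall G w i,
    w \is a GRing.unit -> pull (d :: p) G = w * axis (atinf d) ^+ i * y -> clean f s p d G.
Proof.
move=> ps hd od; case E: (ax (~~ atinf d) (pt p d (ydepth s p d))) => [a|].
  exists (axis (~~ atinf d)); first exact: transversal_axisN.
  move=> G w i wu GE; rewrite /clean E.
  have := monoM (monoM (mono_unit wu) (monoX i (mono_axis R (atinf d)))) (mono_axis R (~~ atinf d)).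
  rewrite -GE; exact: mono_pull.
have [m0 _ yq [w [i0 [y [wu ty fE]]]]] := free_point f0 f00 hs ps E.
have c0 : (0 < dord d (pull p f))%N by case: hd; rewrite ?od.
exists y => // G w' i wu' GE; rewrite /clean E; exists w', i, y, 1%N; split=> //.
by apply/(free_point_str _ yq od wu ty fE).
Qed.

Lemma clean_curvette p d : p \in s -> olda p d = None -> exists2 H, H != 0 &
  [/\ mult (pull p H) = nval (tdat p),
     forall d', dord d' (pull p H) = ((d' == d) + dweight p d')%N &
     forall d', hasdiv f p d' -> clean f s p d' H].
Proof.
move=> ps od; have [y ty yc] : exists2 y, transversal (ori (atinf d) y) &
    (hasdiv f p d -> forall G w i, w \is a GRing.unit ->
      pull (d :: p) G = w * axis (atinf d) ^+ i * y -> clean f s p d G).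
  case: (pselect (hasdiv f p d)) => [hd|nd].
    by have [y ty yc] := free_section ps hd od; exists y.
  by exists (axis (~~ atinf d)) => //; apply: transversal_axisN.
have [H H0 [M [h [[ME eM pH mh] [bh bd dH iH]]]]] := curvette_germ od ty.
have [mH dH'] := curvette_orders H0 ME pH mh ty bh.
exists H => //; split=> // [d'|d' hd]; first by rewrite dH' /dweight addnA.
have eM' : excmono (d' :: p) (blow d' M) by apply: excmono_blow.
case: (eqVneq d' d) => [dE|ne]; last first.
  apply: clean_excmono => //=; rewrite pH blowM; apply: excmonoM => //.
  have [w wu ->] := bd _ ne; apply: excmonoM; first exact: excmono_unit.
  rewrite -[axis _]expr1; apply: excmono_axis; by rewrite (ax_pt p d' 0).
have [w wu bE] := bh; have [i [j [[w' wu' ME'] z1 z2]]] := eM'; rewrite dE in ME' z1 z2 hd *.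
apply: (yc hd H (w' * w) (if atinf d then j else i).+1); first by rewrite unitrM wu' wu.
have [_ aN] := ax_cons_free od.
rewrite /= pH blowM bE ME'; move: aN z1 z2; case: (atinf d) => /= e z1 z2.
  by rewrite z1 // expr0 exprS; ring.
by rewrite z2 // expr0 exprS; ring.
Qed.

Lemma curvette_product p (r : seq (direction R)) (a : direction R -> nat) : p \in s -> uniq r ->
    (forall d, d \in r -> olda p d = None) ->
  exists2 H, H != 0 & let S := (\sum_(d <- r) a d)%N in
  [/\ mult (pull p H) = (S * nval (tdat p))%N,
     forall d, dord d (pull p H) = ((if d \in r then a d else 0) + S * dweight p d)%N &
     forall d, hasdiv f p d -> clean f s p d H].
Proof.
move=> ps; elim: r => [|e r IH] /=.
  move=> _ _; exists 1; first exact: oner_neq0.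
  rewrite big_nil; split=> [|d|d hd]; last exact: clean1.
    by rewrite rmorph1; have [-> _] := dord_unit None (unitr1 germ).
  by rewrite rmorph1; have [_ ->] := dord_unit d (unitr1 germ).
move=> /andP[er ur] fr; have [|G G0 [mG dG cG]] := IH ur.
  by move=> d dr; apply: fr; rewrite inE dr orbT.
have [|H H0 [mH dH cH]] := @clean_curvette p e ps; first by apply: fr; rewrite mem_head.
have HX0 : H ^+ a e != 0 by rewrite expf_neq0.
exists (H ^+ a e * G); first by rewrite mulf_neq0.
have pX : pull p (H ^+ a e) != 0 by apply: pull_neq0.
have pG := pull_neq0 p G0; have pH := pull_neq0 p H0.
rewrite big_cons; split=> [|d|d hd]; last by apply: cleanM (cG d hd) => //; apply: cleanX (cH d hd).
  by rewrite pullM multM // mG pullX multX // mH mulnDl.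
rewrite pullM dordM // dG pullX dordX // dH inE.
have -> : ((if (d == e) || (d \in r) then a d else 0) =
    a e * (d == e) + (if d \in r then a d else 0))%N.
  by case: eqP => [->|_] /=; rewrite ?(negPf er) ?muln1 ?addn0 // muln0.
by rewrite !mulnDr !mulnDl; ring.
Qed.

Lemma realize p w T (r : seq (direction R)) (a : direction R -> nat) (ar : nat) :
    p \in s -> uniq r -> (forall d, d \in r -> olda p d = None) ->
    let D := tdat p in tG D w -> (ax (tor D) p = None -> tm1 D w T = 0%N) ->
    (ax (~~ tor D) p = None -> tm2 D w T = 0%N) ->
  exists2 g, g != 0 & let S := (\sum_(d <- r) a d + ar)%N in
    let a1 := (tm1 D w T + S * xplus D)%N in let a2 := (tm2 D w T + S * xminus D)%N in
    mult (pull p g) = (a1 + a2 + S)%N /\ forall d, hasdiv f p d -> clean f s p d g /\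
      dord d (pull p g) = (a1 * (d == adir (tor D)) + a2 * (d == adir (~~ tor D)) +
        (if d \in r then a d else 0))%N.
Proof.
move=> ps ur fr D Gw z1 z2; have ty := transversal_axisN R (tor D).
have [g g0 [t tu gE]] := @realizesP R p _ w T (fun=> erefl) ty Gw.
(* The ar leftover curvettes go in a direction without component of F_pi, where no residue number is
   counted. *)
have [c [oc cr _ dc]] := fresh_free p r f0.
have [||H H0 [mH dH cH]] := @curvette_product p (c :: r) (fun d => if d == c then ar else a d) ps.
- by rewrite /= cr ur.
- by move=> d; rewrite inE => /orP[/eqP ->|/fr].
have SE : (\sum_(d <- c :: r) (if d == c then ar else a d) = \sum_(d <- r) a d + ar)%N.
  rewrite big_cons eqxx addnC; congr addn; apply: eq_big_seq => d dr.
  by case: eqP cr => // <-; rewrite dr.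
rewrite SE in mH dH.
have pg := pull_neq0 p g0; have pH := pull_neq0 p H0.
exists (g * H); first by rewrite mulf_neq0.
split=> [|d hd].
  have [_ mg _] := dord_axes None (tor D) (tm1 D w T) (tm2 D w T) tu.
  by rewrite pullM multM // mH gE mg nvalE -/D; lia.
split.
  apply: cleanM (cH d hd) => //; apply: clean_excmono => //=; rewrite gE.
  apply: excmono_blow; apply: excmonoM; last exact: excmono_axis.
  by apply: excmonoM; [apply: excmono_unit|apply: excmono_axis].
have [_ _ dg] := dord_axes d (tor D) (tm1 D w T) (tm2 D w T) tu.
rewrite pullM dordM // dH gE dg inE; have -> : (d == c) = false.
  apply/eqP => dE; case: hd; rewrite dE ?oc ?dc //.
by rewrite /dweight -/D /= !mulnDr !mulnDl; ring.
Qed.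

(** * Older directions and the assembled form *)

Definition olds p : seq (direction R) :=
  [seq d <- [:: adir (tor (tdat p)); adir (~~ tor (tdat p))] | olda p d != None].

Lemma mem_olds p d : (d \in olds p) = (olda p d != None).
Proof.
rewrite mem_filter andb_idr //; case E: (olda p d) => [a|] // _.
have [o -> _] := olda_some E; rewrite !inE.
by case: o (tor _) => -[]; rewrite eqxx ?orbT.
Qed.

Lemma uniq_olds p : uniq (olds p).
Proof. by apply: filter_uniq; rewrite /= inE adir_neq. Qed.

Lemma olds_satellite p : size (olds p) = 2%N -> satellite p.
Proof.
rewrite /olds /= !olda_adir; case E1: (ax _ p) => [a|]; case E2: (ax _ p) => [b|] // _.
by move: E1 E2; case: (tor _) => /= E1 E2; [exists b, a|exists a, b];
  rewrite [axes p]surjective_pairing E1 E2.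
Qed.

Lemma dweight_plus p : dweight p (adir (tor (tdat p))) = xplus (tdat p).
Proof. by rewrite /dweight eqxx (negPf (adir_neq R _)) muln0 addn0 muln1. Qed.

Lemma dweight_minus p : dweight p (adir (~~ tor (tdat p))) = xminus (tdat p).
Proof. by rewrite /dweight eqxx eq_sym (negPf (adir_neq R _)) muln0 muln1. Qed.

(** By [toric_support] each extreme monomial of the leading form comes from a pair (w, T) of natural
    numbers; the first difference is [tal * w], the second [tP * T]. *)
Lemma old_dord_ge p G : G != 0 ->
  (xplus (tdat p) * mult (pull p G) <=
     dord (adir (tor (tdat p))) (pull p G) * nval (tdat p))%N /\
  (xminus (tdat p) * mult (pull p G) <=
     dord (adir (~~ tor (tdat p))) (pull p G) * nval (tdat p))%N.
Proof.
move=> G0; set D := tdat p; set o := tor D; have det := tdat_det p; rewrite -/D in det.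
have [e1 n1 n2] := ext_plus o (pull_neq0 p G0).
have [e2 _ _] := ext_plus (~~ o) (pull_neq0 p G0).
have min i j : (i + j = mult (pull p G))%N -> forall i' j',
    (ori o (pull p G)) i' j' != 0 -> (1 * i + 1 * j <= 1 * i' + 1 * j')%N.
  by move=> e i' j' /mult_ori_le; rewrite !mul1n e.
have tsP i j := @toric_supportP R p G 1 1 i j G0 isT isT.
have [w [T [_ w1 w2]]] := tsP _ _ n1 (min _ _ (subnKC e1)).
have [w' [T' [_ w1' w2']]] := tsP _ _ n2 (min _ _ (subnK e2)).
have NE : mult (pull p G) = (tm1 D w T + tm2 D w T)%N by rewrite -w2 -w1 subnKC.
have NE' : mult (pull p G) = (tm1 D w' T' + tm2 D w' T')%N by rewrite -w2' -w1' subnK.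
have tmD i j : (tm1 D i j + tm2 D i j = tal D * i + tP D * j)%N.
  by rewrite /tm1 /tm2 /tP /tal /tbe; ring.
have x1 : (ta1 D * tP D = (ta1 D * tn D + tb1 D) * tal D + 1)%N.
  by rewrite /tP /tal /tbe !mulnDr !mulnDl det; ring.
have x2 : ((ta2 D * tn D + tb2 D) * tal D = ta2 D * tP D + 1)%N.
  by rewrite /tP /tal /tbe !mulnDr !mulnDl [(tb2 D * ta1 D)%N]mulnC det; ring.
split.
  rewrite w1 NE tmD /xplus /nval.
  have -> : (tm1 D w T * (tal D * tP D) = tal D * (w * (ta1 D * tP D) +
    T * (ta1 D * tn D + tb1 D) * tP D))%N by rewrite /tm1; ring.
  by rewrite x1 -mulnA leq_mul2l; apply/orP; right; apply: leq_trans (leq_addr w _) (eq_leq _); ring.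
rewrite w2' NE' tmD /xminus /nval.
have -> : (tm2 D w' T' * (tal D * tP D) = (ta2 D * tal D * w' +
  T' * ((ta2 D * tn D + tb2 D) * tal D)) * tP D)%N by rewrite /tm2; ring.
rewrite x2 mulnAC leq_mul2r; apply/orP; right.
by apply: leq_trans (leq_addr T' _) (eq_leq _); ring.
Qed.

Lemma free_dirs p G : G != 0 -> exists r : seq (direction R), [/\ uniq r,
  forall d, (d \in r) = (olda p d == None) && (0 < dord d (pull p G))%N &
  mult (pull p G) = (\sum_(d <- olds p) dord d (pull p G) + \sum_(d <- r) dord d (pull p G))%N].
Proof.
move=> G0; have [r0 r0E] := sum_dord (pull_neq0 p G0).
pose L := undup (olds p ++ r0).
have LE : (\sum_(d <- L) dord d (pull p G))%N = mult (pull p G).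
  by apply: r0E (undup_uniq _) _ => d dr; rewrite mem_undup mem_cat dr orbT.
have out d : d \notin L -> dord d (pull p G) = 0%N.
  move=> dL; have := @sum_dord_le _ (pull p G) (d :: L) (pull_neq0 p G0).
  rewrite /= dL undup_uniq big_cons LE => /(_ isT); lia.
exists [seq d <- L | (olda p d == None) && (0 < dord d (pull p G))%N]; split.
- by rewrite filter_uniq ?undup_uniq.
- move=> d; rewrite mem_filter andb_idr // => /andP[_ c0].
  by apply/negPn/negP => /out e; rewrite e in c0.
rewrite -LE (bigID (fun d => olda p d == None)) /= addnC; congr addn.
  rewrite -big_filter; apply: perm_big; apply: uniq_perm; rewrite ?uniq_olds ?(filter_uniq _ (undup_uniq _)) //.
  by move=> d; rewrite mem_filter mem_olds mem_undup mem_cat mem_olds; case: (olda p d).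
rewrite big_filter [RHS]big_mkcondr; apply: eq_bigr => d _.
by case: posnP.
Qed.

Definition free_dirs_of p (r : seq (direction R)) : Prop := uniq r /\
  forall d, (d \in r) = (olda p d == None) && (0 < dord d (pull p f))%N.

Lemma hasdiv_mem p r d : free_dirs_of p r -> hasdiv f p d <-> d \in olds p ++ r.
Proof.
move=> [_ rE]; rewrite mem_cat rE mem_olds; split.
  by case=> [/eqP->//|->]; rewrite andbT orNb.
by case/orP => [/eqP|/andP[_ c0]]; [left|right].
Qed.

Lemma adjusted_form p g : p \in s -> g != 0 ->
  exists r, free_dirs_of p r /\ exists2 g', g' != 0 &
  [/\ mult (pull p g') = mult (pull p g),
     forall d, hasdiv f p d -> -1 <= residue f p g' (Some (ddiv f s p d)) <= 1,
     forall d, hasdiv f p d -> residue f p g' (Some (ddiv f s p d)) = 1 -> olda p d <> None /\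
       (dord d (pull p f) * nval (tdat p) = dweight p d * mult (pull p f))%N &
     forall d, hasdiv f p d -> residue f p g' (Some (ddiv f s p d)) = -1 -> r = [::] \/
       size r = 1%N /\ exists l, [/\ (0 < l)%N, mult (pull p f) = (l * nval (tdat p))%N &
          forall d', olda p d' <> None -> dord d' (pull p f) = (l * dweight p d')%N]].
Proof.
move=> ps g0; have [r [ur rE NE]] := free_dirs p f0; exists r; split=> //.
set D := tdat p; set o := tor D.
have [A1 A2] := tdat_ax p; rewrite -/D -/o in A1 A2.
pose c1 := if ax o p is Some _ then dord (adir o) (pull p f) else 0%N.
pose c2 := if ax (~~ o) p is Some _ then dord (adir (~~ o)) (pull p f) else 0%N.
have oE : (\sum_(d <- olds p) dord d (pull p f) = c1 + c2)%N.
  rewrite big_filter !big_cons big_nil !olda_adir -/o /c1 /c2.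
  by case: (ax o p) => [a|]; case: (ax (~~ o) p) => [b|] /=; rewrite ?addn0.
rewrite oE in NE; have [X1 X2] := old_dord_ge p f0.
have {}X1 : (xplus D * mult (pull p f) <= c1 * nval D)%N.
  rewrite /c1; case E: (ax o p) => [a|] //.
  suff -> : xplus D = 0%N by rewrite !mul0n.
  by rewrite /D (A1 E).
have {}X2 : (xminus D * mult (pull p f) <= c2 * nval D)%N.
  rewrite /c2; case E: (ax (~~ o) p) => [a|] //.
  by have [_ _ e _] := A2 E; rewrite /xminus e !mul0n.
have N0 : (0 < mult (pull p f))%N by apply: mult_pull_gt0.
have gv : gval D (mult (pull p g)).
  have [d [od _ _ d0]] := fresh_free p [::] g0.
  by have [w gw ->] := value_split (@toric_supportP R p) g0 od; rewrite d0 muln0 addn0.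
have c0 d : d \in r -> (0 < dord d (pull p f))%N by rewrite rE => /andP[].
have [w [T [a [ar []]]]] := residue_windows (tdat_det p) (tdat_kn p) (tdat_semigroup p) ur N0 c0 NE
  X1 X2 gv.
rewrite -/D; set S := (\sum_(d <- r) a d + ar)%N; set s0 := _%:R / _%:R.
set a1 := (tm1 D w T + _)%N; set a2 := (tm2 D w T + _)%N.
move=> Gw vE [b1 b2 bj] [t1 t2] [m1 mj].
(* A virtual axis enters with order 0 and k = 1, so the bound 1 on its residue number leaves the
   exponent 0. *)
have z1 : ax o p = None -> a1 = 0%N.
  move=> E; move: b1; rewrite /c1 E mulr0 subr0 => /andP[_]; rewrite -natrD lern1.
  by rewrite {1 2 3}/D (A1 E) /=; lia.
have z2 : ax (~~ o) p = None -> a2 = 0%N.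
  move=> E; move: b2; rewrite /c2 E mulr0 subr0 => /andP[_]; rewrite -natrD lern1.
  by have [_ _ -> ->] := A2 E; lia.
have fr d : d \in r -> olda p d = None by rewrite rE => /andP[/eqP].
have [||g' g'0 []] := @realize p w T r a ar ps ur fr Gw.
- by move=> /z1 /eqP; rewrite addn_eq0 => /andP[/eqP].
- by move=> /z2 /eqP; rewrite addn_eq0 => /andP[/eqP].
rewrite -/D -/S -/o -/a1 -/a2 => mg' dg'; exists g' => //.
have [k1 k2] := tdat_k p; rewrite -/D -/o in k1 k2.
have bN (b b' : bool) : b != b' -> b = ~~ b' by case: b b' => -[].
have kdirE b : kdir p (adir b) = kcomp b p by case: b => //=; rewrite eqxx.
have sE : sigma f p g' = - s0.
  rewrite sigmaE // mg' vE /s0; congr (- (_%:R / _)); congr addn; rewrite knum_exc /kval.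
  by move: k1 k2; rewrite /kcomp /tal /tbe; case: (o) => /= -> ->; ring.
have res d : hasdiv f p d -> [\/ [/\ d = adir o, olda p d <> None & residue f p g' (Some (ddiv f s p d)) =
     (ta1 D * tk D + tb1 D)%:R + a1%:R - s0 * c1%:R],
   [/\ d = adir (~~ o), olda p d <> None & residue f p g' (Some (ddiv f s p d)) =
     (ta2 D * tk D + tb2 D)%:R + a2%:R - s0 * c2%:R] |
   d \in r /\ residue f p g' (Some (ddiv f s p d)) = 1 + (a d)%:R - s0 * (dord d (pull p f))%:R].
  move=> hd; have [cg dg] := dg' d hd; rewrite residue_ddiv // sE dg.
  case E: (olda p d) => [b|]; last first.
    have dr : d \in r by rewrite rE E eqxx; case: hd; rewrite ?E.
    apply: Or33; split=> //; rewrite dr (kdir_none E).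
    have -> : (a1 * (d == adir o) = 0)%N.
      by case: eqP => [dE|_]; rewrite ?muln0 // z1 // -olda_adir -dE.
    have -> : (a2 * (d == adir (~~ o)) = 0)%N.
      by case: eqP => [dE|_]; rewrite ?muln0 // z2 // -olda_adir -dE.
    by rewrite !add0n; ring.
  have -> : d \in r = false by rewrite rE E.
  have [o' dE aE] := olda_some E; rewrite addn0.
  case: (o' =P o) => [o'E|/eqP ne].
    apply: Or31; rewrite dE o'E eqxx (negPf (adir_neq R o)) muln0 addn0 muln1; split=> //.
    by rewrite -k1 /c1 -o'E aE kdirE; ring.
  have o'E := bN _ _ ne.
  apply: Or32; rewrite dE o'E eqxx eq_sym (negPf (adir_neq R o)) muln0 add0n muln1; split=> //.
  by rewrite -k2 /c2 -o'E aE kdirE; ring.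
have c1E : olda p (adir o) <> None -> c1 = dord (adir o) (pull p f).
  by rewrite olda_adir /c1; case: (ax o p).
have c2E : olda p (adir (~~ o)) <> None -> c2 = dord (adir (~~ o)) (pull p f).
  by rewrite olda_adir /c2; case: (ax (~~ o) p).
have olds_eq (d : direction R) : olda p d <> None ->
    (c1 * nval D)%N = (xplus D * mult (pull p f))%N ->
    (c2 * nval D)%N = (xminus D * mult (pull p f))%N ->
  (dord d (pull p f) * nval D = dweight p d * mult (pull p f))%N.
  move=> od; move: (od); case E: (olda p d) => [b|] // _ h1 h2.
  have [o' dE aE] := olda_some E; subst d; case: (o' =P o) => [o'E|/eqP ne].
    by rewrite o'E in od *; rewrite -c1E // h1 dweight_plus.
  have o'E := bN _ _ ne.
  by rewrite o'E in od *; rewrite -c2E // h2 dweight_minus.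
split; first by rewrite mg' vE.
- by move=> d /res[[_ _ ->]|[_ _ ->]|[dr ->]] //; have /andP[-> /ltW] := bj d dr.
- move=> d hd; case: (res d hd) => [[dE od ->] /t1 h|[dE od ->] /t2 h|[dr ->] e].
  + by split=> //; move: od h; rewrite dE dweight_plus => /c1E ->.
  + by split=> //; move: od h; rewrite dE dweight_minus => /c2E ->.
  + by have := bj d dr; rewrite e ltxx andbF.
move=> d hd; case: (res d hd) => [[_ _ ->] e|[_ _ ->] e|[dr ->] e].
- by left; apply: m1; left.
- by left; apply: m1; right.
(* The factor is the order l of f in the only free direction: with n = [nval], the equalities for
   the older ones add up to (n - 1) N, and N n = (n - 1) N + l n. *)
right; have [sz h1 h2] := mj d dr e; split=> //; exists (dord d (pull p f)).
have rd : r = [:: d].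
  by case: (r) sz dr => [|d1 [|//]] // _; rewrite inE => /eqP ->.
have nE := nvalE p; rewrite -/D in nE.
have NE1 : mult (pull p f) = (dord d (pull p f) * nval D)%N.
  have := congr1 (muln^~ (nval D)) NE; rewrite rd big_seq1 /= !mulnDl h1 h2.
  rewrite {1}nE !mulnDr muln1 ![(mult _ * _)%N]mulnC => /eqP.
  by rewrite eqn_add2l => /eqP.
split=> //; first exact: c0.
move=> d' od; have := olds_eq d' od h1 h2; rewrite NE1 mulnA => /eqP.
rewrite eqn_pmul2r; first by move/eqP ->; rewrite mulnC.
by rewrite nE addn1.
Qed.

Lemma valencyP p r : p \in s -> free_dirs_of p r -> valency f s p (size (olds p ++ r)).
Proof.
move=> ps fr; set L := olds p ++ r.
have uL : uniq L.
  have [ur rE] := fr; rewrite cat_uniq uniq_olds ur andbT; apply/hasPn => d.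
  by rewrite rE mem_olds => /andP[/eqP -> _]; rewrite eqxx.
rewrite /valency (_ : [set D | _]%classic =
    [set ddiv f s p (nth None L i) | i in `I_(size L)]%classic).
  apply: inj_card_eq => i j; rewrite !inE /= => iL jL e.
  have {}e := ddiv_inj f0 e; by apply/eqP; rewrite -(nth_uniq None iL jL uL) e.
apply/seteqP; split=> D /=.
  move=> /(adjacentP f0 f00 hs _ ps)[d /(hasdiv_mem _ fr) dL ->].
  by exists (index d L); rewrite ?index_mem //= nth_index.
case=> i iL <-; apply/(adjacentP f0 f00 hs _ ps); eexists; last by [].
by apply/(hasdiv_mem _ fr)/mem_nth.
Qed.

Lemma ddiv_old p d : olda p d <> None -> exists p', ddiv f s p d = Exc p'.
Proof.
rewrite /ddiv; case: (ydepth s p d) => [|m]; last by rewrite ax_optS; exists (pt p d m).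
by rewrite ax_opt0; case: (olda p d) => [a|] // _; exists a.
Qed.

(** The germ H descended from the smooth branch y divides the irreducible Ci, so the two agree up to
    a unit. *)
Lemma curvette_adapted p Ci : p \in s -> curvette f s p Ci ->
  [/\ Ci != 0, mult (pull p Ci) = nval (tdat p) & forall d, olda p d <> None ->
    dord d (pull p Ci) = dweight p d /\ clean f s p d Ci].
Proof.
move=> ps [ir [q [e [n [y [yq /exc_eqP[o aE eE] un CE cs]]]]]].
have [_ [d qE oE]] := ax_on_Y bs yq aE.
have bN : ax (~~ atinf d) (pt p d (ydepth s p d)) = None.
  rewrite -qE -oE; case E: (ax _ _) => [a|] //; exfalso.
  have aS : a \in s by apply: (ax_mem bs (or_introl yq) E).
  have tq : through (Exc a) q by apply/exc_through; exists (~~ o).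
  by have [ap] := un (Exc a) aS tq; apply: (ax_other aE E).
have [m0 od yq' _] := free_point f0 f00 hs ps bN.
have ty : transversal (ori (atinf d) y).
  rewrite -oE; apply: coordinate_system_u; rewrite -(ori_axis R o) -eE.
  by move: cs; case: (o) => //; apply: coordinate_system_tr.
have [H H0 [M [h [[ME eM pH mh] [bh _ dH iH]]]]] := curvette_germ od ty.
have [mH dH'] := curvette_orders H0 ME pH mh ty bh.
have [t tE] : divides H Ci.
  by apply: dH; exists (e ^+ n); rewrite mulrC -CE qE m0.
have Hn : H \isn't a GRing.unit.
  apply/negP => Hu; have : pull p H \is a GRing.unit by rewrite germ_unitE pull00 -germ_unitE.
  by move=> /mult_unit; rewrite mH nvalE addn1.
have [C0 _ ir'] := ir; have [Hu|tu] := ir' _ _ tE; first by rewrite Hu in Hn.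
have pH0 := pull_neq0 p H0; have ptu : pull p t \is a GRing.unit by apply: pull_unit.
have pt0 := unit_neq0 ptu.
have [mt dt] := dord_unit None ptu.
split=> //; first by rewrite tE pullM multM // mH mt addn0.
move=> d' od'; have ne : d' <> d by move=> dd; apply: od'; rewrite dd.
have [_ dt'] := dord_unit d' ptu; split.
  by rewrite tE pullM dordM // dt' addn0 dH' /dweight; move/eqP/negPf: ne => ->.
have nsuf (a b : direction R) : a <> b -> ~~ suffix (a :: p) (b :: p).
  by move=> ab; apply/negP => sab; apply: ab; have := suffix_size_eq sab (suffix_refl _) erefl => -[].
apply: clean_excmono => //; first by left.
rewrite tE pullM; apply: excmonoM; last by apply: excmono_unit; apply: pull_unit.
by apply: iH; apply: nsuf => // /esym.
Qed.

(** * The labels of the adjacent divisors *)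

Variables (p : infpoint) (adj : seq (option (divisor R))).
Hypotheses (ps : p \in s) (hadj : adjacent_labelling f s p adj).

Lemma label_dir j D : nth None adj j = Some D -> exists2 d, hasdiv f p d & D = ddiv f s p d.
Proof.
have [_ adP _ _ _] := hadj; move=> jD; apply/(adjacentP f0 f00 hs _ ps).
by apply/adP; exists j.
Qed.

(** A path leaving p in a free direction stays over [d :: p], where neither E_0 nor any divisor
    created before p lies. *)
Lemma label_old j D d : (j < 2)%N -> nth None adj j = Some D -> D = ddiv f s p d ->
  olda p d <> None.
Proof.
have [_ _ _ P1 P0] := hadj => j2 jD DE od.
have [p' [t [pE tw nt]]] : exists p' t, [/\ D = Exc p', towards s p t p' & ~~ suffix (d :: p) t].
  case: j j2 jD => [|[|//]] _.
    move=> /P0[p' -> [_ [t [ts cb tw]]]]; exists p', t; split=> //.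
    apply/negP => /suffixP[l te]; move: cb ts; rewrite /created_before te => lt ts.
    by have := ltn_trans lt (index_suffix_lt bs ts); rewrite ltnn.
  move=> /P1[p' -> tw]; exists p', [::]; split=> //.
  by apply: suffix_nsize.
case/negP: nt; apply: (towards_free od _ tw).
move: pE; rewrite DE /ddiv; case E: (ax _ _) => [a|] // -[aE]; subst a.
case: (ydepth s p d) E => [|m]; first by rewrite ax_opt0 od.
by rewrite ax_optS => -[<-]; apply: suffix_pt.
Qed.

(** The older divisor a was created before p, and the path towards it starts in the direction d. *)
Lemma old_label j D d : nth None adj j = Some D -> D = ddiv f s p d -> olda p d <> None ->
  j = 0%N \/ j = 1%N.
Proof.
have [_ _ inj P1 P0] := hadj => jD DE; case E: (olda p d) => [a|] // _.
have [p' tw [q [o [yq aE qE oE]]]] := towards_old bs ps E.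
have {DE} DE : D = Exc p' by rewrite DE /ddiv -qE -oE aE.
case: (pselect (towards s p [::] p')) => [tw0|ntw].
  by right; apply: (inj _ _ D) => //; apply/P1; exists p'.
left; apply: (inj _ _ D) => //; apply/P0; exists p' => //; split=> //; exists a.
have [o' _ aE'] := olda_some E.
have [d' [k [pE _]]] := ax_inv aE'.
split=> //; first by apply: (ax_mem bs (or_intror ps) aE').
by have := ps; rewrite /created_before pE; apply: index_suffix_lt.
Qed.

End ResidueNumbers.

Theorem theoremA (R : realType) (f : germ R) (hf0 : f != 0) (hfx : f 0%N 0%N = 0)
    (s : seq (infpoint R)) (hs : minimal_log_resolution f s)
    (p : infpoint R) (hp : p \in s)
    (adj : seq (option (divisor R))) (hadj : adjacent_labelling f s p adj)
    (g : germ R) (hg : g != 0) :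
  exists g' : germ R,
    [/\ g' != 0,
        sigma f p g' = sigma f p g,
        (forall (j : nat) (D : divisor R), nth None adj j = Some D ->
          -1 <= residue f p g' (nth None adj j) <= 1),
        (forall (j : nat) (D : divisor R), nth None adj j = Some D ->
          residue f p g' (nth None adj j) = -1 ->
          [\/ valency f s p 1, valency f s p 2 |
              [/\ valency f s p 3, satellite p &
                forall Ci : germ R, curvette f s p Ci ->
                exists l : nat,
                  [/\ (0 < l)%N,
                      vord (Exc p) f = (l * vord (Exc p) Ci)%N,
                      ovord (nth None adj 0) f = (l * ovord (nth None adj 0) Ci)%N &
                      ovord (nth None adj 1) f = (l * ovord (nth None adj 1) Ci)%N]]]) &
        (forall (j : nat) (D : divisor R), nth None adj j = Some D ->
          residue f p g' (nth None adj j) = 1 ->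
          (j = 0%N \/ j = 1%N) /\
          exists p', D = Exc p' /\ no_arrowheads f s p p')].
Proof.
have [r [fr [g' g'0 [mg' bnd one mone]]]] := adjusted_form hf0 hfx hs hp hg.
have ldir := label_dir hf0 hfx hs hp hadj.
exists g'; split=> //.
- by rewrite !sigmaE // mg'.
- by move=> j D jD; have [d hd DE] := ldir j D jD; rewrite jD DE; apply: bnd.
- move=> j D jD; have [d hd DE] := ldir j D jD; rewrite jD DE => /(mone d hd) e.
  have := valencyP hf0 hfx hs hp fr; rewrite size_cat.
  have o2 : (size (olds p) <= 2)%N by rewrite size_filter; apply: count_size.
  have : (0 < size (olds p) + size r)%N.
    by rewrite -size_cat; have /(hasdiv_mem _ fr) := hd; case: (_ ++ _).
  (* The valency is the number of older directions, at most 2, plus the size of r. If r is empty it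
     is 1 or 2; otherwise r has size 1, and valency 3 means two older directions, a satellite
     point. *)
  case: e => [->|[-> [l [l0 NE oE]]]].
    rewrite addn0; case: (size _) o2 => [|[|[|]]] // _ _ V; [exact: Or31|exact: Or32].
  case E: (size (olds p)) o2 => [|[|[|]]] // _ _ V; [exact: Or31|exact: Or32|apply: Or33].
  split=> //; first exact: olds_satellite.
  move=> Ci hC; have [C0 mC dC] := curvette_adapted hf0 hfx hs hp hC.
  have ov i : (i < 2)%N -> ovord (nth None adj i) f = (l * ovord (nth None adj i) Ci)%N.
    (* An absent divisor gives order 0 to both germs. *)
    move=> i2; case iD: (nth None adj i) => [D'|]; last by rewrite muln0.
    have [d' hd' DE'] := ldir i D' iD.
    have od := label_old hs hadj i2 iD DE'.
    have [dC' cC] := dC d' od.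
    rewrite /ovord DE' !vord_ddiv //; last exact: clean_self.
    by rewrite dC' mC NE oE // mulnDr mulnCA.
  by exists l; split=> //; [rewrite !vord_exc // mC|apply: ov|apply: ov].
- move=> j D jD; have [d hd DE] := ldir j D jD; rewrite jD DE => /(one d hd)[od X].
  split; first exact: (old_label hs hp hadj jD DE od).
  have [p' pE] := ddiv_old f s od; exists p'; split=> //.
  exact: (no_arrowheadsP hf0 hfx hs hp od pE X).
Qed.
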